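(* Let $A$ be a Nakayama algebra. For a simple $A$-module $S$, let $M_S=S$ provided $S$ has finite projective dimension, and $M_S=IS$ otherwise; and let $N_S=S$ provided $S$ has finite injective dimension, and $N_S=PS$ otherwise. Let $d=\max_S\operatorname{pd} M_S$ and $d'=\max_S\operatorname{id} N_S$, where $S$ runs through the simple modules. Then $$\operatorname{fin-pro} A=\operatorname{fin-inj} A=\operatorname{del} A=\operatorname{des} A=d=d'.$$
   Context: A Nakayama algebra is an artin algebra such that all indecomposable modules are serial (i.e. have a unique composition series). Modules are left $A$-modules; $\operatorname{pd}$ and $\operatorname{id}$ denote projective and injective dimension; $PS$ is a projective cover and $IS$ an injective envelope of $S$. $\operatorname{fin-pro} A$ (resp. $\operatorname{fin-inj} A$) is the supremum of $\operatorname{pd} M$ (resp. $\operatorname{id} M$) over the finitely generated modules $M$ for which this number is finite. For finitely generated $M$, $\Omega M$ is the kernel of a projective cover of $M$, and $\Sigma M$ is the cokernel of an injective envelope of $M$; $\Omega^d,\Sigma^d$ denote the iterates, with $\Omega^0M=M=\Sigma^0M$. The delooping level $\operatorname{del} M$ is the smallest $d\ge 0$ such that $\Omega^d M$ is a direct summand of $P\oplus\Omega^{d+1}M'$ for some finitely generated modules $P,M'$ with $P$ projective ($\infty$ if no such $d$ exists). The desuspending level $\operatorname{des} M$ is the smallest $d\ge0$ such that $\Sigma^dM$ is a direct summand of $I\oplus\Sigma^{d+1}M'$ for some finitely generated modules $I,M'$ with $I$ injective ($\infty$ if no such $d$ exists). $\operatorname{del} A=\max_S\operatorname{del} S$ and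 $\operatorname{des} A=\max_S\operatorname{des} S$, where $S$ runs through the simple modules. *)

(* Defs.v *)
From HB Require Import structures.
From mathcomp Require Import all_boot all_order all_algebra.
From mathcomp Require Import boolp classical_sets.

Set Implicit Arguments.
Unset Strict Implicit.
Unset Printing Implicit Defensive.

Import GRing.Theory.

Local Open Scope classical_set_scope.
Local Open Scope ring_scope.

(* Dimensions and levels live in N u {oo}: [Some n] is n, [None] is oo. *)
Definition enat := option nat.
Definition infty : enat := None.

Definition enat_le (u v : enat) : Prop :=
  match u, v with
  | _, None => True
  | None, Some _ => False
  | Some m, Some n => (m <= n)%N
  end.

(* [xget] returns its default value, oo, when P is empty. *)
Definition least (P : set nat) : enat :=
  xget infty [set Some n | n in [set n | P n /\ forall m, P m -> (n <= m)%N]].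

(* The supremum in N u {oo} is the smallest finite upper bound if there is one,
   and oo otherwise; the supremum of the empty set is 0. *)
Definition enat_sup (E : set enat) : enat :=
  least [set n | forall v, E v -> enat_le v (Some n)].

Section Modules.
Variable A : nzRingType.
Implicit Types M N X Y P I K C S : lmodType A.

Definition zero_module M : Prop := forall x : M, x = 0.

Definition iso M N : Prop := exists f : {linear M -> N}, bijective f.

Definition summand M N : Prop := exists X, iso N (M * X)%type.

Definition surjective M N (f : M -> N) : Prop := forall y, exists x, f x = y.

Definition exact M N X (f : M -> N) (g : N -> X) : Prop :=
  forall y, g y = 0 <-> exists x, f x = y.

Definition finitely_generated M : Prop :=
  exists (n : nat) (s : 'I_n -> M),
    forall x, exists c : 'I_n -> A, x = \sum_(i < n) c i *: s i.

Definition artinian M : Prop :=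
  forall N : nat -> {pred M},
    (forall i, submod_closed (N i)) ->
    (forall i, {subset N i.+1 <= N i}) ->
    exists n, forall m, (n <= m)%N -> N m =i N n.

Definition simple_module S : Prop :=
  ~ zero_module S /\
  forall N : {pred S}, submod_closed N ->
    (forall x, x \in N -> x = 0) \/ (forall x, x \in N).

Definition indecomposable M : Prop :=
  ~ zero_module M /\
  forall X Y, iso M (X * Y)%type -> zero_module X \/ zero_module Y.

(* U is a maximal proper submodule of V, i.e. V / U is simple. *)
Definition maximal_submodule M (U V : {pred M}) : Prop :=
  [/\ {subset U <= V}, ~ {subset V <= U} &
      forall W : {pred M}, submod_closed W ->
        {subset U <= W} -> {subset W <= V} -> W =i U \/ W =i V].

(* 0 = N 0 < N 1 < ... < N n = M; the values N i for i > n are irrelevant. *)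
Definition composition_series M (n : nat) (N : nat -> {pred M}) : Prop :=
  [/\ forall i, (i <= n)%N -> submod_closed (N i),
      forall x, x \in N 0%N <-> x = 0,
      forall x, x \in N n &
      forall i, (i < n)%N -> maximal_submodule (N i) (N i.+1)].

Definition serial M : Prop :=
  exists (n : nat) (N : nat -> {pred M}), composition_series n N /\
    forall (n' : nat) (N' : nat -> {pred M}), composition_series n' N' ->
      n' = n /\ forall i, (i <= n)%N -> N' i =i N i.

Definition projective P : Prop :=
  forall X Y (p : {linear X -> Y}) (g : {linear P -> Y}), surjective p ->
    exists h : {linear P -> X}, forall x, p (h x) = g x.

Definition injective_module I : Prop :=
  forall X Y (i : {linear X -> Y}) (g : {linear X -> I}), injective i ->
    exists h : {linear Y -> I}, forall x, h (i x) = g x.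

(* ... -> P 1 -> P 0 -> M -> 0 *)
Definition projective_resolution M (P : nat -> lmodType A)
    (d : forall i, {linear P i.+1 -> P i}) (e : {linear P 0%N -> M}) : Prop :=
  [/\ forall i, projective (P i), surjective e, exact (d 0%N) e &
      forall i, exact (d i.+1) (d i)].

(* 0 -> M -> I 0 -> I 1 -> ... *)
Definition injective_resolution M (I : nat -> lmodType A)
    (e : {linear M -> I 0%N}) (d : forall i, {linear I i -> I i.+1}) : Prop :=
  [/\ forall i, injective_module (I i), injective e, exact e (d 0%N) &
      forall i, exact (d i) (d i.+1)].

Definition pdim M : enat :=
  least [set n | exists (P : nat -> lmodType A)
      (d : forall i, {linear P i.+1 -> P i}) (e : {linear P 0%N -> M}),
    projective_resolution d e /\ forall i, (n < i)%N -> zero_module (P i)].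

Definition idim M : enat :=
  least [set n | exists (I : nat -> lmodType A)
      (e : {linear M -> I 0%N}) (d : forall i, {linear I i -> I i.+1}),
    injective_resolution e d /\ forall i, (n < i)%N -> zero_module (I i)].

(* Surjective, from a projective module, with superfluous kernel. *)
Definition projective_cover P M (f : {linear P -> M}) : Prop :=
  [/\ projective P, surjective f &
      forall N : {pred P}, submod_closed N ->
        (forall x, exists2 y, y \in N & f (x - y) = 0) ->
        forall x, x \in N].

(* Injective, into an injective module, with essential image. *)
Definition injective_envelope M I (f : {linear M -> I}) : Prop :=
  [/\ injective_module I, injective f &
      forall N : {pred I}, submod_closed N ->
        (exists2 x, x \in N & x <> 0) ->
        exists2 y, f y \in N & f y <> 0].

(* Covers, envelopes, syzygies and cosyzygies are only defined up to
   isomorphism, so they are rendered as relations. *)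
Definition is_PC M P : Prop := exists f : {linear P -> M}, projective_cover f.

Definition is_IE M I : Prop := exists f : {linear M -> I}, injective_envelope f.

(* K is (isomorphic to) Omega M. *)
Definition is_syzygy M K : Prop :=
  exists P (f : {linear P -> M}) (i : {linear K -> P}),
    [/\ projective_cover f, injective i & exact i f].

(* C is (isomorphic to) Sigma M. *)
Definition is_cosyzygy M C : Prop :=
  exists I (f : {linear M -> I}) (p : {linear I -> C}),
    [/\ injective_envelope f, surjective p & exact f p].

Fixpoint is_Omega (d : nat) M N : Prop :=
  match d with
  | 0%N => iso M N
  | d'.+1 => exists K, is_Omega d' M K /\ is_syzygy K N
  end.

Fixpoint is_Sigma (d : nat) M N : Prop :=
  match d with
  | 0%N => iso M N
  | d'.+1 => exists C, is_Sigma d' M C /\ is_cosyzygy C N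
  end.

Definition del M : enat :=
  least [set d | exists N P M' N',
    [/\ is_Omega d M N,
        finitely_generated P /\ projective P,
        finitely_generated M',
        is_Omega d.+1 M' N' &
        summand N (P * N')%type]].

Definition des M : enat :=
  least [set d | exists N I M' N',
    [/\ is_Sigma d M N,
        finitely_generated I /\ injective_module I,
        finitely_generated M',
        is_Sigma d.+1 M' N' &
        summand N (I * N')%type]].

(* X is M_S: S itself if pd S is finite, IS otherwise. *)
Definition is_MS S X : Prop :=
  (pdim S <> infty /\ iso S X) \/ (pdim S = infty /\ is_IE S X).

(* X is N_S: S itself if id S is finite, PS otherwise. *)
Definition is_NS S X : Prop :=
  (idim S <> infty /\ iso S X) \/ (idim S = infty /\ is_PC S X).

End Modules.

Definition fin_pro (A : nzRingType) : enat :=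
  enat_sup [set v | exists M : lmodType A,
    [/\ finitely_generated M, pdim M <> infty & v = pdim M]].

Definition fin_inj (A : nzRingType) : enat :=
  enat_sup [set v | exists M : lmodType A,
    [/\ finitely_generated M, idim M <> infty & v = idim M]].

(* An artin algebra has only finitely many simple modules up to isomorphism, so
   the suprema below over the simple modules are maxima. *)
Definition del_alg (A : nzRingType) : enat :=
  enat_sup [set v | exists S : lmodType A, simple_module S /\ v = del S].

Definition des_alg (A : nzRingType) : enat :=
  enat_sup [set v | exists S : lmodType A, simple_module S /\ v = des S].

Definition max_pd_MS (A : nzRingType) : enat :=
  enat_sup [set v | exists S X : lmodType A,
    [/\ simple_module S, is_MS S X & v = pdim X]].

Definition max_id_NS (A : nzRingType) : enat :=
  enat_sup [set v | exists S X : lmodType A,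
    [/\ simple_module S, is_NS S X & v = idim X]].

Definition artin_algebra (k : comNzRingType) (A : algType k) : Prop :=
  artinian k^o /\ finitely_generated (A : lmodType k).

(* Only the finitely generated indecomposable modules are required to be
   serial; for artin algebras this implies the same for all indecomposables. *)
Definition nakayama_algebra (k : comNzRingType) (A : algType k) : Prop :=
  artin_algebra A /\
  forall M : lmodType A,
    finitely_generated M -> indecomposable M -> serial M.

(* Main.v *)
From HB Require Import structures.
Require Import Defs.
From mathcomp Require Import all_boot all_algebra.
From mathcomp Require Import generic_quotient ring_quotient.
From mathcomp Require Import boolp classical_sets.

Set Implicit Arguments.
Unset Strict Implicit.
Unset Printing Implicit Defensive.

Import GRing.Theory.

Local Open Scope quotient_scope.
Local Open Scope ring_scope.

(** All six numbers are equal because each of the inequalities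
    [fin_inj <= del <= max_pd_MS <= fin_pro <= des <= max_id_NS <= fin_inj]
    holds, and going once around the cycle forces equality.

    The first inequality and its dual [fin_pro <= des] compare vanishing
    Ext groups.  If [id M = n + 1], the last but one cosyzygy [C] of [M] is not
    injective, so [Ext^1(S, C) <> 0] for a simple [S].  Were [del S = m <= n],
    then [Omega^m S] would be a summand of [P + Omega^(m+1) M'], and dimension
    shifting would embed [Ext^1(S, C)] into [Ext^1(M', J)] with [J] injective
    ([fin_inj_le_del], [fin_pro_le_des], [Ext0_syz_cosyz]).

    The second inequality and its dual [des <= max_id_NS] use the sequence
    [0 -> S -> IS -> C -> 0]: if [pd IS <= n], then taking syzygies of the whole
    sequence by the horseshoe lemma makes the middle term projective after [n]
    steps, so that [Omega^n S] is a summand of a projective plus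
    [Omega^(n+1) C] ([Omega_summand], [Sigma_summand]).

    The third inequality says that [pd IS] is finite when [pd S] is infinite;
    here uniserial modules enter.  Write [R => T] if [T] is a composition factor
    of [Omega^2 R].  If [0 -> L -> Q -> Omega R -> 0] is a projective cover and
    [T = Y / Y'] with [Y' < Y <= L], then [Q / Y'] is the injective envelope of
    [T] ([injective_quotient]).  Consequently a simple module has at most one
    predecessor for [=>], and [Omega^2 R] is multiplicity free.  A simple module
    of infinite projective dimension has a successor of the same kind, so, there
    being finitely many simple modules, [=>] restricts to a permutation of the
    simple modules of infinite projective dimension ([simple_graph]).  If [S] is
    one of them and [R] its predecessor, then [IS = Q / Y'] where all
    composition factors of [Y'] are successors of [R] other than [S]; they have
    finite projective dimension, and so have [Y'] and [IS]
    ([envelope_pd_finite], and dually [cover_id_finite]).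

    The structure theory behind this is that a finitely generated module is a
    finite direct sum of uniserial modules ([artinian_uniserial_sum]).  Hence
    uniserial modules have uniserial projective covers, and a simple module has
    a uniserial injective envelope, namely a uniserial module of maximal length
    containing it ([simple_envelope]). *)

(** * Linear maps, submodules and quotient modules *)

(** Linear maps are obtained existentially from their values throughout, so that
    no packed structure has to be unfolded later. *)
Lemma mk_linear (A : nzRingType) (M N : lmodType A) (f : M -> N) :
  (forall a x y, f (a *: x + y) = a *: f x + f y) ->
  exists g : {linear M -> N}, forall x, g x = f x.
Proof.
move=> fl.
pose F := GRing.isLinear.Build A M N *:%R f fl.
pose g : {linear M -> N} := HB.pack f F.
by exists g.
Qed.

Section SubQuot.
Variables (A : nzRingType) (M : lmodType A) (Q : M -> Prop).

(** Submodules are handled as arbitrary propositional predicates; [pred_of]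
    turns them into the decidable predicates of the definitions. *)
Definition psub : Prop := Q 0 /\ forall a x y, Q x -> Q y -> Q (a *: x + y).

Definition pred_of : {pred M} := fun x => `[< Q x >].

Lemma in_pred_of x : (x \in pred_of) <-> Q x.
Proof. by rewrite unfold_in; split=> /asboolP. Qed.

Lemma pred_of_closed : psub -> submod_closed pred_of.
Proof.
by case=> q0 qD; split; [apply/in_pred_of|move=> a x y /in_pred_of ?
  /in_pred_of ?; apply/in_pred_of/qD].
Qed.

Hypothesis Qs : psub.

Let Qcl := GRing.isSubmodClosed.Build A M pred_of (pred_of_closed Qs).
HB.instance Definition _ := Qcl.

Record submodule := Submodule { submodule_val : M;
  _ : submodule_val \in pred_of }.
HB.instance Definition _ := [isSub for submodule_val].
HB.instance Definition _ := [Choice of submodule by <:].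
HB.instance Definition _ := [SubChoice_isSubLmodule of submodule by <:].

Lemma submodule_exists : exists (N : lmodType A) (i : {linear N -> M}),
  injective i /\ forall x, Q x <-> exists y, i y = x.
Proof.
exists (submodule : lmodType A), (\val : {linear submodule -> M}); split;
  first exact: val_inj.
move=> x; split=> [/in_pred_of qx|[y <-]]; first by exists (Submodule qx).
by apply/in_pred_of/valP.
Qed.

Let pred_ofI : zmodClosed M := [the zmodClosed M of pred_of].
Definition quotient_module := Quotient.quot pred_ofI.
HB.instance Definition _ := GRing.Zmodule.on quotient_module.

Definition quotient_module_pi (x : M) : quotient_module :=
  \pi_quotient_module x.

Lemma quotient_module_piE x y : (quotient_module_pi x = quotient_module_pi y)
  <-> Q (x - y).
Proof.
rewrite /quotient_module_pi; split.
  by move/eqP; rewrite eqmodE => /in_pred_of.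
by move=> q; apply/eqP; rewrite eqmodE; apply/in_pred_of.
Qed.

Lemma quotient_module_piK x : quotient_module_pi (repr x) = x.
Proof. exact: reprK. Qed.

Definition quotient_module_scale (a : A) (x : quotient_module) :
  quotient_module := quotient_module_pi (a *: repr x).

Lemma psubB x y : Q x -> Q y -> Q (x - y).
Proof. by case: Qs => _ qD qx qy; rewrite -scaleN1r addrC; apply: qD. Qed.

Lemma psubZ a x : Q x -> Q (a *: x).
Proof. by case: Qs => q0 qD qx; rewrite -[_ *: _]addr0; apply: qD. Qed.

Lemma quotient_module_scaleE a x :
  quotient_module_scale a (quotient_module_pi x) = quotient_module_pi (a *: x).
Proof.
by apply/quotient_module_piE; rewrite -scalerBr; apply: psubZ;
  apply/quotient_module_piE/quotient_module_piK.
Qed.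

Lemma quotient_module_piD x y :
  quotient_module_pi (x + y) = quotient_module_pi x + quotient_module_pi y.
Proof. exact: (raddfD (\pi_quotient_module)). Qed.

Fact quotient_module_scaleA a b v : quotient_module_scale a
  (quotient_module_scale b v) = quotient_module_scale (a * b) v.
Proof. by rewrite -(quotient_module_piK v) !quotient_module_scaleE scalerA. Qed.
Fact quotient_module_scale1 : left_id 1 quotient_module_scale.
Proof. by move=> v; rewrite -(quotient_module_piK v) quotient_module_scaleE
  scale1r. Qed.
Fact quotient_module_scaleDr : right_distributive quotient_module_scale +%R.
Proof.
move=> a u v; rewrite -(quotient_module_piK u) -(quotient_module_piK v)
  !quotient_module_scaleE -!quotient_module_piD.
by rewrite quotient_module_scaleE scalerDr.
Qed.
Fact quotient_module_scaleDl v : {morph quotient_module_scale^~ v : a b / a +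
  b}.
Proof.
by move=> a b; rewrite -(quotient_module_piK v) !quotient_module_scaleE
  -!quotient_module_piD scalerDl.
Qed.
HB.instance Definition _ := GRing.Zmodule_isLmodule.Build A quotient_module
  quotient_module_scaleA quotient_module_scale1 quotient_module_scaleDr
    quotient_module_scaleDl.

Lemma quotient_exists : exists (N : lmodType A) (p : {linear M -> N}),
  (forall y, exists x, p x = y) /\ forall x, p x = 0 <-> Q x.
Proof.
have [|p pE] := @mk_linear A M quotient_module quotient_module_pi.
  by move=> a x y; rewrite quotient_module_piD -quotient_module_scaleE.
exists (quotient_module : lmodType A), p; split=> [y|x].
  by exists (repr y); rewrite pE quotient_module_piK.
rewrite pE; have -> : 0 = quotient_module_pi 0 by rewrite -[RHS]pE linear0.
by rewrite quotient_module_piE subr0.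
Qed.
End SubQuot.

Section Toolkit.
Variable A : nzRingType.
Implicit Types M N K L X Y Z P I C S T U V E Q : lmodType A.

Definition short_exact X Y Z (i : {linear X -> Y}) (p : {linear Y ->
  Z}) : Prop :=
  [/\ injective i, surjective p & exact i p].

Lemma psub_ker M N (f : {linear M -> N}) : psub (fun x => f x = 0).
Proof.
by split=> [|a x y fx fy]; rewrite ?linear0 // linearP fx fy scaler0 addr0.
Qed.

Lemma psub_im M N (f : {linear M -> N}) : psub (fun y => exists x, f x = y).
Proof.
split=> [|a _ _ [x <-] [y <-]]; first by exists 0; rewrite linear0.
by exists (a *: x + y); rewrite linearP.
Qed.

Lemma psub_preim M N (f : {linear M -> N}) (Q : N -> Prop) :
  psub Q -> psub (fun x => Q (f x)).
Proof.
by case=> q0 qD; split=> [|a x y]; rewrite ?linear0 // linearP; apply: qD.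
Qed.

Lemma psub_img M N (f : {linear M -> N}) (Q : M -> Prop) :
  psub Q -> psub (fun y => exists2 x, Q x & f x = y).
Proof.
case=> q0 qD; split=> [|a _ _ [x qx <-] [y qy <-]].
  by exists 0; rewrite ?linear0.
by exists (a *: x + y); rewrite ?linearP //; apply: qD.
Qed.

Lemma psub_all M : psub (fun _ : M => True). Proof. by []. Qed.

Lemma psub_zero M : psub (fun x : M => x = 0).
Proof. by split=> // a x y -> ->; rewrite scaler0 addr0. Qed.

Lemma psubD M (Q : M -> Prop) x y : psub Q -> Q x -> Q y -> Q (x + y).
Proof. by case=> _ qD qx qy; rewrite -[x]scale1r; apply: qD. Qed.

Lemma psubN M (Q : M -> Prop) x : psub Q -> Q x -> Q (- x).
Proof. by move=> Qs qx; rewrite -scaleN1r; apply: psubZ. Qed.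

Lemma closed_psub M (W : {pred M}) : submod_closed W -> psub (fun x => x \in W).
Proof. by case=> w0 wD; split=> // a x y; apply: wD. Qed.

Lemma inj0 M N (f : {linear M -> N}) :
  (forall x, f x = 0 -> x = 0) -> injective f.
Proof. exact: raddf_inj. Qed.

Lemma inj0P M N (f : {linear M -> N}) x : injective f -> f x = 0 -> x = 0.
Proof. by move=> fI fx; apply: fI; rewrite linear0. Qed.

Lemma ker_exists M N (f : {linear M -> N}) :
  exists K (i : {linear K -> M}), injective i /\ exact i f.
Proof. exact: submodule_exists (psub_ker f). Qed.

Lemma coker_exists M N (f : {linear M -> N}) :
  exists C (p : {linear N -> C}), surjective p /\ exact f p.
Proof. exact: quotient_exists (psub_im f). Qed.

Lemma short_exact_ker M N (f : {linear M -> N}) : surjective f ->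
  exists K (i : {linear K -> M}), short_exact i f.
Proof. by move=> fS; have [K [i [? ?]]] := ker_exists f; exists K, i. Qed.

Lemma short_exact_coker M N (f : {linear M -> N}) : injective f ->
  exists C (p : {linear N -> C}), short_exact f p.
Proof. by move=> fI; have [C [p [? ?]]] := coker_exists f; exists C, p. Qed.

Lemma short_exact0 X Y Z (i : {linear X -> Y}) (p : {linear Y -> Z}) x :
  short_exact i p -> p (i x) = 0.
Proof. by case=> _ _ e; apply/e; exists x. Qed.

Lemma short_exact_lift X Y Z (i : {linear X -> Y}) (p : {linear Y -> Z}) y :
  short_exact i p -> p y = 0 -> exists x, i x = y.
Proof. by case=> _ _ e /e. Qed.

Lemma factor_surj M Q N (p : {linear M -> Q}) (f : {linear M -> N}) :
  surjective p -> (forall x, p x = 0 -> f x = 0) ->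
  exists g : {linear Q -> N}, forall x, g (p x) = f x.
Proof.
move=> pS pf; have [r rE] := choice pS.
have rf x y : p x = p y -> f x = f y.
  move=> e; apply/eqP; rewrite -subr_eq0 -linearB; apply/eqP/pf.
  by rewrite linearB e subrr.
have [|g gE] := @mk_linear A Q N (f \o r).
  by move=> a x y /=; rewrite -linearP; apply: rf; rewrite linearP !rE.
by exists g => x; rewrite gE /=; apply: rf; rewrite rE.
Qed.

Lemma factor_inj K M N (i : {linear K -> M}) (f : {linear N -> M}) :
  injective i -> (forall x, exists y, i y = f x) ->
  exists g : {linear N -> K}, forall x, i (g x) = f x.
Proof.
move=> iI fi; have [r rE] := choice fi.
have [|g gE] := @mk_linear A N K r.
  by move=> a x y; apply: iI; rewrite linearP !rE linearP.
by exists g => x; rewrite gE.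
Qed.

Lemma img_exists M N (f : {linear M -> N}) :
  exists I (q : {linear M -> I}) (j : {linear I -> N}),
    [/\ surjective q, injective j & forall x, j (q x) = f x].
Proof.
have [I [j [jI jE]]] := submodule_exists (psub_im f).
have [|q qE] := factor_inj jI (f := f); first by move=> x; apply/jE; exists x.
exists I, q, j; split=> // y.
have /jE[x fx] : exists z, j z = j y by exists y.
by exists x; apply: jI; rewrite qE.
Qed.

Lemma iso_intro M N (f : {linear M -> N}) : injective f -> surjective f ->
  iso M N.
Proof.
move=> fI fS; have [g gE] := choice fS; exists f, g => // x.
by apply: fI; rewrite gE.
Qed.

Lemma isoE M N : iso M N -> exists (f : {linear M -> N}) (g : {linear N -> M}),
  (forall x, g (f x) = x) /\ (forall y, f (g y) = y).
Proof.
case=> f [g fK gK]; have fI := can_inj fK.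
have [|h hE] := factor_inj fI (f := idfun : {linear N -> N}).
  by move=> y; exists (g y); rewrite gK.
by exists f, h; split=> // x; apply: fI; rewrite hE.
Qed.

Lemma iso_refl M : iso M M.
Proof. by apply: (iso_intro (f := idfun)) => // x; exists x. Qed.

Lemma iso_sym M N : iso M N -> iso N M.
Proof. by case/isoE=> f [g [fK gK]]; exists g; exists f. Qed.

Lemma iso_trans N M P : iso M N -> iso N P -> iso M P.
Proof.
by case=> f fB [g gB]; exists (g \o f : {linear M -> P}); apply: bij_comp.
Qed.

Lemma pair_map Z M N (f : {linear Z -> M}) (g : {linear Z -> N}) :
  exists h : {linear Z -> (M * N)%type}, forall z, h z = (f z, g z).
Proof. by apply: mk_linear => a x y; rewrite !linearP. Qed.

Lemma copair_map Z M N (f : {linear M -> Z}) (g : {linear N -> Z}) :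
  exists h : {linear (M * N)%type -> Z}, forall x, h x = f x.1 + g x.2.
Proof.
by apply: mk_linear => a x y; rewrite !linearP /= scalerDr addrACA.
Qed.

Lemma diff_map M N (f g : {linear M -> N}) :
  exists h : {linear M -> N}, forall x, h x = f x - g x.
Proof.
by apply: mk_linear => a x y; rewrite (linearP f) (linearP g) scalerBr opprD
  addrACA.
Qed.

Lemma zero_map M N : exists h : {linear M -> N}, forall x, h x = 0.
Proof. by apply: mk_linear => a x y; rewrite scaler0 addr0. Qed.

(** * Pullbacks, pushouts and the vanishing of the first Ext group *)

(** [E] is the fibre product of [X] and [Y] over [Z]. *)
Lemma pullback X Y Z K (f : {linear X -> Z}) (p : {linear Y -> Z})
    (i : {linear K -> Y}) : short_exact i p ->
  exists E (a : {linear E -> Y}) (b : {linear E -> X}) (k : {linear K -> E}),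
  [/\ short_exact k b, forall e, p (a e) = f (b e), forall x, a (k x) = i x,
      forall x y, f x = p y -> exists e, a e = y /\ b e = x
    & forall e, a e = 0 -> b e = 0 -> e = 0].
Proof.
move=> s; have [iI pS ip] := s.
have [c cE] := copair_map f p.
have [n nE] := zero_map X Y.
have [d dE] := @mk_linear _ (X * Y)%type Z (fun x => f x.1 - p x.2)
  ltac:(by move=> a x y /=; rewrite (linearP f) (linearP p) scalerBr opprD
    addrACA).
have [E [j [jI jE]]] := ker_exists d.
have [n' n'E] := zero_map K X.
have [k0 k0E] := pair_map n' i.
have [|k kE] := factor_inj jI (f := k0).
  by move=> x; apply/jE; rewrite dE k0E n'E /= (short_exact0 _ s) linear0 subrr.
exists E, (snd \o j : {linear E -> Y}), (fst \o j : {linear E -> X}), k => /=.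
have pf e : p (j e).2 = f (j e).1.
  have /jE : exists y, j y = j e by exists e.
  by rewrite dE => /eqP; rewrite subr_eq0 => /eqP ->.
have ff x y : f x = p y -> exists e, (j e).2 = y /\ (j e).1 = x.
  move=> e; have /jE[z zE] : d (x, y) = 0 by rewrite dE /= e subrr.
  by exists z; rewrite zE.
split=> //.
- split=> [|x|e] /=.
  + apply: inj0 => x kx; apply: (inj0P iI).
    by have := kE x; rewrite kx linear0 k0E => -[_ <-].
  + by have [y /esym/ff[e [_ ?]]] := pS (f x); exists e.
  + split=> [e1|[x <-]]; last by rewrite kE k0E n'E.
    have /ip[x xE] : p (j e).2 = 0 by rewrite pf e1 linear0.
    by exists x; apply: jI; rewrite kE k0E n'E xE -e1; case: (j e).
- by move=> x; rewrite kE k0E.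
- by move=> e e2 e1; apply: (inj0P jI); case: (j e) e1 e2 => u v /= -> ->.
Qed.

(** [E] is the amalgamated sum of [X] and [Y] along [K]. *)
Lemma pushout X Y Z K (f : {linear K -> X}) (p : {linear Y -> Z})
    (i : {linear K -> Y}) : short_exact i p ->
  exists E (a : {linear Y -> E}) (b : {linear X -> E}) (q : {linear E -> Z}),
  [/\ short_exact b q, forall x, a (i x) = b (f x), forall y, q (a y) = p y,
      forall e, exists y x, e = a y + b x
    & forall y x, a y + b x = 0 -> exists k, y = i k /\ x = - f k].
Proof.
move=> s; have [iI pS ip] := s.
have [d dE] := @mk_linear _ K (Y * X)%type (fun k => (i k, - f k))
  ltac:(by move=> a x y /=; rewrite (linearP i) (linearP f) opprD -scalerN).
have [E [c [cS cE]]] := coker_exists d.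
have [ny nyE] := zero_map X Y; have [nx nxE] := zero_map Y X.
have [a aE] := pair_map (idfun : {linear Y -> Y}) nx.
have [b bE] := pair_map ny (idfun : {linear X -> X}).
have [|q qE] := factor_surj cS (f := p \o fst : {linear (Y * X)%type -> Z}).
  by move=> x /cE[k <-]; rewrite dE /= (short_exact0 _ s).
exists E, (c \o a : {linear Y -> E}), (c \o b : {linear X -> E}), q => /=.
have cab y x : c (a y) + c (b x) = c (y, x).
  by rewrite -linearD aE bE nxE nyE /=; congr (c (_, _)); rewrite ?addr0 ?add0r.
split.
- split=> [|z|e].
  + apply: inj0 => x /= /cE[k]; rewrite dE bE nyE /= => -[ik <-].
    by rewrite (inj0P iI ik) linear0 oppr0.
  + by have [y yE] := pS z; exists (c (a y)); rewrite qE aE.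
  + split=> [qe|[x <-] /=]; last by rewrite qE bE nyE /= linear0.
    have [[y x] eE] := cS e; move: qe; rewrite -eE qE /= => /ip[k <-].
    exists (x + f k); apply/eqP; rewrite -subr_eq0 -linearB; apply/eqP/cE.
    exists (- k); rewrite dE bE nyE !linearN opprK /=.
    by congr (_, _); rewrite /= ?sub0r // addrC addKr.
- move=> x; apply/eqP; rewrite -subr_eq0 -linearB; apply/eqP/cE.
  by exists x; rewrite dE aE bE nxE nyE; congr (_, _); rewrite /= ?subr0 ?sub0r.
- by move=> y; rewrite qE aE.
- by move=> e; have [[y x] <-] := cS e; exists y, x; rewrite cab.
- by move=> y x; rewrite cab => /cE[k]; rewrite dE => -[<- <-]; exists k.
Qed.

(** The vanishing of [Ext^1(X, M)]: [Ext0] lets maps out of [X] be lifted along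
    epimorphisms with kernel [M], [Ext0'] lets maps into [M] be extended along
    monomorphisms with cokernel [X].  No Ext group has to be constructed. *)
Definition Ext0 X M : Prop :=
  forall E Y (i : {linear M -> E}) (p : {linear E -> Y}), short_exact i p ->
  forall f : {linear X -> Y}, exists h : {linear X ->
    E}, forall x, p (h x) = f x.

Definition Ext0' X M : Prop :=
  forall K E (i : {linear K -> E}) (p : {linear E -> X}), short_exact i p ->
  forall f : {linear K -> M}, exists h : {linear E ->
    M}, forall x, h (i x) = f x.

(** Push out along a map into [M], respectively pull back along a map out of
    [X], and split the resulting extension of [X] by [M]. *)
Lemma Ext0P X M : Ext0 X M <-> Ext0' X M.
Proof.
split=> V.
- move=> K E i p s f; have [E' [a [b [q [s' abf qap _ inv]]]]] := pushout f s.
  have [h hE] := V _ _ _ _ s' (idfun : {linear X -> X}).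
  have [d dE] := diff_map a (h \o p : {linear E -> E'}).
  have [bI _ _] := s'; have [|g gE] := factor_inj bI (f := d).
    by move=> x; apply: (short_exact_lift s'); rewrite dE /= linearB hE qap
      subrr.
  exists g => x; apply: bI; rewrite gE dE /= abf (short_exact0 _ s) linear0.
  by rewrite subr0.
- move=> E Y i p s f; have [E' [a [b [k [s' paf aki _ _]]]]] := pullback f s.
  have [r rE] := V _ _ _ _ s' (idfun : {linear M -> M}).
  have [d dE] := diff_map a (i \o r : {linear E' -> E}).
  have [_ bS _] := s'; have [|g gE] := factor_surj bS (f := d).
    by move=> e /(short_exact_lift s')[x <-]; rewrite dE /= rE aki subrr.
  exists g => x; have [e <-] := bS x.
  by rewrite gE dE /= linearB paf (short_exact0 _ s) subr0.
Qed.

Lemma Ext0_proj P M : projective P -> Ext0 P M.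
Proof. by move=> Pp E Y i p [_ pS _] f; apply: Pp. Qed.

Lemma Ext0_inj X I : injective_module I -> Ext0 X I.
Proof. by move=> Ii; apply/Ext0P => K E i p [iI _ _] f; apply: Ii. Qed.

(** One projective presentation of [X] decides [Ext^1(X, M)]: any epimorphism
    onto [X] is dominated by it. *)
Lemma Ext0_of_proj K P X (i : {linear K -> P}) (p : {linear P -> X}) M :
  projective P -> short_exact i p ->
  (forall f : {linear K -> M}, exists h : {linear P ->
    M}, forall x, h (i x) = f x) ->
  Ext0 X M.
Proof.
move=> Pp s V; apply/Ext0P => K1 E i1 p1 s1 f.
have [i1I p1S _] := s1; have [iI pS _] := s.
have [l lE] := Pp _ _ _ p p1S.
have [|k kE] := factor_inj i1I (f := l \o i : {linear K -> E}).
  by move=> x; apply: (short_exact_lift s1); rewrite /= lE (short_exact0 _ s).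
have [t tE] := V (f \o k : {linear K -> M}).
have [c cE] := copair_map l i1; have [d dE] := copair_map t f.
have cS : surjective c.
  move=> e; have [y yE] := pS (p1 e).
  have [x xE] : exists x, i1 x = e - l y.
    by apply: (short_exact_lift s1); rewrite linearB lE yE subrr.
  by exists (y, x); rewrite cE /= xE addrC subrK.
have [|h hE] := factor_surj cS (f := d).
  move=> [y x]; rewrite cE dE /= => e.
  have [z zE] : exists z, i z = y.
    apply: (short_exact_lift s); have := congr1 p1 e.
    by rewrite linearD lE (short_exact0 _ s1) linear0 addr0.
  rewrite -zE tE /= -linearD.
  have -> : k z + x = 0; last by rewrite linear0.
  by apply: (inj0P i1I); rewrite linearD kE /= zE.
exists h => x; have -> : i1 x = c (0, x) by rewrite cE /= linear0 add0r.
by rewrite hE dE /= linear0 add0r.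
Qed.

Lemma Ext0_of_inj X M I C (i : {linear M -> I}) (p : {linear I -> C}) :
  injective_module I -> short_exact i p ->
  (forall f : {linear X -> C}, exists h : {linear X ->
    I}, forall x, p (h x) = f x) ->
  Ext0 X M.
Proof.
move=> Ii s V E Y i1 p1 s1 f.
have [i1I p1S _] := s1; have [iI pS _] := s.
have [l lE] := Ii _ _ i1 i i1I.
have [|k kE] := factor_surj p1S (f := p \o l : {linear E -> C}).
  by move=> x /(short_exact_lift s1)[y <-]; rewrite /= lE (short_exact0 _ s).
have [t tE] := V (k \o f : {linear X -> C}).
have [c cE] := pair_map l p1; have [d dE] := pair_map t f.
have cI : injective c.
  apply: inj0 => e; rewrite cE => -[le /(short_exact_lift s1)[x xE]].
  by rewrite -xE; move: le; rewrite -xE lE => /(inj0P iI) ->; rewrite linear0.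
have [|h hE] := factor_inj cI (f := d).
  move=> x; have [e eE] := p1S (f x).
  have [m mE] : exists m, i m = t x - l e.
    by apply: (short_exact_lift s); rewrite linearB tE /= -eE kE subrr.
  exists (e + i1 m); rewrite cE dE; congr (_, _).
    by rewrite linearD lE mE addrC subrK.
  by rewrite linearD (short_exact0 _ s1) addr0.
by exists h => x; have := hE x; rewrite cE dE => -[].
Qed.

(** [Ext^1(Omega X, M) = Ext^1(X, Sigma M)]: both vanish if and only if every
    map from [K] to [C] lifts to [I], equivalently extends to [P]. *)
Lemma Ext0_shift K P X (i : {linear K -> P}) (p : {linear P -> X})
    M I C (j : {linear M -> I}) (q : {linear I -> C}) :
  projective P -> short_exact i p -> injective_module I -> short_exact j q ->
  Ext0 K M <-> Ext0 X C.
Proof.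
move=> Pp s Ii s'; have [iI pS _] := s; have [jI qS _] := s'; split=> V.
- apply: (Ext0_of_proj Pp s) => f.
  have [g gE] := V _ _ _ _ s' f; have [h hE] := Ii _ _ _ g iI.
  by exists (q \o h : {linear P -> C}) => x /=; rewrite hE gE.
- apply: (Ext0_of_inj Ii s') => f.
  have [g gE] := (Ext0P X C).1 V _ _ _ _ s f.
  have [h hE] := Pp _ _ q g qS.
  by exists (h \o i : {linear K -> I}) => x /=; rewrite hE gE.
Qed.

(** Half exactness of Ext in either variable; the extension, respectively
    lifting, problem is solved in two steps. *)
Lemma Ext0_midl X Y Z (i : {linear X -> Y}) (p : {linear Y -> Z}) M :
  short_exact i p -> Ext0 X M -> Ext0 Z M -> Ext0 Y M.
Proof.
move=> s /Ext0P VX /Ext0P VZ; apply/Ext0P => K E k q s1 f.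
have [kI qS _] := s1; have [iI pS _] := s.
have [K' [k' s2]] := short_exact_ker (f := p \o q : {linear E -> Z})
  ltac:(by move=> z; have [y <-] := pS z; have [e <-] := qS y; exists e).
have [k'I _ _] := s2.
have [|u uE] := factor_inj iI (f := q \o k' : {linear K' -> Y}).
  by move=> x; apply: (short_exact_lift s); apply: (short_exact0 x s2).
have [|v vE] := factor_inj k'I (f := k).
  by move=> x; apply: (short_exact_lift s2); rewrite /= (short_exact0 _ s1)
    linear0.
have s3 : short_exact v u.
  split=> [|x|x].
  - by apply: inj0 => x vx; apply: (inj0P kI); rewrite -vE vx linear0.
  - have [e eE] := qS (i x).
    have [y yE] : exists y, k' y = e by apply: (short_exact_lift s2);
      rewrite /= eE (short_exact0 _ s).
    by exists y; apply: iI; rewrite uE /= yE.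
  - split=> [ux|[y <-]].
      have [y yE] : exists y, k y = k' x.
        by apply: (short_exact_lift s1); have := uE x; rewrite ux linear0.
      by exists y; apply: k'I; rewrite vE.
    by apply: (inj0P iI); rewrite uE /= vE (short_exact0 _ s1).
have [g gE] := VX _ _ _ _ s3 f; have [h hE] := VZ _ _ _ _ s2 g.
by exists h => x; rewrite -vE hE gE.
Qed.

Lemma Ext0_midr X Y Z (i : {linear X -> Y}) (p : {linear Y -> Z}) W :
  short_exact i p -> Ext0 W X -> Ext0 W Z -> Ext0 W Y.
Proof.
move=> s VX VZ E T j q s1 f.
have [jI qS _] := s1; have [iI pS _] := s.
have [C [c s2]] := short_exact_coker (f := j \o i : {linear X -> E})
  ltac:(by move=> x y /= /jI/iI).
have [_ cS _] := s2.
have [|u uE] := factor_surj pS (f := c \o j : {linear Y -> C}).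
  by move=> x /(short_exact_lift s)[y <-]; apply: (short_exact0 y s2).
have [|v vE] := factor_surj cS (f := q).
  by move=> x /(short_exact_lift s2)[y <-]; apply: (short_exact0 _ s1).
have s3 : short_exact u v.
  split=> [|x|x].
  - apply: inj0 => z; have [y <-] := pS z; rewrite uE /= => /(short_exact_lift
    s2)[x /= xE].
    by rewrite -(jI _ _ xE) (short_exact0 _ s).
  - by have [e <-] := qS x; exists (c e).
  - split=> [|[z <-]]; last by have [y <-] := pS z;
    rewrite uE /= vE (short_exact0 _ s1).
    have [e <-] := cS x; rewrite vE => /(short_exact_lift s1)[y <-].
    by exists (p y); rewrite uE.
have [g gE] := VZ _ _ _ _ s3 f; have [h hE] := VX _ _ _ _ s2 g.
by exists h => x; rewrite -vE hE gE.
Qed.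
End Toolkit.

(** * Suprema of extended natural numbers *)

Lemma enat_le_refl u : enat_le u u. Proof. by case: u => /=. Qed.

Lemma enat_le_trans v u w : enat_le u v -> enat_le v w -> enat_le u w.
Proof. by case: u v w => [m|] [n|] [p|] //=; apply: leq_trans. Qed.

Lemma enat_le_anti u v : enat_le u v -> enat_le v u -> u = v.
Proof.
case: u v => [m|] [n|] //= mn nm; congr Some; apply/eqP.
by rewrite eqn_leq mn nm.
Qed.

Lemma leastP (P : set nat) :
  (exists n, [/\ least P = Some n, P n & forall m, P m -> (n <= m)%N]) \/
  (least P = infty /\ forall n, ~ P n).
Proof.
case: (pselect (exists n, P n)) => [[n Pn]|nP].
  left; have eP : exists m, `[< P m >] by exists n; apply/asboolP.
  case: (ex_minnP eP) => m /asboolP Pm mmin.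
  have mM k : P k -> (m <= k)%N by move=> Pk; apply/mmin/asboolP.
  exists m; split=> //; rewrite /least; apply: xget_unique; first by exists m.
  move=> _ [k [Pk kmin] <-]; congr Some; apply/eqP.
  by rewrite eqn_leq mM // kmin.
right; have nP' n : ~ P n by move=> Pn; apply: nP; exists n.
split=> //; rewrite /least; apply: xgetPN => x [k [Pk _] _].
exact: (nP' k).
Qed.

Lemma enat_sup_ub (E : set enat) u : E u -> enat_le u (enat_sup E).
Proof.
rewrite /enat_sup => Eu; set D := (X in least X);
  case: (leastP D) => [[n [-> nP _]]|[-> _]]; first exact: nP.
by case: u Eu.
Qed.

Lemma enat_sup_le (E : set enat) v :
  (forall u, E u -> enat_le u v) -> enat_le (enat_sup E) v.
Proof.
rewrite /enat_sup => Ev; set D := (X in least X);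
  case: (leastP D) => [[n [-> _ nmin]]|[-> nP]].
  by case: v Ev => [m|] //= Ev; apply: nmin.
by case: v Ev => [m|] //= Ev; apply: (nP m).
Qed.

Section Chains.
Variable A : nzRingType.
Implicit Types M N K L X Y Z P I C S T U V E Q : lmodType A.

(** * Syzygies, cosyzygies and homological dimensions *)

(** Syzygies and cosyzygies with respect to arbitrary, not necessarily minimal,
    presentations.  They make dimension shifting independent of covers and
    envelopes. *)
Definition syz1 X K : Prop :=
  exists P (i : {linear K -> P}) (p : {linear P ->
    X}), projective P /\ short_exact i p.

Definition cosyz1 X C : Prop :=
  exists I (i : {linear X -> I}) (p : {linear I -> C}),
    injective_module I /\ short_exact i p.

Section Iterate.
Variable R : lmodType A -> lmodType A -> Prop.

(** Iteration from the front, unlike [is_Omega] and [is_Sigma], which iterate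
    from the back; [chain_rcons] and [chain_split] mediate. *)
Fixpoint chain n X K : Prop :=
  if n is m.+1 then exists L, R X L /\ chain m L K else iso X K.

Hypothesis R_isol : forall X X' K, iso X X' -> R X' K -> R X K.

Lemma chain_rcons n X L K : chain n X L -> R L K -> chain n.+1 X K.
Proof.
elim: n X => [|n IHn] X /=.
  by move=> /R_isol h /h r; exists K; split=> //; apply: iso_refl.
by case=> L' [r c] r'; exists L'; split=> //; apply: IHn.
Qed.

Hypothesis R_isor : forall X K K', iso K K' -> R X K -> R X K'.

Lemma chain_split m n X K :
  chain (m + n) X K -> exists L, chain m X L /\ chain n L K.
Proof.
elim: m X => [|m IHm] X /=; first by exists X; split=> //; apply: iso_refl.
case=> L [r /IHm[L' [c1 c2]]]; exists L'; split=> //.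
by exists L.
Qed.

Lemma chain1 X K : chain 1 X K -> R X K.
Proof. by case=> L [r /R_isor]; apply. Qed.
End Iterate.

Definition syz := chain syz1.
Definition cosyz := chain cosyz1.

Lemma short_exact_isor X Y Z Z' (i : {linear X -> Y}) (p : {linear Y -> Z})
    (f : {linear Z -> Z'}) (g : {linear Z' -> Z}) :
  cancel f g -> cancel g f -> short_exact i p -> short_exact i (f \o p :
    {linear Y -> Z'}).
Proof.
move=> fK gK [iI pS e]; split=> // [z|y] /=.
  by have [y yE] := pS (g z); exists y; rewrite /= yE gK.
rewrite -e; split=> [h|->]; last by rewrite linear0.
by rewrite -(fK (p y)) h linear0.
Qed.

Lemma short_exact_isol X X' Y Z (i : {linear X -> Y}) (p : {linear Y -> Z})
    (f : {linear X -> X'}) (g : {linear X' -> X}) :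
  cancel f g -> cancel g f -> short_exact i p -> short_exact (i \o g : {linear
    X' -> Y}) p.
Proof.
move=> fK gK [iI pS e]; split=> // [|y] /=.
  by move=> x y /= /iI /(can_inj gK).
rewrite e; split=> [[x <-]|[x <-]]; last by exists (g x).
by exists (f x); rewrite /= fK.
Qed.

Lemma syz1_isol X X' K : iso X X' -> syz1 X' K -> syz1 X K.
Proof.
move=> /isoE[f [g [fK gK]]] [P [i [p [Pp s]]]].
by exists P, i, (g \o p : {linear P -> X}); split=> //;
  apply: short_exact_isor gK fK s.
Qed.

Lemma syz1_isor X K K' : iso K K' -> syz1 X K -> syz1 X K'.
Proof.
move=> /isoE[f [g [fK gK]]] [P [i [p [Pp s]]]].
by exists P, (i \o g : {linear K' -> P}), p; split=> //;
  apply: short_exact_isol fK gK s.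
Qed.

Lemma cosyz1_isol X X' K : iso X X' -> cosyz1 X' K -> cosyz1 X K.
Proof.
move=> /isoE[f [g [fK gK]]] [P [i [p [Pp s]]]].
by exists P, (i \o f : {linear X -> P}), p; split=> //;
  apply: short_exact_isol gK fK s.
Qed.

Lemma cosyz1_isor X K K' : iso K K' -> cosyz1 X K -> cosyz1 X K'.
Proof.
move=> /isoE[f [g [fK gK]]] [P [i [p [Pp s]]]].
by exists P, i, (f \o p : {linear P -> K'}); split=> //;
  apply: short_exact_isor fK gK s.
Qed.

Lemma proj_retract M N (u : {linear M -> N}) (v : {linear N -> M}) :
  cancel u v -> projective N -> projective M.
Proof.
move=> uK Np X Y p g pS; have [h hE] := Np _ _ p (g \o v : {linear N -> Y}) pS.
by exists (h \o u : {linear M -> X}) => x /=; rewrite hE /= uK.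
Qed.

Lemma inj_retract M N (u : {linear M -> N}) (v : {linear N -> M}) :
  cancel u v -> injective_module N -> injective_module M.
Proof.
move=> uK Np X Y p g pS; have [h hE] := Np _ _ p (u \o g : {linear X -> N}) pS.
by exists (v \o h : {linear Y -> M}) => x /=; rewrite hE /= uK.
Qed.

Lemma proj_iso M N : iso M N -> projective N -> projective M.
Proof. by case/isoE=> f [g [fK _]]; apply: proj_retract fK. Qed.

Lemma inj_iso M N : iso M N -> injective_module N -> injective_module M.
Proof. by case/isoE=> f [g [fK _]]; apply: inj_retract fK. Qed.

Lemma Ext0_retractl X X' M (u : {linear X -> X'}) (v : {linear X' -> X}) :
  cancel u v -> Ext0 X' M -> Ext0 X M.
Proof.
move=> uK V E Y i p s f; have [h hE] := V _ _ _ _ s (f \o v : {linear X' -> Y}).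
by exists (h \o u : {linear X -> E}) => x /=; rewrite hE /= uK.
Qed.

Lemma Ext0_retractr X M M' (u : {linear M -> M'}) (v : {linear M' -> M}) :
  cancel u v -> Ext0 X M' -> Ext0 X M.
Proof.
move=> uK /Ext0P V; apply/Ext0P => K E i p s f.
have [h hE] := V _ _ _ _ s (u \o f : {linear K -> M'}).
by exists (v \o h : {linear E -> M}) => x /=; rewrite hE /= uK.
Qed.

Lemma Ext0_isol X X' M : iso X X' -> Ext0 X M <-> Ext0 X' M.
Proof.
by move=> /isoE[f [g [fK gK]]]; split; [apply: Ext0_retractl gK|apply:
  Ext0_retractl fK].
Qed.

Lemma Ext0_isor X M M' : iso M M' -> Ext0 X M <-> Ext0 X M'.
Proof.
by move=> /isoE[f [g [fK gK]]]; split; [apply: Ext0_retractr gK|apply: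
  Ext0_retractr fK].
Qed.

(** [Ext^1(Omega^n X, M) = Ext^1(X, Sigma^n M)] for any choice of the syzygies
    and cosyzygies.  In particular the vanishing of the left hand side does not
    depend on the choice of [Omega^n X]. *)
Lemma Ext0_syz_cosyz n X K M C :
  syz n X K -> cosyz n M C -> Ext0 K M <-> Ext0 X C.
Proof.
elim: n X C => [|n IHn] X C.
  by move=> /= eX eM; rewrite (Ext0_isol _ eX) (Ext0_isor _ eM).
case=> L [[P [i [p [Pp s]]]] sz] csz.
have [N [cn /(chain1 cosyz1_isor)[I [j [q [Ii s']]]]]] :
    exists N, cosyz n M N /\ cosyz 1 N C.
  by apply: chain_split; rewrite addn1.
rewrite (IHn _ _ sz cn); exact: Ext0_shift Pp s Ii s'.
Qed.

(** These describe resolutions of length at most [n] by recursion; see [pdimP]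
    and [idimP]. *)
Fixpoint pd_le n X : Prop :=
  if n is m.+1 then exists K, syz1 X K /\ pd_le m K else projective X.

Fixpoint id_le n X : Prop :=
  if n is m.+1 then exists C, cosyz1 X C /\ id_le m C else injective_module X.

Lemma pd_leP n X : pd_le n X <-> exists K, syz n X K /\ projective K.
Proof.
elim: n X => [|n IHn] X /=; split.
- by exists X; split=> //; apply: iso_refl.
- by case=> K [/proj_iso]; apply.
- by case=> L [s /IHn[K [? ?]]]; exists K; split=> //; exists L.
- by case=> K [[L [s c]] Kp]; exists L; split=> //; apply/IHn; exists K.
Qed.

Lemma id_leP n X : id_le n X <-> exists K, cosyz n X K /\ injective_module K.
Proof.
elim: n X => [|n IHn] X /=; split.
- by exists X; split=> //; apply: iso_refl.
- by case=> K [/inj_iso]; apply.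
- by case=> L [s /IHn[K [? ?]]]; exists K; split=> //; exists L.
- by case=> K [[L [s c]] Kp]; exists L; split=> //; apply/IHn; exists K.
Qed.

Lemma pd_le_iso n X X' : iso X X' -> pd_le n X' -> pd_le n X.
Proof.
case: n => [|n] /= e; first exact: proj_iso.
by case=> K [s h]; exists K; split=> //; apply: syz1_isol s.
Qed.

Lemma id_le_iso n X X' : iso X X' -> id_le n X' -> id_le n X.
Proof.
case: n => [|n] /= e; first exact: inj_iso.
by case=> K [s h]; exists K; split=> //; apply: cosyz1_isol s.
Qed.

Lemma zero_proj M : zero_module M -> projective M.
Proof.
move=> M0 X Y p g _; have [h hE] := zero_map M X.
by exists h => x; rewrite hE linear0 (M0 x) linear0.
Qed.

Lemma zero_inj M : zero_module M -> injective_module M.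
Proof.
move=> M0 X Y p g _; have [h hE] := zero_map Y M.
by exists h => x; rewrite hE -(M0 (g x)).
Qed.

Lemma zero_exists : exists M : lmodType A, zero_module M.
Proof.
by exists ('rV[A]_0 : lmodType A) => x; apply/matrixP => i [].
Qed.

Lemma syz1_proj P : projective P -> exists K, zero_module K /\ syz1 P K.
Proof.
move=> Pp; have [Z Z0] := zero_exists; have [h hE] := zero_map Z P.
exists Z; split=> //; exists P, h, idfun; split=> //; split=> [||x] /=.
- by move=> x y _; rewrite (Z0 x) (Z0 y).
- by move=> x; exists x.
- by split=> [->|[y <-]]; rewrite ?hE //; exists 0; rewrite hE.
Qed.

Lemma cosyz1_inj P : injective_module P -> exists K,
  zero_module K /\ cosyz1 P K.
Proof.
move=> Pp; have [Z Z0] := zero_exists; have [h hE] := zero_map P Z.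
exists Z; split=> //; exists P, idfun, h; split=> //; split=> [//||x] /=.
- by move=> x; exists 0; rewrite linear0 (Z0 x).
- by split=> // _; exists x.
Qed.

Lemma pd_leS n X : pd_le n X -> pd_le n.+1 X.
Proof.
elim: n X => [|n IHn] X.
  by case/syz1_proj=> K [/zero_proj ? ?]; exists K.
by case=> K [s /IHn h]; exists K.
Qed.

Lemma id_leS n X : id_le n X -> id_le n.+1 X.
Proof.
elim: n X => [|n IHn] X.
  by case/cosyz1_inj=> K [/zero_inj ? ?]; exists K.
by case=> K [s /IHn h]; exists K.
Qed.

Lemma pd_le_mono m n X : (m <= n)%N -> pd_le m X -> pd_le n X.
Proof.
move/subnK <-; elim: (n - m)%N => // k IHk /IHk.
by rewrite addSn; apply: pd_leS.
Qed.

Lemma id_le_mono m n X : (m <= n)%N -> id_le m X -> id_le n X.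
Proof.
move/subnK <-; elim: (n - m)%N => // k IHk /IHk.
by rewrite addSn; apply: id_leS.
Qed.

Lemma res_pd_le n X (P : nat -> lmodType A)
    (d : forall i, {linear P i.+1 -> P i}) (e : {linear P 0%N -> X}) :
  projective_resolution d e -> (forall i, (n < i)%N -> zero_module (P i)) ->
  pd_le n X.
Proof.
elim: n X P d e => [|n IHn] X P d e [Pp eS de dd] P0 /=.
  apply: (proj_iso _ (Pp 0%N)); apply/iso_sym/(iso_intro _ eS).
  by apply: inj0 => x /de[y <-]; rewrite (P0 1%N isT y) linear0.
have [K [i s]] := short_exact_ker eS; have [iI _ _] := s.
exists K; split; first by exists (P 0%N), i, e.
have [|e' e'E] := factor_inj iI (f := d 0%N).
  by move=> x; apply: (short_exact_lift s); apply/de; exists x.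
apply: (IHn K (fun i => P i.+1) (fun i => d i.+1) e').
  split=> [j|y|y|j]; [exact: Pp| | |exact: dd].
  - have /de[x xE] := short_exact0 y s.
    by exists x; apply: iI; rewrite e'E.
  - rewrite -dd -e'E; split=> [->|]; first by rewrite linear0.
    exact: inj0P.
by move=> j ji; apply: P0.
Qed.

Lemma pd_le_res n X : pd_le n X ->
  exists (P : nat -> lmodType A) (d : forall i, {linear P i.+1 -> P i})
    (e : {linear P 0%N -> X}),
  projective_resolution d e /\ forall i, (n < i)%N -> zero_module (P i).
Proof.
elim: n X => [|n IHn] X.
  move=> Xp; have [Z Z0] := zero_exists; have [z zE] := zero_map Z X.
  pose P i := if i is i.+1 then Z else X.
  pose d i : {linear P i.+1 -> P i} :=
    match i with 0%N => z | i.+1 => (idfun : {linear Z -> Z}) end.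
  exists P, d, idfun; split; last by case.
  split=> [[|i]|x|x|[|i] x] /=.
  - exact: Xp.
  - exact: zero_proj.
  - by exists x.
  - by split=> [->|[y <-]]; rewrite ?zE //; exists 0; rewrite zE.
  - by split=> [_|[y <-]]; [exists x|rewrite zE].
  - by split=> [->|[y <-]]; [exists 0|rewrite (Z0 y)].
case=> K [[P0 [i [p [P0p s]]]] /IHn[P [d [e [[Pp eS de dd] P0z]]]]].
have [iI pS ip] := s.
pose P' i := if i is i.+1 then P i else P0.
pose d' j : {linear P' j.+1 -> P' j} :=
  match j with 0%N => (i \o e : {linear P 0%N -> P0}) | j.+1 => d j end.
exists P', d', p; split; last by case=> //= j; apply: P0z.
split=> [[|j]|//|x|[|j] x] /=.
- exact: P0p.
- exact: Pp.
- rewrite ip; split=> [[y <-]|[y <-]]; last by exists (e y).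
  by have [z <-] := eS y; exists z.
- rewrite -de; split=> [/(inj0P iI)//|->]; exact: linear0.
- exact: dd.
Qed.

Lemma res_id_le n X (P : nat -> lmodType A)
    (e : {linear X -> P 0%N}) (d : forall i, {linear P i -> P i.+1}) :
  injective_resolution e d -> (forall i, (n < i)%N -> zero_module (P i)) ->
  id_le n X.
Proof.
elim: n X P e d => [|n IHn] X P e d [Pp eI de dd] P0 /=.
  apply: (inj_iso _ (Pp 0%N)); apply: (iso_intro eI) => y.
  by apply/de; apply: P0.
have [K [p s]] := short_exact_coker eI; have [_ pS _] := s.
exists K; split; first by exists (P 0%N), e, p.
have [|e' e'E] := factor_surj pS (f := d 0%N).
  by move=> x /(short_exact_lift s)[y <-]; apply/de; exists y.
apply: (IHn K (fun i => P i.+1) e' (fun i => d i.+1)).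
  split=> [j| |y|j]; [exact: Pp| | |exact: dd].
  - apply: inj0 => z; have [y <-] := pS z; rewrite e'E => /de[x <-].
    exact: short_exact0 s.
  - rewrite dd; split=> [[x <-]|[x <-]]; first by exists (p x).
    by have [z <-] := pS x; exists z.
by move=> j ji; apply: P0.
Qed.

Lemma id_le_res n X : id_le n X ->
  exists (P : nat -> lmodType A) (e : {linear X -> P 0%N})
     (d : forall i, {linear P i -> P i.+1}),
  injective_resolution e d /\ forall i, (n < i)%N -> zero_module (P i).
Proof.
elim: n X => [|n IHn] X.
  move=> Xp; have [Z Z0] := zero_exists; have [z zE] := zero_map X Z.
  pose P i := if i is i.+1 then Z else X.
  pose d i : {linear P i -> P i.+1} :=
    match i with 0%N => z | i.+1 => (idfun : {linear Z -> Z}) end.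
  exists P, idfun, d; split; last by case.
  split=> [[|i]||x|[|i] x] //=.
  - exact: zero_inj.
  - by split=> // _; exists x.
  - by split=> [->|[y <-]] //; exists 0; rewrite zE.
  - by split=> [->|[y <-]]; [exists 0|rewrite (Z0 y)].
case=> K [[P0 [i [p [P0p s]]]] /IHn[P [e [d [[Pp eI de dd] P0z]]]]].
have [iI pS ip] := s.
pose P' i := if i is i.+1 then P i else P0.
pose d' j : {linear P' j -> P' j.+1} :=
  match j with 0%N => (e \o p : {linear P0 -> P 0%N}) | j.+1 => d j end.
exists P', i, d'; split; last by case=> //= j; apply: P0z.
split=> [[|j]|//|x|[|j] x] /=.
- exact: P0p.
- exact: Pp.
- rewrite -ip; split=> [/(inj0P eI)//|->]; exact: linear0.
- rewrite de; split=> [[y <-]|[y <-]]; last by exists (p y).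
  by have [z <-] := pS y; exists z.
- exact: dd.
Qed.

(** * Comparison with resolutions and minimal syzygies *)

Lemma pdimP X :
  (exists n, [/\ pdim X = Some n, pd_le n X & forall m, pd_le m X ->
    (n <= m)%N]) \/
  (pdim X = infty /\ forall n, ~ pd_le n X).
Proof.
rewrite /pdim; set D := (X in least X); case: (leastP D) => [[n [e [P [d [f [r
  z]]]] nmin]]|[e nP]].
  left; exists n; split=> // [|m /pd_le_res h]; last exact: nmin.
  exact: res_pd_le r z.
by right; split=> // n /pd_le_res h; apply: (nP n).
Qed.

Lemma idimP X :
  (exists n, [/\ idim X = Some n, id_le n X & forall m, id_le m X ->
    (n <= m)%N]) \/
  (idim X = infty /\ forall n, ~ id_le n X).
Proof.
rewrite /idim; set D := (X in least X); case: (leastP D) => [[n [e [P [d [f [r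
  z]]]] nmin]]|[e nP]].
  left; exists n; split=> // [|m /id_le_res h]; last exact: nmin.
  exact: res_id_le r z.
by right; split=> // n /id_le_res h; apply: (nP n).
Qed.

Lemma pdim_iso X X' : iso X X' -> pdim X = pdim X'.
Proof.
move=> e; have e' := iso_sym e.
case: (pdimP X) => [[n [-> h hm]]|[-> h]]; case: (pdimP X') => [[m [-> h'
  hm']]|[-> h']] //.
- congr Some; apply/eqP; rewrite eqn_leq hm ?hm' //.
    exact: pd_le_iso e' h.
  exact: pd_le_iso e h'.
- by case: (h' n); apply: pd_le_iso e' h.
- by case: (h m); apply: pd_le_iso e h'.
Qed.

Lemma idim_iso X X' : iso X X' -> idim X = idim X'.
Proof.
move=> e; have e' := iso_sym e.
case: (idimP X) => [[n [-> h hm]]|[-> h]]; case: (idimP X') => [[m [-> h'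
  hm']]|[-> h']] //.
- congr Some; apply/eqP; rewrite eqn_leq hm ?hm' //.
    exact: id_le_iso e' h.
  exact: id_le_iso e h'.
- by case: (h' n); apply: id_le_iso e' h.
- by case: (h m); apply: id_le_iso e h'.
Qed.

Lemma is_syzygy_syz1 M K : is_syzygy M K -> syz1 M K.
Proof. by case=> P [f [i [[Pp fS _] iI e]]]; exists P, i, f. Qed.

Lemma is_cosyzygy_cosyz1 M K : is_cosyzygy M K -> cosyz1 M K.
Proof. by case=> P [f [i [[Pp fS _] iI e]]]; exists P, f, i. Qed.

Lemma is_Omega_syz n M N : is_Omega n M N -> syz n M N.
Proof.
elim: n N => [//|n IHn] N [K [/IHn h /is_syzygy_syz1 s]].
exact: (chain_rcons syz1_isol h s).
Qed.

Lemma is_Sigma_cosyz n M N : is_Sigma n M N -> cosyz n M N.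
Proof.
elim: n N => [//|n IHn] N [K [/IHn h /is_cosyzygy_cosyz1 s]].
exact: (chain_rcons cosyz1_isol h s).
Qed.

Lemma is_syzygy_isor M K N : is_syzygy M K -> iso K N -> is_syzygy M N.
Proof.
case=> P [f [i [h iI e]]] /isoE[u [v [uK vK]]].
have s : short_exact i f by case: h.
have [? ? ?] := short_exact_isol uK vK s.
by exists P, f, (i \o v : {linear N -> P}).
Qed.

Lemma is_cosyzygy_isor M K N : is_cosyzygy M K -> iso K N -> is_cosyzygy M N.
Proof.
case=> P [f [i [h iI e]]] /isoE[u [v [uK vK]]].
have s : short_exact f i by case: h.
have [? ? ?] := short_exact_isor uK vK s.
by exists P, f, (u \o i : {linear P -> N}).
Qed.

Lemma is_Omega_cons n M K N : is_syzygy M K -> is_Omega n K N ->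
  is_Omega n.+1 M N.
Proof.
move=> s; elim: n N => [|n IHn] N.
  move=> /= e; exists M; split; first exact: iso_refl.
  exact: is_syzygy_isor e.
by case=> L [/IHn h s']; exists L.
Qed.

Lemma is_Sigma_cons n M K N :
  is_cosyzygy M K -> is_Sigma n K N -> is_Sigma n.+1 M N.
Proof.
move=> s; elim: n N => [|n IHn] N.
  move=> /= e; exists M; split; first exact: iso_refl.
  exact: is_cosyzygy_isor e.
by case=> L [/IHn h s']; exists L.
Qed.

Lemma retract_summand M N (u : {linear M -> N}) (v : {linear N -> M}) :
  cancel u v -> summand M N.
Proof.
move=> uK; have [X [j [jI jE]]] := ker_exists v; exists X.
have [d dE] := diff_map (idfun : {linear N -> N}) (u \o v : {linear N -> N}).
have [|g gE] := factor_inj jI (f := d).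
  by move=> x; apply/jE; rewrite dE /= linearB uK subrr.
have [h hE] := pair_map v g.
apply: (iso_intro (f := h)).
  apply: inj0 => x; rewrite hE => -[vx gx].
  by have := gE x; rewrite dE gx linear0 /= vx linear0 subr0 => <-.
move=> [m x]; exists (u m + j x).
have vj : v (j x) = 0 by apply/jE; exists x.
have vE : v (u m + j x) = m by rewrite linearD uK vj addr0.
rewrite hE vE; congr (_, _); apply: jI; rewrite gE dE /= vE.
by rewrite addrC addKr.
Qed.

Lemma summand_retract M N : summand M N ->
  exists (u : {linear M -> N}) (v : {linear N -> M}), cancel u v.
Proof.
case=> X /isoE[f [g [fK gK]]]; have [z zE] := zero_map M X.
have [p pE] := pair_map (idfun : {linear M -> M}) z.
exists (g \o p : {linear M -> N}), (fst \o f : {linear N -> M}) => x /=.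
by rewrite gK pE.
Qed.

Lemma Ext0_sumr X M N : Ext0 X M -> Ext0 X N -> Ext0 X (M * N)%type.
Proof.
move=> /Ext0P VM /Ext0P VN; apply/Ext0P => K E i p s f.
have [h hE] := VM _ _ _ _ s (fst \o f : {linear K -> M}).
have [g gE] := VN _ _ _ _ s (snd \o f : {linear K -> N}).
have [k kE] := pair_map h g.
by exists k => x; rewrite kE hE gE /=; case: (f x).
Qed.

Lemma Ext0_suml X Y M : Ext0 X M -> Ext0 Y M -> Ext0 (X * Y)%type M.
Proof.
move=> VX VY E Z i p s f.
have [nx nxE] := zero_map Y X; have [ny nyE] := zero_map X Y.
have [ix ixE] := pair_map (idfun : {linear X -> X}) ny.
have [iy iyE] := pair_map nx (idfun : {linear Y -> Y}).
have [h hE] := VX _ _ _ _ s (f \o ix : {linear X -> Z}).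
have [g gE] := VY _ _ _ _ s (f \o iy : {linear Y -> Z}).
have [k kE] := copair_map h g.
exists k => -[x y]; rewrite kE linearD hE gE /= -linearD ixE iyE nxE nyE.
by congr (f (_, _)); rewrite /= ?addr0 ?add0r.
Qed.
End Chains.

Section FiniteLength.
Variable A : nzRingType.
Implicit Types M N K L X Y Z P I C S T U V E : lmodType A.

(** * Simple modules and modules of finite length *)

Lemma simple_psub S (Q : S -> Prop) : simple_module S -> psub Q ->
  (forall x, Q x -> x = 0) \/ (forall x, Q x).
Proof.
case=> _ sS /pred_of_closed/sS[h|h]; [left=> x /in_pred_of; exact: h|right=> x].
exact/in_pred_of/h.
Qed.

Lemma simple_intro S : ~ zero_module S ->
  (forall Q : S -> Prop, psub Q -> (forall x, Q x ->
    x = 0) \/ (forall x, Q x)) ->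
  simple_module S.
Proof. by move=> S0 h; split=> // N /closed_psub/h. Qed.

Lemma nonzeroP M : ~ zero_module M <-> exists x : M, x <> 0.
Proof.
split=> [h|[x x0] /(_ x)//]; apply: contrapT => h'; apply: h => x.
by apply: contrapT => x0; apply: h'; exists x.
Qed.

Lemma simple_map_inj S M (f : {linear S -> M}) x :
  simple_module S -> f x <> 0 -> injective f.
Proof.
by move=> sS fx; apply: inj0; case: (simple_psub sS (psub_ker f)).
Qed.

Lemma simple_map_surj S M (f : {linear M -> S}) x :
  simple_module S -> f x <> 0 -> surjective f.
Proof.
move=> sS fx; case: (simple_psub sS (psub_im f)) => // h.
by case: fx; apply: h; exists x.
Qed.

Lemma schur S T (f : {linear S -> T}) x :
  simple_module S -> simple_module T -> f x <> 0 -> iso S T.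
Proof.
move=> sS sT fx; apply: (iso_intro (f := f)).
  exact: simple_map_inj fx.
exact: simple_map_surj fx.
Qed.

Lemma simple_iso S T : iso S T -> simple_module S -> simple_module T.
Proof.
move=> /isoE[f [g [fK gK]]] sS; apply: simple_intro => [T0|Q Qs].
  by case: sS => + _; apply=> x; rewrite -(fK x) (T0 (f x)) linear0.
case: (simple_psub sS (psub_preim f Qs)) => h; [left=> x|right=> x].
  by rewrite -{1}(gK x) => /h gx; rewrite -(gK x) gx linear0.
by rewrite -(gK x).
Qed.

Lemma zero_iso M N : iso M N -> zero_module M -> zero_module N.
Proof.
by case/isoE=> f [g [fK gK]] M0 x; rewrite -(gK x) (M0 (g x)) linear0.
Qed.

(** The existence of a composition series of length [n], given from the top.
    The induction principle replaces arguments with composition factors. *)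
Inductive has_length : nat -> lmodType A -> Prop :=
| has_length_zero M : zero_module M -> has_length 0 M
| has_length_succ n K M S (i : {linear K -> M}) (p : {linear M -> S}) :
    short_exact i p -> simple_module S -> has_length n K -> has_length n.+1 M.

Definition finite_length M := exists n, has_length n M.

Lemma has_length0 M : has_length 0 M -> zero_module M.
Proof. by move e : 0%N => n h; case: h e. Qed.

Lemma has_lengthS n M : has_length n.+1 M -> exists K S (i : {linear K -> M})
  (p : {linear M -> S}), [/\ short_exact i p, simple_module S & has_length n K].
Proof.
by move e : n.+1 => m h; case: h e => // k K M' S i p s sS f [->];
  exists K, S, i, p.
Qed.

Lemma has_length_iso n M N : iso M N -> has_length n M -> has_length n N.
Proof.
case: n => [|n] e; first by move/has_length0/(zero_iso e);
  apply: has_length_zero.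
case/has_lengthS=> K [S [i [p [[iI pS ip] sS h]]]].
have [f [g [fK gK]]] := isoE e.
apply: (@has_length_succ n K N S (f \o i : {linear K ->
  N}) (p \o g : {linear N -> S})) => //.
split=> [|x|y] /=.
- by apply: inj_comp => //; apply: can_inj fK.
- by have [y yE] := pS x; exists (f y) => /=; rewrite fK.
- rewrite ip; split=> [[x xE]|[x <-]]; last by exists x => /=; rewrite fK.
  by exists x; rewrite /= xE gK.
Qed.

(** The clause on equality gives what is needed of the Jordan-Hoelder theorem:
    proper submodules and proper quotients have smaller minimal length. *)
Lemma has_length_sub n M N (j : {linear N -> M}) : has_length n M ->
  injective j ->
  exists m, [/\ (m <= n)%N, has_length m N & m = n -> surjective j].
Proof.
elim: n M N j => [|n IHn] M N j.
  move/has_length0=> M0 jI; exists 0%N; split=> // [|_ y].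
    by apply: has_length_zero => x; apply: (inj0P jI).
  by exists 0; rewrite linear0 (M0 y).
case/has_lengthS=> K [S [i [p [s sS h]]]] jI; have [iI pS ip] := s.
case: (simple_psub sS (psub_im (p \o j : {linear N -> S}))) => hW.
  have [|g gE] := factor_inj iI (f := j).
    by move=> x; apply: (short_exact_lift s); apply: hW; exists x.
  have [|m [mn hm _]] := IHn K N g h.
    by apply: inj0 => x gx; apply: (inj0P jI); rewrite -gE gx linear0.
  by exists m; split=> //; [exact: leqW|move=> e; rewrite e ltnn in mn].
have [K' [k' s']] := short_exact_ker hW; have [k'I _ _] := s'.
have [|g gE] := factor_inj iI (f := j \o k' : {linear K' -> M}).
  by move=> x; apply: (short_exact_lift s); apply: (short_exact0 x s').
have [|m [mn hm gS]] := IHn K K' g h.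
  apply: inj0 => x gx; apply: (inj0P k'I); apply: (inj0P jI).
  by have := gE x; rewrite gx linear0.
exists m.+1; split=> // [|[/gS{}gS] y]; first exact: has_length_succ s' sS hm.
have [x /= xE] := hW (p y).
have [z zE] : exists z, i z = y - j x.
  by apply: (short_exact_lift s); rewrite linearB xE subrr.
have [w wE] := gS z; exists (x + k' w).
by have /= := gE w; rewrite wE zE linearD => <-; rewrite addrC subrK.
Qed.

Lemma has_length_quo n M N (q : {linear M -> N}) : has_length n M ->
  surjective q ->
  exists m, [/\ (m <= n)%N, has_length m N & m = n -> injective q].
Proof.
elim: n M N q => [|n IHn] M N q.
  move/has_length0=> M0 qS; exists 0%N; split=> // [|_].
    by apply: has_length_zero => x; have [y <-] := qS x; rewrite (M0 y) linear0.
  by apply: inj0 => x _.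
case/has_lengthS=> K [S [i [p [s sS h]]]] qS; have [iI pS ip] := s.
have [I [q1 [j [q1S jI jE]]]] := img_exists (q \o i : {linear K -> N}).
have [m [mn hm q1I]] := IHn _ _ _ h q1S.
have [C [c s']] := short_exact_coker jI; have [_ cS _] := s'.
case: (pselect (zero_module C)) => [C0|/nonzeroP[y y0]].
  exists m; split=> // [||e]; [exact: leqW| |by rewrite e ltnn in mn].
  apply: has_length_iso hm; apply: (iso_intro jI) => y.
  exact: (short_exact_lift s').
have [|g gE] := factor_surj pS (f := c \o q : {linear M -> C}).
  by move=> x /ip[k <-] /=; rewrite -[q _]jE (short_exact0 _ s').
have gS : surjective g.
  by move=> z; have [w <-] := cS z; have [x <-] := qS w; exists (p x).
have [z zE] := gS y; have gz : g z <> 0 by rewrite zE.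
have gI := simple_map_inj sS gz.
have sC := simple_iso (iso_intro gI gS) sS.
exists m.+1; split=> // [|[/q1I{}q1I]]; first exact: has_length_succ s' sC hm.
apply: inj0 => x qx.
have [k kE] : exists k, i k = x.
  by apply/ip; apply: (inj0P gI); rewrite gE /= qx linear0.
rewrite -kE; have : j (q1 k) = 0 by rewrite jE /= kE.
by move/(inj0P jI)/(inj0P q1I) ->; rewrite linear0.
Qed.

Lemma finite_length_zero M : zero_module M -> finite_length M.
Proof. by exists 0%N; apply: has_length_zero. Qed.

Lemma finite_length_sub M N (j : {linear N -> M}) : finite_length M ->
  injective j -> finite_length N.
Proof. by move=> [n h] /(has_length_sub h)[m [_ ? _]]; exists m. Qed.

Lemma finite_length_quo M N (j : {linear M -> N}) : finite_length M ->
  surjective j -> finite_length N.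
Proof. by move=> [n h] /(has_length_quo h)[m [_ ? _]]; exists m. Qed.

Lemma finite_length_iso M N : iso M N -> finite_length M -> finite_length N.
Proof. by move=> e [n h]; exists n; apply: has_length_iso h. Qed.

Lemma finite_length_simple S : simple_module S -> finite_length S.
Proof.
move=> sS; have [Z Z0] := zero_exists A; have [z zE] := zero_map Z S.
exists 1%N; apply: (@has_length_succ _ Z S S z idfun _ sS (has_length_zero Z0)).
split=> [x y _|x|x] /=; first by rewrite (Z0 x) (Z0 y).
  by exists x.
by split=> [->|[y <-]]; rewrite ?zE //; exists 0; rewrite zE.
Qed.

Lemma finite_length_ext X Y Z (i : {linear X -> Y}) (p : {linear Y -> Z}) :
  short_exact i p -> finite_length X -> finite_length Z -> finite_length Y.
Proof.
move=> + fX [n]; elim: n Y Z i p => [|n IHn] Y Z i p s.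
  move/has_length0=> Z0; have [iI _ _] := s; apply: finite_length_iso fX.
  by apply: (iso_intro iI) => y; apply: (short_exact_lift s).
case/has_lengthS=> K [S [j [q [s1 sS h]]]].
have [iI pS ip] := s; have [jI qS jq] := s1.
have [M [k s2]] := short_exact_ker (f := q \o p : {linear Y -> S})
  ltac:(by move=> z; have [y <-] := qS z; have [x <-] := pS y; exists x).
have [kI _ kqp] := s2.
have [|a aE] := factor_inj kI (f := i).
  by move=> x; apply/kqp; rewrite /= (short_exact0 _ s) linear0.
have [|b bE] := factor_inj jI (f := p \o k : {linear M -> Z}).
  by move=> x; apply/jq; apply: (short_exact0 x s2).
have s3 : short_exact a b.
  split=> [|x|x].
  - by apply: inj0 => x ax; apply: (inj0P iI); rewrite -aE ax linear0.
  - have [y yE] := pS (j x).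
    have [z zE] : exists z, k z = y by apply/kqp;
      rewrite /= yE (short_exact0 _ s1).
    by exists z; apply: jI; rewrite bE /= zE.
  - split=> [bx|[y <-]].
      have [y yE] : exists y, i y = k x.
        by apply/ip; have /= := bE x; rewrite bx linear0.
      by exists y; apply: kI; rewrite aE.
    by apply: (inj0P jI); rewrite bE /= aE (short_exact0 _ s).
have [m hm] := IHn _ _ _ _ s3 h.
by exists m.+1; apply: has_length_succ s2 sS hm.
Qed.

Lemma short_exact_prod M N : exists (i : {linear M -> (M * N)%type})
  (p : {linear (M * N)%type -> N}), short_exact i p.
Proof.
have [z zE] := zero_map M N; have [i iE] := pair_map (idfun : {linear M ->
  M}) z.
exists i, snd; split=> [x y|y|[x y]] /=.
- by rewrite !iE => -[].
- by exists (0, y).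
- split=> [->|[w]]; first by exists x; rewrite iE zE.
  by rewrite iE zE => -[].
Qed.

Lemma finite_length_prod M N : finite_length M -> finite_length N ->
  finite_length (M * N)%type.
Proof. by have [i [p s]] := short_exact_prod M N;
  apply: finite_length_ext s. Qed.

Lemma finite_length_min M : finite_length M ->
  exists n, has_length n M /\ forall m, has_length m M -> (n <= m)%N.
Proof.
case=> n hn; have h : exists n, `[< has_length n M >] by exists n;
  apply/asboolP.
case: (ex_minnP h) => m /asboolP hm mmin; exists m; split=> // k hk.
exact/mmin/asboolP.
Qed.

Lemma surj_endo_inj M (f : {linear M -> M}) : finite_length M ->
  surjective f -> injective f.
Proof.
move=> /finite_length_min[n [hn nmin]] /(has_length_quo hn)[m [mn /nmin nm]];
  apply.
by apply/eqP; rewrite eqn_leq mn nm.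
Qed.

Lemma inj_endo_surj M (f : {linear M -> M}) : finite_length M -> injective f ->
  surjective f.
Proof.
move=> /finite_length_min[n [hn nmin]] /(has_length_sub hn)[m [mn /nmin nm]];
  apply.
by apply/eqP; rewrite eqn_leq mn nm.
Qed.

Lemma finite_length_top M : finite_length M -> ~ zero_module M ->
  exists S (p : {linear M -> S}), simple_module S /\ surjective p.
Proof.
case=> -[/has_length0 //|n /has_lengthS[K [S [i [p [[_ pS _] sS _]]]]] _].
by exists S, p.
Qed.

Lemma finite_length_socle M : finite_length M -> ~ zero_module M ->
  exists S (i : {linear S -> M}), simple_module S /\ injective i.
Proof.
case=> n; elim: n M => [|n IHn] M; first by move/has_length0.
case/has_lengthS=> K [S [i [p [s sS h]]]] M0; have [iI pS ip] := s.
case: (pselect (zero_module K)) => [K0|/(IHn _ h)[T [j [sT jI]]]].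
  have pI : injective p.
    by apply: inj0 => x /ip[k <-]; rewrite (K0 k) linear0.
  have /isoE[f [g [fK gK]]] := iso_intro pI pS.
  by exists S, g; split=> //; apply: can_inj gK.
by exists T, (i \o j : {linear T -> M}); split=> //; apply: inj_comp.
Qed.

(** For [T] simple and [L] of finite length, [T] is a composition factor
    of [L]. *)
Definition subquot T L := exists Y (a : {linear Y -> L}) (b : {linear Y -> T}),
  injective a /\ surjective b.

Lemma subquot_sub T K L (i : {linear K -> L}) : injective i -> subquot T K ->
  subquot T L.
Proof.
move=> iI [Y [a [b [aI bS]]]]; exists Y, (i \o a : {linear Y -> L}), b.
by split=> //; apply: inj_comp.
Qed.

Lemma subquot_isol T T' L : iso T T' -> subquot T L -> subquot T' L.
Proof.
move=> /isoE[f [g [fK gK]]] [Y [a [b [aI bS]]]].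
exists Y, a, (f \o b : {linear Y -> T'}); split=> // x.
by have [y yE] := bS (g x); exists y; rewrite /= yE gK.
Qed.

Lemma finite_length_ind_subquot (Pr : lmodType A -> Prop) L :
  (forall M, zero_module M -> Pr M) ->
  (forall X Y Z (i : {linear X -> Y}) (p : {linear Y -> Z}), short_exact i p ->
     finite_length Y -> Pr X -> Pr Z -> Pr Y) ->
  finite_length L -> (forall T, simple_module T -> subquot T L -> Pr T) -> Pr L.
Proof.
move=> Pr0 Prx fL; have [n h] := fL.
elim: n L fL h => [|n IHn] L fL; first by move/has_length0/Pr0.
case/has_lengthS=> K [S [i [p [s sS h]]]] hT; have [iI pS ip] := s.
apply: (Prx _ _ _ _ _ s fL).
  apply: IHn => // [|T sT TK]; first by exists n.
  by apply: hT => //; apply: subquot_sub iI TK.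
by apply: hT => //; exists L, idfun, p; split=> // x y.
Qed.

(** * Finitely generated modules *)

Lemma cyclic_map M (y : M) : exists f : {linear A^o ->
  M}, forall a, f a = a *: y.
Proof.
by apply: mk_linear => a x z; rewrite scalerDl -scalerA.
Qed.

Lemma reg_proj : projective (A^o : lmodType A).
Proof.
move=> X Y p g pS; have [x xE] := pS (g 1); have [h hE] := cyclic_map x.
exists h => a; rewrite hE linearZ_LR /= xE -linearZ_LR.
by rewrite /GRing.scale /= mulr1.
Qed.

Lemma proj_prod P P' : projective P -> projective P' ->
  projective (P * P')%type.
Proof.
move=> Pp Pp' X Y p g pS.
have [z zE] := zero_map P P'; have [z' z'E] := zero_map P' P.
have [i iE] := pair_map (idfun : {linear P -> P}) z.
have [i' i'E] := pair_map z' (idfun : {linear P' -> P'}).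
have [h hE] := Pp _ _ p (g \o i : {linear P -> Y}) pS.
have [h' h'E] := Pp' _ _ p (g \o i' : {linear P' -> Y}) pS.
have [k kE] := copair_map h h'; exists k => -[x y].
rewrite kE linearD hE h'E /= -linearD iE i'E zE z'E.
by congr (g (_, _)); rewrite /= ?addr0 ?add0r.
Qed.

Lemma inj_prod I I' : injective_module I -> injective_module I' ->
  injective_module (I * I')%type.
Proof.
move=> Ip Ip' X Y i g iI.
have [h hE] := Ip _ _ i (fst \o g : {linear X -> I}) iI.
have [h' h'E] := Ip' _ _ i (snd \o g : {linear X -> I'}) iI.
have [k kE] := pair_map h h'; exists k => x.
by rewrite kE hE h'E /=; case: (g x).
Qed.

Lemma fgP M : finitely_generated M <-> exists n (s : nat -> M),
  forall x, exists c : nat -> A, x = \sum_(i < n) c i *: s i.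
Proof.
split=> [[n [s h]]|[n [s h]]]; exists n; last first.
  exists (fun i => s i) => x; have [c ->] := h x.
  by exists (fun i => c i).
exists (fun i => if insub i is Some j then s j else 0) => x.
have [c ->] := h x; exists (fun i => if insub i is Some j then c j else 0).
by apply: eq_bigr => i _; rewrite !valK.
Qed.

Lemma fg_free n M (s : nat -> M) : finite_length (A^o : lmodType A) ->
  exists P (f : {linear P -> M}), [/\ finite_length P, projective P &
    forall c : nat -> A, exists y, f y = \sum_(i < n) c i *: s i].
Proof.
move=> fA; elim: n => [|n [P [f [fP Pp h]]]].
  have [Z Z0] := zero_exists A; have [z zE] := zero_map Z M.
  exists Z, z; split=> [||c]; [exact: finite_length_zero|exact: zero_proj|].
  by exists 0; rewrite zE big_ord0.
have [g gE] := cyclic_map (s n); have [k kE] := copair_map f g.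
exists (P * A^o)%type, k; split=> [||c].
- exact: finite_length_prod.
- by apply: proj_prod => //; apply: reg_proj.
- have [y yE] := h c; exists (y, c n).
  by rewrite kE /= yE gE big_ord_recr.
Qed.

Lemma fg_cover M : finite_length (A^o : lmodType A) -> finitely_generated M ->
  exists P (f : {linear P -> M}), [/\ finite_length P,
    projective P & surjective f].
Proof.
move=> fA /fgP[n [s h]]; have [P [f [fP Pp fh]]] := fg_free n s fA.
by exists P, f; split=> // x; have [c ->] := h x.
Qed.

Lemma fg_finite_length M : finite_length (A^o : lmodType A) ->
  finitely_generated M -> finite_length M.
Proof.
by move=> fA /(fg_cover fA)[P [f [fP _]]]; apply: finite_length_quo.
Qed.

Lemma fg_ext_cyclic X Y Z (i : {linear X -> Y}) (p : {linear Y -> Z}) y :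
  short_exact i p -> finitely_generated X -> (forall z, exists a,
    z = a *: p y) ->
  finitely_generated Y.
Proof.
move=> s /fgP[n [g h]] hy; apply/fgP; exists n.+1.
exists (fun j => if (j < n)%N then i (g j) else y) => x.
have [a aE] := hy (p x); have [w wE] : exists w, i w = x - a *: y.
  by apply: (short_exact_lift s); rewrite linearB linearZ_LR aE /= subrr.
have [c cE] := h w; exists (fun j => if (j < n)%N then c j else a).
rewrite big_ord_recr /= ltnn.
under eq_bigr => j _ do rewrite ltn_ord -linearZ_LR.
by rewrite /= -linear_sum -cE wE subrK.
Qed.

Lemma simple_cyclic S (y : S) : simple_module S -> y <> 0 ->
  forall z, exists a, z = a *: y.
Proof.
move=> sS y0 z; have [f fE] := cyclic_map y.
have fn : f 1 <> 0 by rewrite fE scale1r.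
by have [a <-] := simple_map_surj sS fn z; exists a; rewrite fE.
Qed.

Lemma finite_length_fg M : finite_length M -> finitely_generated M.
Proof.
case=> n; elim: n M => [|n IHn] M.
  move/has_length0=> M0; apply/fgP; exists 0%N, (fun _ => 0) => x.
  by exists (fun _ => 0); rewrite big_ord0 (M0 x).
case/has_lengthS=> K [S [i [p [s sS /IHn h]]]].
have [y y0] := (nonzeroP S).1 sS.1; have [_ pS _] := s.
have [x xE] := pS y; apply: (fg_ext_cyclic (y := x) s h) => z.
by rewrite xE; apply: simple_cyclic.
Qed.

(** * Uniserial and serial modules *)

Definition chained M := forall Q Q' : M -> Prop, psub Q -> psub Q' ->
  (forall x, Q x -> Q' x) \/ (forall x, Q' x -> Q x).

Definition uniserial M := finite_length M /\ chained M.

Lemma uniserial_sub M N (j : {linear N -> M}) : uniserial M -> injective j ->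
  uniserial N.
Proof.
move=> [fM cM] jI; split; first exact: finite_length_sub jI.
move=> Q Q' /(psub_img j) qs /(psub_img j) qs'.
by case: (cM _ _ qs qs') => h; [left|right] => x qx;
  have [|y qy /jI <-//] := h (j x); exists x.
Qed.

Lemma uniserial_quo M N (p : {linear M -> N}) : uniserial M -> surjective p ->
  uniserial N.
Proof.
move=> [fM cM] pS; split; first exact: finite_length_quo pS.
move=> Q Q' /(psub_preim p) qs /(psub_preim p) qs'.
by case: (cM _ _ qs qs') => h; [left|right] => x; have [y <-] := pS x; apply: h.
Qed.

Lemma uniserial_simple S : simple_module S -> uniserial S.
Proof.
move=> sS; split; first exact: finite_length_simple.
move=> Q Q' /(simple_psub sS)[h|h] qs'; last by right.
by left=> x /h ->; case: qs'.
Qed.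

Lemma chained_ker M N N' (f : {linear M -> N}) (g : {linear M -> N'}) :
  chained M -> (forall x, f x = 0 -> g x = 0) \/ (forall x, g x = 0 -> f x = 0).
Proof. by move=> cM; apply: cM; apply: psub_ker. Qed.

Lemma chained_im M N N' (f : {linear N -> M}) (g : {linear N' -> M}) :
  chained M -> (forall x, exists y, g y = f x) \/ (forall x, exists y,
    f y = g x).
Proof.
move=> cM; case: (cM _ _ (psub_im f) (psub_im g)) => h; [left|right] => x;
  by apply: h; exists x.
Qed.

Lemma chained_imker M N N' (f : {linear N -> M}) (g : {linear M -> N'}) :
  chained M -> (forall x, g (f x) = 0) \/ (forall y, g y = 0 ->
    exists x, f x = y).
Proof.
move=> cM; case: (cM _ _ (psub_im f) (psub_ker g)) => h; [left|right] => x.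
  by apply: h; exists x.
exact: h.
Qed.
End FiniteLength.

Section Serial.
Variables (A : nzRingType) (M : lmodType A).

Lemma comp_finite_length n (N : nat -> {pred M}) : composition_series n N ->
  finite_length M.
Proof.
case=> Ncl N0 Nn Nmax.
have h i : (i <= n)%N -> exists (K : lmodType A) (j : {linear K -> M}),
    [/\ injective j, forall x, x \in N i <-> exists y,
      j y = x & finite_length K].
  elim: i => [|i IHi] lei.
    have [K [j [jI jE]]] := submodule_exists (psub_zero M).
    exists K, j; split=> // [x|]; first by rewrite N0 jE.
    by apply: finite_length_zero => x; apply: (inj0P jI); apply/jE; exists x.
  have [K [j [jI jE fK]]] := IHi (ltnW lei).
  have [K' [j' [jI' jE']]] := submodule_exists (closed_psub (Ncl _ lei)).
  have [NS NnS Nm] := Nmax i lei.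
  exists K', j'; split=> //.
  have [|g gE] := factor_inj jI' (f := j).
    by move=> x; apply/jE'; apply: NS; apply/jE; exists x.
  have gI : injective g.
    by apply: inj0 => x gx; apply: (inj0P jI); rewrite -gE gx linear0.
  have [C [c s]] := short_exact_coker gI; have [_ cS cE] := s.
  apply: (finite_length_ext s fK); apply: finite_length_simple;
    apply: simple_intro => [C0|Q Qs].
    apply: NnS => x /jE'[y <-]; apply/jE.
    by have /cE[z <-] := C0 (c y); exists z; rewrite gE.
  have Ws := psub_img j' (psub_preim c Qs).
  case: (Nm _ (pred_of_closed Ws)) => [x /jE[y <-]|x /in_pred_of[y _ <-]|hW|hW].
  - by apply/in_pred_of; exists (g y); rewrite ?(short_exact0 _ s) ?gE //;
    case: Qs.
  - by apply/jE'; exists y.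
  - left=> x; have [y <-] := cS x => qy.
    have /jE[z zE] : j' y \in N i by rewrite -hW; apply/in_pred_of; exists y.
    by apply/cE; exists z; apply: jI'; rewrite gE.
  - right=> x; have [y <-] := cS x.
    have : j' y \in N i.+1 by apply/jE'; exists y.
    by rewrite -hW => /in_pred_of[z qz /jI' <-].
have [K [j [jI jE fK]]] := h n (leqnn n).
by apply: finite_length_iso fK; apply: (iso_intro jI) => x; apply/jE/Nn.
Qed.

(** In a filtration obtained by intersecting a composition series with a
    submodule, or by adding a submodule to it, consecutive terms may agree. *)
Definition equal_or_maximal (U V : M -> Prop) := (forall x, U x -> V x) /\
  forall W : M -> Prop, psub W -> (forall x, U x -> W x) ->
    (forall x, W x -> V x) -> (forall x, W x -> U x) \/ (forall x, V x -> W x).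

(** Deleting the repetitions of a filtration leaves a composition series with
    the same terms. *)
Lemma refine m (W : nat -> M -> Prop) :
  (forall j, (j <= m)%N -> psub (W j)) -> (forall x, W 0%N x <-> x = 0) ->
  (forall j, (j < m)%N -> equal_or_maximal (W j) (W j.+1)) ->
  exists n (N : nat -> {pred M}),
  [/\ forall i, (i <= n)%N -> submod_closed (N i),
      forall x, x \in N 0%N <-> x = 0,
      forall i, (i < n)%N -> maximal_submodule (N i) (N i.+1),
      forall x, x \in N n <-> W m x &
      forall j, (j <= m)%N -> exists2 i, (i <= n)%N & forall x,
        x \in N i <-> W j x].
Proof.
move=> + W0; elim: m => [|m IHm] Ws Wst.
  exists 0%N, (fun _ => pred_of (W 0%N)); split=> //.
  - by move=> _ _; apply: pred_of_closed; apply: Ws.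
  - by move=> x; rewrite in_pred_of W0.
  - by move=> x; rewrite in_pred_of.
  - by case=> // _; exists 0%N => // x; rewrite in_pred_of.
have [j jm|j jm|n [N [Ncl N0 Nmax Nn NW]]] := IHm.
- by apply: Ws; apply: leqW.
- by apply: Wst; apply: leqW.
have [WW Wm] := Wst m (ltnSn m).
case: (pselect (forall x, W m.+1 x -> W m x)) => [eW|neW].
  exists n, N; split=> // [x|j].
    by rewrite Nn; split=> [/WW|/eW].
  rewrite leq_eqVlt => /orP[/eqP ->|/NW//]; exists n => // x.
  by rewrite Nn; split=> [/WW|/eW].
exists n.+1, (fun i => if (i <= n)%N then N i else pred_of (W m.+1)).
split=> [i lei|x|i lei|x|j].
- by case: (leqP i n) => [/Ncl//|_]; apply: pred_of_closed; apply: Ws.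
- by rewrite leq0n N0.
- rewrite -ltnS lei; case: (ltnP i n) => [/Nmax//|nei].
  have -> : i = n by apply/eqP; rewrite eqn_leq nei -ltnS lei.
  split=> [x /Nn/WW/in_pred_of//|h|V Vcl NV VW].
    by apply: neW => x /in_pred_of/h/Nn.
  have [x /Nn/NV//|x /VW/in_pred_of//|h|h] := Wm _ (closed_psub Vcl).
  + left=> x; apply/idP/idP => [/h/Nn//|/NV//].
  + right=> x; apply/idP/idP => [/VW//|/in_pred_of/h//].
- by rewrite ltnn in_pred_of.
- rewrite leq_eqVlt => /orP[/eqP ->|/NW[i lei iE]].
    by exists n.+1 => // x; rewrite ltnn in_pred_of.
  by exists i; [exact: leqW|rewrite lei].
Qed.

(** Every submodule [Q] occurs in a composition series: refine the filtration
    that runs through [Q :&: N i] up to [Q] and then through [Q + N i] up to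
    [M].  By uniqueness, every submodule is thus one of the [N i]. *)
Lemma serial_uniserial : serial M -> uniserial M.
Proof.
case=> n [N [Ncs Nu]]; split; first exact: comp_finite_length Ncs.
have [Ncl N0 Nn Nmax] := Ncs.
have Nps i : (i <= n)%N -> psub (fun x => x \in N i) by move/Ncl/closed_psub.
suff h Q : psub Q -> exists2 i, (i <= n)%N & forall x, x \in N i <-> Q x.
  have mono i j : (i <= j)%N -> (j <= n)%N -> {subset N i <= N j}.
    move/subnK <-; elim: (j - i)%N => [_ x //|k IHk kn x hx].
    by have [+ _ _] := Nmax _ kn; apply; apply: IHk => //; apply: ltnW.
  move=> Q Q' /h[i lei iE] /h[j lej jE].
  case: (leqP i j) => [ij|/ltnW ji]; [left|right] => x.
    by rewrite -iE -jE; apply: mono.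
  by rewrite -iE -jE; apply: mono.
move=> Qs; pose W j x := if (j <= n)%N then Q x /\ x \in N j
  else exists y z, [/\ Q y, z \in N (j - n)%N & x = y + z].
have psI (i : nat) : (i <= n)%N -> psub (fun x => Q x /\ x \in N i).
  move/Nps=> [n0 nD]; case: Qs => q0 qD; split=> // a x y [? ?] [? ?].
  by split; [apply: qD|apply: nD].
have psD (i : nat) : (i <= n)%N ->
    psub (fun x => exists y z, [/\ Q y, z \in N i & x = y + z]).
  move/Nps=> [n0 nD]; case: Qs => q0 qD; split=> [|a x y].
    by exists 0, 0; rewrite addr0.
  move=> [u [v [qu nv ->]]] [u' [v' [qu' nv' ->]]].
  exists (a *: u + u'), (a *: v + v'); split; [exact: qD|exact: nD|].
  by rewrite scalerDr addrACA.
have WnE x : W n x <-> Q x by rewrite /W leqnn; split=> [[]|].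
have WDE i x : (i <= n)%N -> W (n + i)%N x <->
    exists y z, [/\ Q y, z \in N i & x = y + z].
  move=> lei; case: i lei => [|i] lei.
    rewrite addn0 WnE; split=> [qx|[y [z [qy /N0 -> ->]]]];
      last by rewrite addr0.
    by exists x, 0; rewrite addr0; split=> //; apply/N0.
  by rewrite /W leqNgt addnS leq_addr /= -addnS addKn.
have [||j jm|n' [N' [cl' N0' max' Nn' NW]]] := @refine (n + n)%N W.
- move=> j jm; rewrite /W; case: leqP => [/psI//|nj]; apply: psD.
  by rewrite leq_subLR.
- move=> x; rewrite /W leq0n; split=> [[_ /N0]//|->].
  by split; [case: Qs|apply/N0].
- case: (ltnP j n) => [jn|nj].
    have [NS _ Nm] := Nmax _ jn.
    rewrite /W jn (ltnW jn); split=> [x [? /NS]//|V Vs NV VN].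
    have Es : psub (fun x => exists y z, [/\ V y, z \in N j & x = y + z]).
      case: (Nps j (ltnW jn)) => n0 nD; case: (Vs) => v0 vD; split=> [|a x y].
        by exists 0, 0; rewrite addr0.
      move=> [u [v [qu nv ->]]] [u' [v' [qu' nv' ->]]].
      exists (a *: u + u'), (a *: v + v'); split; [exact: vD|exact: nD|].
      by rewrite scalerDr addrACA.
    case: (Nm _ (pred_of_closed Es)) => [x nx|x /in_pred_of[y [z [/VN[_ ny] nz
      ->]]]|hE|hE].
    + by apply/in_pred_of; exists 0, x; rewrite add0r; split=> //; case: Vs.
    + by apply: (psubD (Nps _ jn)) => //; apply: NS.
    + left=> x Vx; have [qx _] := VN x Vx; split=> //; rewrite -hE;
      apply/in_pred_of.
      exists x, 0; rewrite addr0; split=> //; exact: (Nps j (ltnW jn)).1.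
    + right=> x [qx]; rewrite -hE => /in_pred_of[y [z [vy nz xE]]].
      rewrite xE; apply: (psubD Vs) => //; apply: NV; split=> //.
      have -> : z = x - y by rewrite xE addrC addKr.
      by apply: psubB => //; apply: (VN y vy).1.
  have [i iE] : exists i, j = (n + i)%N by exists (j - n)%N; rewrite subnKC.
  subst j; rewrite ltn_add2l in jm.
  have [NS _ Nm] := Nmax _ jm.
  split=> [x|V Vs WV VW].
    rewrite -addnS => /(WDE _ _ (ltnW jm))[y [z [? /NS ? ->]]].
    by apply/(WDE _ _ jm); exists y, z.
  have Vn x : x \in N i -> V x.
    move=> nx; apply/WV/(WDE _ _ (ltnW jm)); exists 0, x; rewrite add0r.
    by split=> //; case: Qs.
  have Vq x : Q x -> V x.
    move=> nx; apply/WV/(WDE _ _ (ltnW jm)); exists x, 0; rewrite addr0.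
    by split=> //; exact: (Nps i (ltnW jm)).1.
  have Es : psub (fun x => V x /\ x \in N i.+1).
    case: (Nps _ jm) => n0 nD; case: (Vs) => v0 vD;
      split=> // a x y [? ?] [? ?].
    by split; [apply: vD|apply: nD].
  case: (Nm _ (pred_of_closed Es)) => [x nx|x /in_pred_of[]//|hE|hE].
  + by apply/in_pred_of; split; [apply: Vn|apply: NS].
  + left=> x Vx; apply/(WDE _ _ (ltnW jm)).
    have /(WDE _ _ jm)[y [z [qy nz xE]]] : W (n + i.+1)%N x by rewrite addnS;
      apply: VW.
    exists y, z; split=> //; rewrite -hE; apply/in_pred_of; split=> //.
    have -> : z = x - y by rewrite xE addrC addKr.
    by apply: psubB => //; apply: Vq.
  + right=> x; rewrite -addnS => /(WDE _ _ jm)[y [z [qy nz ->]]].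
    apply: (psubD Vs); first exact: Vq.
    by move: nz; rewrite -hE => /in_pred_of[].
have [|e eN] := Nu n' N'.
  split=> // x; apply/Nn'/(WDE n); first exact: leqnn.
  by exists 0, x; rewrite add0r Nn; split=> //; case: Qs.
have [i lei iE] := NW n (leq_addr _ _).
subst n'; exists i => // x; rewrite -eN // iE; exact: WnE.
Qed.
End Serial.

Section Artinian.
Variables (A : nzRingType) (M : lmodType A).

Definition span n (s : nat -> M) (x : M) : Prop :=
  exists c : nat -> A, x = \sum_(i < n) c i *: s i.

Lemma psub_span n s : psub (span n s).
Proof.
split=> [|a _ _ [c ->] [d ->]].
  by exists (fun _ => 0); rewrite big1 // => i _; rewrite scale0r.
exists (fun i => a * c i + d i); rewrite scaler_sumr -big_split /=.
by apply: eq_bigr => i _; rewrite scalerDl scalerA.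
Qed.

Lemma desc_mono (N : nat -> {pred M}) : (forall i, {subset N i.+1 <= N i}) ->
  forall i j, (i <= j)%N -> {subset N j <= N i}.
Proof.
move=> Nd i j /subnK <-; elim: (j - i)%N => [x //|k IHk x].
by rewrite addSn => /Nd/IHk.
Qed.

(** * Descending chains and decomposition into uniserial modules *)

(** Induction on the number of generators: a chain of submodules of
    [span n.+1 s] is controlled by its traces on [span n s] and the ideals of
    the coefficients of [s n]. *)
Lemma span_dcc n s (N : nat -> {pred M}) : artinian (A^o : lmodType A) ->
  (forall i, submod_closed (N i)) -> (forall i, {subset N i.+1 <= N i}) ->
  (forall x, x \in N 0%N -> span n s x) ->
  exists n, forall m, (n <= m)%N -> N m =i N n.
Proof.
move=> aA; elim: n N => [|n IHn] N Ncl Nd Ns.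
  exists 0%N => m _ x; apply/idP/idP => [/(desc_mono Nd (leq0n m))//|/Ns[c]].
  by rewrite big_ord0 => ->; case: (Ncl m).
have Nps i := closed_psub (Ncl i).
pose N' i := pred_of (fun x => x \in N i /\ span n s x).
pose J i := pred_of (fun a : A^o => exists y, span n s y /\ a *: s n + y \in N
  i).
have [sp0 spD] := psub_span n s.
have [|||n1 h1] := IHn N'.
- move=> i; apply: pred_of_closed; have [n0 nD] := Nps i;
  split=> // a x y [? ?] [? ?].
  by split; [apply: nD|apply: spD].
- by move=> i x /in_pred_of[/Nd ? ?]; apply/in_pred_of.
- by move=> x /in_pred_of[].
have [||n2 h2] := aA J.
- move=> i; apply: pred_of_closed; have [n0 nD] := Nps i; split=> [|a x y].
    by exists 0; rewrite scale0r addr0.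
  move=> [u [us ux]] [v [vs vy]]; exists (a *: u + v); split; first exact: spD.
  by rewrite scalerDl -scalerA addrACA -scalerDr; apply: nD.
- by move=> i a /in_pred_of[y [? /Nd ?]]; apply/in_pred_of; exists y.
exists (maxn n1 n2) => m; rewrite geq_max => /andP[n1m n2m] x.
set q := maxn n1 n2.
have n1q : (n1 <= q)%N by apply: leq_maxl.
have n2q : (n2 <= q)%N by apply: leq_maxr.
have qm : (q <= m)%N by rewrite geq_max n1m.
apply/idP/idP => [|xq]; first exact: desc_mono.
have [c] := Ns _ (desc_mono Nd (leq0n q) xq); rewrite big_ord_recr /=.
set y := \sum_(i < n) _ => xE.
have ys : span n s y by exists c.
have : (c n : A^o) \in J q by apply/in_pred_of; exists y; rewrite addrC -xE.
rewrite (h2 q n2q) -(h2 m n2m) => /in_pred_of[y' [ys' xm]].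
have xm' := desc_mono Nd qm xm.
have : x - (c n *: s n + y') \in N' q.
  apply/in_pred_of; split; first exact: (psubB (Nps q)).
  rewrite xE [y + _]addrC opprD addrACA subrr add0r.
  by apply: (psubB (psub_span n s)).
rewrite (h1 q n1q) -(h1 m n1m) => /in_pred_of[xy _].
by rewrite -[x](subrK (c n *: s n + y')); apply: (psubD (Nps m)).
Qed.

Lemma fg_artinian : artinian (A^o : lmodType A) -> finitely_generated M ->
  artinian M.
Proof.
move=> aA /fgP[n [s h]] N Ncl Nd; apply: span_dcc aA Ncl Nd _ => x _.
exact: h.
Qed.

Lemma artinian_min (F : (M -> Prop) -> Prop) : artinian M ->
  (forall W, F W -> psub W) -> (exists W, F W) ->
  exists W, F W /\ forall W', F W' -> (forall x, W' x -> W x) ->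
    forall x, W x -> W' x.
Proof.
move=> aM Fs [W0 FW0]; apply: contrapT => nmin.
have step (W : {W | F W}) : exists W' : {W | F W},
    (forall x, sval W' x -> sval W x) /\ exists2 x, sval W x & ~ sval W' x.
  apply: contrapT => nW; apply: nmin; exists (sval W); split;
    first exact: svalP.
  move=> W' FW' sW' x Wx; apply: contrapT => W'x; apply: nW.
  by exists (exist _ W' FW'); split=> //; exists x.
have [g gE] := choice step.
pose W i := iter i g (exist _ W0 FW0).
have [||n h] := aM (fun i => pred_of (sval (W i))).
- by move=> i; apply/pred_of_closed/Fs/svalP.
- by move=> i x /in_pred_of/(gE _).1 ?; apply/in_pred_of.
have [_ [x Wx nWx]] := gE (W n); apply: nWx.
have := h n.+1 (leqnSn n) x; move/in_pred_of: Wx => -> /in_pred_of; exact.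
Qed.
End Artinian.

Section DirectSum.
Variable A : nzRingType.
Implicit Types M N K L X Y Z P I C S T U V E : lmodType A.

Inductive uniserial_sum : lmodType A -> Prop :=
| uniserial_sum_zero M : zero_module M -> uniserial_sum M
| uniserial_sum_cons U X M : uniserial U -> uniserial_sum X ->
  iso M (U * X)%type -> uniserial_sum M.

Lemma uniserial_sum_iso M N : iso M N -> uniserial_sum N -> uniserial_sum M.
Proof.
move=> + h; case: h => [N' N0|U X N' uU dX e'] e.
  by apply: uniserial_sum_zero; apply: zero_iso (iso_sym e) N0.
by apply: uniserial_sum_cons uU dX (iso_trans e e').
Qed.

Lemma iso_prod0l X Y : zero_module X -> iso (X * Y)%type Y.
Proof.
move=> X0; apply: (iso_intro (f := snd)) => [|y]; last by exists (0, y).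
by apply: inj0 => -[x y] /= ->; rewrite (X0 x).
Qed.

Lemma iso_prod0r X Y : zero_module Y -> iso (X * Y)%type X.
Proof.
move=> X0; apply: (iso_intro (f := fst)) => [|y]; last by exists (y, 0).
by apply: inj0 => -[x y] /= ->; rewrite (X0 y).
Qed.

Lemma iso_prodA U X Y Z : iso X (U * Y)%type ->
  iso (X * Z)%type (U * (Y * Z))%type.
Proof.
move=> /isoE[f [g [fK gK]]].
have [h hE] := pair_map (snd \o f \o fst : {linear (X * Z)%type -> Y})
  (snd : {linear (X * Z)%type -> Z}).
have [k kE] := pair_map (fst \o f \o fst : {linear (X * Z)%type -> U}) h.
apply: (iso_intro (f := k)).
  apply: inj0 => -[x z]; rewrite kE hE /= => -[f1 f2 ->].
  suff -> : x = 0 by [].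
  by rewrite -(fK x); case: (f x) f1 f2 => /= u y -> ->; rewrite linear0.
by move=> [u [y z]]; exists (g (u, y), z); rewrite kE hE /= gK.
Qed.

Lemma uniserial_sum_prod X Y : uniserial_sum X -> uniserial_sum Y ->
  uniserial_sum (X * Y)%type.
Proof.
move=> dX dY; elim: dX => {X} [X X0|U X M uU dX IH e].
  exact: uniserial_sum_iso (iso_prod0l _ X0) dY.
by apply: uniserial_sum_cons uU IH _; apply: iso_prodA.
Qed.

Lemma uniserial_sum_uniserial U : uniserial U -> uniserial_sum U.
Proof.
move=> uU; have [Z Z0] := zero_exists A.
by apply: uniserial_sum_cons uU (uniserial_sum_zero Z0) _;
  apply/iso_sym/iso_prod0r.
Qed.

Lemma fg_surj M N (f : {linear M -> N}) : surjective f ->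
  finitely_generated M -> finitely_generated N.
Proof.
move=> fS [n [s h]]; exists n, (fun i => f (s i)) => y.
have [x <-] := fS y; have [c ->] := h x; exists c.
by rewrite linear_sum; apply: eq_bigr => i _; rewrite linearZ_LR.
Qed.

(** A minimal submodule that is finitely generated but not a sum of uniserial
    modules is nonzero and decomposable, and its two summands are smaller. *)
Lemma artinian_uniserial_sum M :
  (forall M, finitely_generated M -> indecomposable M -> serial M) ->
  artinian M -> finitely_generated M -> uniserial_sum M.
Proof.
move=> ser aM fgM; apply: contrapT => ndM.
pose F (W : M -> Prop) := psub W /\ exists N (i : {linear N -> M}),
  [/\ injective i, forall x, W x <-> exists y, i y = x,
      finitely_generated N & ~ uniserial_sum N].
have [W [[Ws [N [i [iI iE fgN ndN]]]] Wmin]] : exists W, F W /\ forall W',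
  F W' ->
    (forall x, W' x -> W x) -> forall x, W x -> W' x.
  apply: artinian_min aM _ _ => [W []//|].
  exists (fun _ => True); split=> //; exists M, idfun; split=> // x.
  by split=> // _; exists x.
have N0 : ~ zero_module N by move/uniserial_sum_zero.
have : ~ indecomposable N by move=> /(ser _
  fgN)/serial_uniserial/uniserial_sum_uniserial.
have sub X (j : {linear X -> N}) (p : {linear N -> X}) :
    injective j -> surjective p -> ~ surjective j -> uniserial_sum X.
  move=> jI pS jnS; apply: contrapT => ndX; apply: jnS => y.
  have [] := Wmin (fun x => exists y, i (j y) = x) _ _ (i y).
  - split; first exact: (psub_im (i \o j : {linear X -> M})).
    exists X, (i \o j : {linear X -> M}); split=> //; first exact: inj_comp.
    exact: fg_surj pS fgN.
  - by move=> _ [x <-]; apply/iE; exists (j x).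
  - by apply/iE; exists y.
  - by move=> x /iI <-; exists x.
apply; split=> // X Y e; apply: contrapT => /not_orP[X0 Y0]; apply: ndN.
have [f [g [fK gK]]] := isoE e.
have [z zE] := zero_map X Y; have [z' z'E] := zero_map Y X.
have [a aE] := pair_map (idfun : {linear X -> X}) z.
have [b bE] := pair_map z' (idfun : {linear Y -> Y}).
apply: uniserial_sum_iso e _; apply: uniserial_sum_prod.
  apply: (sub _ (g \o a : {linear X -> N}) (fst \o f : {linear N -> X})).
  - by apply: inj_comp; [exact: can_inj gK|move=> x y; rewrite !aE => -[]].
  - by move=> x; exists (g (x, 0)); rewrite /= gK.
  - move=> h; apply: Y0 => y; have [x /= xE] := h (g (0, y)).
    by move/(congr1 f): xE; rewrite !gK aE zE => -[].
apply: (sub _ (g \o b : {linear Y -> N}) (snd \o f : {linear N -> Y})).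
- by apply: inj_comp; [exact: can_inj gK|move=> x y; rewrite !bE => -[]].
- by move=> x; exists (g (0, x)); rewrite /= gK.
- move=> h; apply: X0 => y; have [x /= xE] := h (g (y, 0)).
  by move/(congr1 f): xE; rewrite !gK bE z'E => -[].
Qed.

(** The images in [X] of the summands of [V] form a chain, so the largest one is
    all of [X]. *)
Lemma uniserial_sum_surj V X (f : {linear V -> X}) :
  uniserial_sum V -> surjective f -> chained X -> ~ zero_module X ->
    projective V ->
  exists U (g : {linear U -> X}), [/\ surjective g, uniserial U & projective U].
Proof.
move=> dV; elim: dV f => {V} [V V0|U V M uU dV IH e] f fS cX X0.
  by case: X0 => x; have [y <-] := fS x; rewrite (V0 y) linear0.
move/(proj_iso (iso_sym e)) => UVp; have [k [l [kK lK]]] := isoE e.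
have [z zE] := zero_map U V; have [z' z'E] := zero_map V U.
have [a aE] := pair_map (idfun : {linear U -> U}) z.
have [b bE] := pair_map z' (idfun : {linear V -> V}).
have Vp : projective V.
  by apply: (proj_retract (u := b) (v := snd)) UVp => x; rewrite bE.
have Up : projective U.
  by apply: (proj_retract (u := a) (v := fst)) UVp => x; rewrite aE.
have fE x : exists u v, x = f (l (a u)) + f (l (b v)).
  have [y <-] := fS x; exists (k y).1, (k y).2.
  rewrite -!linearD aE bE zE z'E -[X in f X = _]kK; congr (f (l _)).
  by case: (k y) => u v; congr (_, _); rewrite /= ?addr0 ?add0r.
case: (chained_im (f \o l \o a : {linear U -> X}) (f \o l \o b : {linear V ->
  X}) cX).
  move=> h; apply: (IH (f \o l \o b : {linear V -> X})) => // x.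
  have [u [v ->]] := fE x; have [w /= wE] := h u.
  by exists (w + v); rewrite /= !linearD wE.
move=> h; exists U, (f \o l \o a : {linear U -> X}); split=> // x.
have [u [v ->]] := fE x; have [w /= wE] := h v.
by exists (u + w); rewrite /= !linearD wE.
Qed.

(** The kernels of the components of [i] form a chain with intersection zero, so
    one component is injective; by maximality of [U] it is bijective. *)
Lemma uniserial_sum_split U V (i : {linear U -> V}) : uniserial_sum V ->
  injective i -> chained U ->
  ~ zero_module U ->
  (forall V1 (j : {linear U -> V1}), uniserial V1 -> injective j ->
    surjective j) ->
  exists r : {linear V -> U}, cancel i r.
Proof.
move=> dV + cU U0 Umax; elim: dV i => {V} [V V0|V1 V M uV1 dV IH e] i iI.
  by case: U0 => x; apply: (inj0P iI); apply: V0.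
have [k [l [kK lK]]] := isoE e.
have kn x : (k (i x)).1 = 0 -> (k (i x)).2 = 0 -> x = 0.
  move=> k1 k2; apply: (inj0P iI); rewrite -(kK (i x)).
  by case: (k (i x)) k1 k2 => /= u v -> ->; rewrite linear0.
case: (chained_ker (fst \o k \o i : {linear U -> V1}) (snd \o k \o i : {linear
  U -> V}) cU)
    => /= h.
  have I1 : injective (fst \o k \o i : {linear U -> V1}).
    by apply: inj0 => x /= k1; apply: kn => //; apply: h.
  have /isoE[f [g [fK gK]]] := iso_intro I1 (Umax _ _ uV1 I1).
  have [c cE] := factor_inj I1 (f := fst \o k : {linear M -> V1})
    (fun x => Umax _ _ uV1 I1 _).
  by exists c => x; apply: I1; rewrite cE.
have I1 : injective (snd \o k \o i : {linear U -> V}).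
  by apply: inj0 => x /= k1; apply: kn => //; apply: h.
have [r rK] := IH _ I1.
by exists (r \o snd \o k : {linear M -> U}) => x; apply: rK.
Qed.

(** * Baer's criterion *)

Section Baer.
Variable U : lmodType A.
Hypothesis Uext : forall K (j : {linear K -> (A^o : lmodType A)}) (f : {linear
  K -> U}),
  injective j -> exists h : {linear (A^o : lmodType A) ->
    U}, forall x, h (j x) = f x.

Variables (X Y : lmodType A) (i : {linear X -> Y}) (g : {linear X -> U}).
Hypothesis iI : injective i.

(** The graph of a linear map from a submodule of [Y] to [U] that extends
    [g]. *)
Definition partial_extension (G : (Y * U)%type -> Prop) := [/\ psub G,
  forall u, G (0, u) -> u = 0 & forall x, G (i x, g x)].

Lemma partial_extension_functional G y u u' : partial_extension G ->
  G (y, u) -> G (y, u') -> u = u'.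
Proof.
case=> Gs G0 _ h h'; apply/eqP; rewrite -subr_eq0; apply/eqP/G0.
by have := psubB Gs h h'; congr G; congr (_, _); rewrite /= subrr.
Qed.

Lemma partial_extension_graph : partial_extension (fun z => exists x, z = (i x,
  g x)).
Proof.
split=> [|u [x [/esym/(inj0P iI) -> ->]]|x]; last by exists x.
  split=> [|a _ _ [x ->] [y ->]]; first by exists 0; rewrite !linear0.
  by exists (a *: x + y); rewrite !linearP.
by rewrite linear0.
Qed.

(** Zorn's lemma; the empty set is admitted because it is the union of the
    empty chain. *)
Lemma partial_extension_max : exists G, partial_extension G /\
  forall G', partial_extension G' -> (forall z, G z -> G' z) ->
    forall z, G' z -> G z.
Proof.
have [F FP Ftot|G [GP Gmax]] := @Zorn_bigcup (Y * U)%type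
    (fun G => (forall z, ~ G z) \/ partial_extension G).
  case: (pselect (exists2 G, F G & partial_extension G)) => [[G0 FG0 pG0]|h];
    last first.
    left=> z [G FG Gz]; case: (FP _ FG) => [/(_ z)//|pG].
    by apply: h; exists G.
  have pF G z : F G -> G z -> partial_extension G by move=> /FP[/(_ z)|].
  right; split=> [|u [G FG Gu]|x].
  - split=> [|a x y [G FG Gx] [G' FG' Gy]].
      by exists G0 => //; case: pG0 => -[].
    case: (Ftot _ _ FG FG') => h.
      by exists G' => //; have [[_ qD] _ _] := pF _ _ FG' Gy; apply: qD => //;
        apply: h.
    by exists G => //; have [[_ qD] _ _] := pF _ _ FG Gx; apply: qD => //;
      apply: h.
  - by have [_ G00 _] := pF _ _ FG Gu; apply: G00.
  - by exists G0 => //; case: pG0.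
have nG G' : partial_extension G' -> (forall z, G z -> G' z) ->
  forall z, G' z -> G z.
  move=> pG' GG' z G'z; apply: contrapT => Gz; apply: (Gmax G'); last by right.
  by split=> // h; apply: Gz; apply: h.
case: GP => [G0|pG]; last by exists G.
have [[q0 _] _ _] := partial_extension_graph.
by case: (G0 0); apply: (nG _ partial_extension_graph) => // z /G0.
Qed.

(** If [y] is outside the domain, extend the map [a |-> G (a y)] from the
    ideal of all [a] with [a y] in the domain to [A]; the value at [1] may then
    be assigned to [y]. *)
Lemma partial_extension_total G : partial_extension G ->
  (forall G', partial_extension G' -> (forall z, G z -> G' z) ->
    forall z, G' z -> G z) ->
  forall y, exists u, G (y, u).
Proof.
move=> pG Gmax y; have [Gs G0 Gg] := pG; have [q0 qD] := Gs.
have Ks : psub (fun a : A^o => exists u, G (a *: y, u)).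
  split=> [|a b c [u bu] [v cv]]; first by exists 0; rewrite scale0r.
  exists (a *: u + v); have := qD a _ _ bu cv; congr G.
  by congr (_, _); rewrite /= scalerDl -scalerA.
have [K [j [jI jE]]] := submodule_exists Ks.
have [f fE] := choice (fun k => (jE (j k)).2 (ex_intro _ k erefl)).
have [|F FE] := @mk_linear A K U f.
  move=> a k k'; apply: (partial_extension_functional pG (fE _)).
  have := qD a _ _ (fE k) (fE k'); congr G; congr (_, _).
  by rewrite linearP /= scalerDl -scalerA.
have [h hE] := Uext F jI.
have hZ a : h a = a *: h 1.
  by rewrite -linearZ_LR; congr (h _); rewrite /GRing.scale /= mulr1.
pose G' z := exists a w, G w /\ z = w + a *: ((y, h 1) : (Y * U)%type).
suff pG' : partial_extension G'.
  exists (h 1); apply: (Gmax G' pG') => [z Gz|].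
    by exists 0, z; rewrite scale0r addr0.
  by exists 1, 0; rewrite scale1r add0r.
split=> [|u [a [[w1 w2] [Gw [e1 ->]]]]|x].
- split=> [|a x z]; first by exists 0, 0; rewrite scale0r addr0.
  move=> [b [w [Gw ->]]] [c [v [Gv ->]]]; exists (a * b + c), (a *: w + v).
  split; first exact: qD.
  by rewrite scalerDr scalerA scalerDl addrACA.
- have Gn : G (a *: y, - w2).
    have := psubN Gs Gw; congr G; congr (_, _) => /=.
    by apply/eqP; rewrite -subr_eq0 -opprD oppr_eq0 -e1.
  have [k kE] := (jE a).1 (ex_intro _ _ Gn).
  have fk : f k = - w2 by apply: (partial_extension_functional pG (fE k));
    rewrite kE.
  by rewrite -hZ -kE hE FE fk subrr.
- by exists 0, (i x, g x); rewrite scale0r addr0.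
Qed.

Lemma baer_extend : exists h : {linear Y -> U}, forall x, h (i x) = g x.
Proof.
have [G [pG Gmax]] := partial_extension_max; have [f fE] :=
  choice (partial_extension_total pG Gmax).
have [[_ qD] _ Gg] := pG.
have [|h hE] := @mk_linear A Y U f.
  move=> a x y; apply: (partial_extension_functional pG (fE _)).
  exact: (qD a _ _ (fE x) (fE y)).
by exists h => x; rewrite hE; apply: (partial_extension_functional pG (fE _)).
Qed.
End Baer.

Lemma baer U :
  (forall K (j : {linear K -> (A^o : lmodType A)}) (f : {linear K -> U}),
    injective j ->
    exists h : {linear (A^o : lmodType A) -> U}, forall x, h (j x) = f x) ->
  injective_module U.
Proof. by move=> h X Y i g iI; apply: baer_extend. Qed.

(** * Projective covers and injective envelopes *)

Lemma cover_unique M P P' (f : {linear P -> M}) (f' : {linear P' -> M}) :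
  projective_cover f -> projective_cover f' -> iso P P'.
Proof.
move=> [Pp fS fE] [Pp' fS' fE'].
have [h hE] := Pp _ _ f' f fS'.
have hS : surjective h.
  move=> y; apply/(in_pred_of (fun y => exists x, h x = y)); apply: fE';
    first exact: pred_of_closed (psub_im h).
  move=> x; have [z zE] := fS (f' x); exists (h z); first by apply/in_pred_of;
    exists z.
  by rewrite linearB hE zE subrr.
have [s sE] := Pp' _ _ h idfun hS.
apply/iso_sym/(iso_intro (f := s)); first exact: can_inj sE.
move=> y; apply/(in_pred_of (fun y => exists x, s x = y)); apply: fE;
  first exact: pred_of_closed (psub_im s).
move=> x; exists (s (h x)); first by apply/in_pred_of; exists (h x).
by rewrite linearB -hE -[f (s _)]hE sE subrr.
Qed.

Lemma envelope_unique M I I' (f : {linear M -> I}) (f' : {linear M -> I'}) :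
  injective_envelope f -> injective_envelope f' -> iso I I'.
Proof.
move=> [Ii fI fE] [Ii' fI' fE'].
have [h hE] := Ii' _ _ f f' fI.
have hI : injective h.
  apply: inj0 => x hx; apply: contrapT => x0.
  have [|y /in_pred_of] := fE _ (pred_of_closed (psub_ker h));
    first by exists x => //; apply/in_pred_of.
  by rewrite hE => /(inj0P fI') ->; rewrite linear0.
have [r rE] := Ii _ _ h idfun hI.
apply: (iso_intro hI); have rI : injective r; last first.
  by move=> y; exists (r y); apply: rI; rewrite rE.
apply: inj0 => x hx; apply: contrapT => x0.
have [|y /in_pred_of] := fE' _ (pred_of_closed (psub_ker r));
  first by exists x => //; apply/in_pred_of.
by rewrite -hE rE /= => ->; rewrite linear0.
Qed.

Lemma chained_cover P X (f : {linear P -> X}) : projective P -> surjective f ->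
  chained P -> ~ zero_module X -> projective_cover f.
Proof.
move=> Pp fS cP X0; split=> // N /closed_psub Ns NE x.
case: (cP _ _ Ns (psub_ker f)) => h.
  case: X0 => z; have [y <-] := fS z; have [w /h fw] := NE y.
  by rewrite linearB fw subr0.
have [y yN /h xy] := NE x.
by rewrite -[x](subrK y); apply: (psubD Ns).
Qed.

Lemma chained_envelope I X (f : {linear X -> I}) : injective_module I ->
  injective f -> chained I -> ~ zero_module X -> injective_envelope f.
Proof.
move=> Ii fI cI /nonzeroP[x0 x0n]; split=> // N /closed_psub Ns [x xN xn].
case: (cI _ _ Ns (psub_im f)) => h.
  by have [y yE] := h x xN; exists y; rewrite yE.
exists x0; first by apply: h; exists x0.
by move/(inj0P fI).
Qed.
End DirectSum.

Section Enough.
Variable A : nzRingType.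
Implicit Types M N K L X Y Z P I C S T U V E : lmodType A.
Hypothesis finA : finite_length (A^o : lmodType A).
Hypothesis decomposes : forall M, finite_length M -> uniserial_sum M.

Lemma uniserial_cover X : uniserial X -> exists P (f : {linear P -> X}),
  projective_cover f /\ uniserial P.
Proof.
move=> uX; have [fX cX] := uX.
case: (pselect (zero_module X)) => X0.
  exists X, idfun; split=> //; split; [exact: zero_proj|by move=> x; exists x|].
  by move=> N [N0 _] _ x; rewrite (X0 x).
have [P [f [fP Pp fS]]] := fg_cover finA (finite_length_fg fX).
have [U [g [gS uU Up]]] := uniserial_sum_surj (decomposes fP) fS cX X0 Pp.
by exists U, g; split=> //; apply: chained_cover => //; case: uU.
Qed.

(** This bounds the length of a uniserial module by the length of [A]. *)
Lemma uniserial_cyclic X : uniserial X -> exists f : {linear (A^o : lmodType A)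
  -> X}, surjective f.
Proof.
move=> [fX cX]; case: (pselect (zero_module X)) => X0.
  have [f fE] := zero_map (A^o : lmodType A) X.
  by exists f => x; exists 0; rewrite fE (X0 x).
have [S [p [sS pS]]] := finite_length_top fX X0.
have [y y0] := (nonzeroP S).1 sS.1; have [x xE] := pS y.
have [f fE] := cyclic_map x; exists f => z.
case: (chained_imker f p cX) => h.
  by case: y0; rewrite -xE; have := h 1; rewrite fE scale1r.
have [a aE] := simple_cyclic sS y0 (p z).
have [b bE] := h (z - a *: x) ltac:(by rewrite linearB linearZ_LR xE aE subrr).
by exists (b + a); rewrite linearD bE fE subrK.
Qed.

(** A uniserial module [U] of maximal length containing [S] splits off every
    module [E] of finite length that contains it: some uniserial summand of [E]
    contains [U].  Applied to pushouts along inclusions of left ideals, this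
    verifies Baer's criterion. *)
Lemma simple_envelope S : simple_module S -> exists I (f : {linear S -> I}),
  injective_envelope f /\ uniserial I.
Proof.
move=> sS; have [L hL] := finA.
pose Pn n := exists U (f : {linear S -> U}),
  [/\ uniserial U, injective f, has_length n U & forall m, has_length m U ->
    (n <= m)%N].
have Pn0 U (f : {linear S -> U}) : uniserial U -> injective f -> exists n, Pn n.
  move=> uU fI; have [n [hn nmin]] := finite_length_min uU.1.
  by exists n, U, f.
have PnL n : `[< Pn n >] -> (n <= L)%N.
  move=> /asboolP[U [f [uU fI hn nmin]]]; have [g gS] := uniserial_cyclic uU.
  have [m [mL hm _]] := has_length_quo hL gS.
  exact: leq_trans (nmin _ hm) mL.
have exP : exists n, `[< Pn n >].
  have [n hn] := Pn0 S idfun (uniserial_simple sS) (fun x y e => e).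
  by exists n; apply/asboolP.
case: (ex_maxnP exP PnL) => n /asboolP[U [f [uU fI hn nmin]]] nmax.
have Umax V1 (j : {linear U -> V1}) : uniserial V1 -> injective j ->
  surjective j.
  move=> uV jI; have [n1 [h1 n1min]] := finite_length_min uV.1.
  have n1n : (n1 <= n)%N.
    apply/nmax/asboolP; exists V1, (j \o f : {linear S -> V1}); split=> //.
    exact: inj_comp.
  have [m [mn1 /nmin nm]] := has_length_sub h1 jI; apply.
  by apply/eqP; rewrite eqn_leq mn1 (leq_trans n1n).
have U0 : ~ zero_module U.
  have [y y0] := (nonzeroP S).1 sS.1; move=> U0; apply: y0.
  by apply: (inj0P fI); apply: U0.
have Ui : injective_module U.
  apply: baer => K j g jI; have [C [c s]] := short_exact_coker jI.
  have [E [a [b [q [s' abg _ _ _]]]]] := pushout g s.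
  have [bI _ _] := s'; have [_ cS _] := s.
  have fE : finite_length E by apply: (finite_length_ext s' uU.1);
    apply: finite_length_quo finA cS.
  have [r rK] := uniserial_sum_split (decomposes fE) bI uU.2 U0 Umax.
  by exists (r \o a : {linear (A^o : lmodType A) -> U}) => x /=; rewrite abg rK.
exists U, f; split=> //; apply: chained_envelope => //; first by case: uU.
by case: sS.
Qed.

Lemma uniserial_envelope X : uniserial X -> exists I (f : {linear X -> I}),
  injective_envelope f /\ uniserial I.
Proof.
move=> uX; have [fX cX] := uX.
case: (pselect (zero_module X)) => X0.
  exists X, idfun; split=> //; split; [exact: zero_inj|by []|].
  by move=> N _ [x _]; rewrite (X0 x).
have [S [i [sS iI]]] := finite_length_socle fX X0.
have [I [f [[Ii fI fE] uI]]] := simple_envelope sS.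
have [g gE] := Ii _ _ i f iI.
exists I, g; split=> //; apply: chained_envelope => //; last by case: uI.
apply: inj0 => x gx; case: (chained_imker i g cX) => h.
  case: sS => + _; case=> s; apply: (inj0P fI); rewrite -gE; exact: h.
have [s sE] := h x gx; rewrite -sE; move: gx; rewrite -sE gE => /(inj0P fI) ->.
by rewrite linear0.
Qed.

Lemma enough_proj X : finite_length X -> exists P (p : {linear P -> X}),
  [/\ finite_length P, projective P & surjective p].
Proof. by move=> /finite_length_fg; apply: fg_cover. Qed.

Lemma enough_inj X : finite_length X -> exists I (i : {linear X -> I}),
  [/\ finite_length I, injective_module I & injective i].
Proof.
case=> n; elim: n X => [|n IHn] X.
  move/has_length0=> X0; exists X, idfun; split=> //; last exact: zero_inj.
  exact: finite_length_zero.
case/has_lengthS=> K [S [i [p [s sS /IHn[I [j [fI Ii jI]]]]]]].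
have [I' [f [[Ii' fI' _] uI']]] := simple_envelope sS.
have [iI pS ip] := s; have [h hE] := Ii _ _ i j iI.
have [k kE] := pair_map h (f \o p : {linear X -> I'}).
exists (I * I')%type, k; split; [exact: finite_length_prod fI uI'.1|exact:
  inj_prod|].
apply: inj0 => x; rewrite kE /= => -[hx /(inj0P fI')/ip[y yE]].
by move: hx; rewrite -yE hE => /(inj0P jI) ->; rewrite linear0.
Qed.
End Enough.

Section Horseshoe.
Variable A : nzRingType.
Implicit Types M N K L X Y Z P Q I J C D S T U V E : lmodType A.

(** * Horseshoe and Schanuel lemmas *)

Lemma horseshoe X Y Z (i : {linear X -> Y}) (p : {linear Y -> Z})
    K P (j : {linear K -> P}) (f : {linear P -> X})
    L Q (l : {linear L -> Q}) (g : {linear Q -> Z}) :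
  short_exact i p -> projective P -> short_exact j f -> projective Q ->
    short_exact l g ->
  exists Y' (a : {linear K -> Y'}) (b : {linear Y' ->
    L}), short_exact a b /\ syz1 Y Y'.
Proof.
move=> s Pp sP Qp sQ; have [iI pS _] := s; have [jI fS _] := sP.
have [lI gS _] := sQ; have [h hE] := Qp _ _ p g pS.
have [c cE] := copair_map (i \o f : {linear P -> Y}) h.
have cS : surjective c.
  move=> y; have [z zE] := gS (p y).
  have [x xE] : exists x, i x = y - h z.
    by apply: (short_exact_lift s); rewrite linearB hE zE subrr.
  by have [w wE] := fS x; exists (w, z); rewrite cE /= wE xE subrK.
have [Y' [k s']] := short_exact_ker cS; have [kI _ _] := s'.
have [z0 z0E] := zero_map K Q; have [d dE] := pair_map j z0.
have [|a aE] := factor_inj kI (f := d).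
  by move=> x; apply: (short_exact_lift s'); rewrite dE cE /= (short_exact0 _
    sP) z0E !linear0 addr0.
have [|b bE] := factor_inj lI (f := snd \o k : {linear Y' -> Q}).
  move=> x; apply: (short_exact_lift sQ) => /=; rewrite -hE.
  by have := short_exact0 x s'; rewrite cE /= => /(congr1 p);
    rewrite linearD (short_exact0 _ s) add0r linear0.
exists Y', a, b; split; last by exists (P * Q)%type, k, c; split=> //;
  apply: proj_prod.
split=> [|y|x].
- apply: inj0 => x ax; apply: (inj0P jI).
  by have := aE x; rewrite ax linear0 dE => -[].
- have [x xE] : exists x, i x = - h (l y).
    by apply: (short_exact_lift s); rewrite linearN hE (short_exact0 _ sQ)
      oppr0.
  have [w wE] := fS x.
  have [v vE] : exists v, k v = (w, l y).
    by apply: (short_exact_lift s'); rewrite cE /= wE xE addNr.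
  by exists v; apply: lI; rewrite bE /= vE.
- split=> [bx|[y <-]]; last first.
    by apply: (inj0P lI); rewrite bE /= aE dE /= z0E.
  have k2 : (k x).2 = 0 by have /= := bE x; rewrite bx linear0.
  have [y yE] : exists y, j y = (k x).1.
    apply: (short_exact_lift sP); apply: (inj0P iI).
    by have := short_exact0 x s'; rewrite cE /= k2 linear0 addr0.
  exists y; apply: kI; rewrite aE dE yE z0E -k2; by case: (k x).
Qed.

Lemma cohorseshoe X Y Z (i : {linear X -> Y}) (p : {linear Y -> Z})
    I C (f : {linear X -> I}) (c : {linear I -> C})
    J D (g : {linear Z -> J}) (d : {linear J -> D}) :
  short_exact i p -> injective_module I -> short_exact f c ->
    injective_module J -> short_exact g d ->
  exists Y' (a : {linear C -> Y'}) (b : {linear Y' ->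
    D}), short_exact a b /\ cosyz1 Y Y'.
Proof.
move=> s Ii sI Ji sJ; have [iI pS _] := s; have [fI cS _] := sI.
have [gI dS _] := sJ; have [h hE] := Ii _ _ i f iI.
have [k kE] := pair_map h (g \o p : {linear Y -> J}).
have kI : injective k.
  apply: inj0 => y; rewrite kE /= => -[hy /(inj0P gI)/(short_exact_lift s)[x
    xE]].
  by move: hy; rewrite -xE hE => /(inj0P fI) ->; rewrite linear0.
have [Y' [q s']] := short_exact_coker kI; have [_ qS _] := s'.
have [z0 z0E] := zero_map I J; have [e eE] := pair_map (idfun : {linear I ->
  I}) z0.
have [|a aE] := factor_surj cS (f := q \o e : {linear I -> Y'}).
  move=> x /(short_exact_lift sI)[w <-] /=; have -> : e (f w) = k (i w).
    by rewrite eE kE /= z0E hE (short_exact0 _ s) linear0.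
  exact: short_exact0 s'.
have [|b bE] := factor_surj qS (f := d \o snd : {linear (I * J)%type -> D}).
  by move=> x /(short_exact_lift s')[w <-] /=; rewrite kE /= (short_exact0 _
    sJ).
exists Y', a, b; split; last by exists (I * J)%type, k, q; split=> //;
  apply: inj_prod.
split=> [|y|x].
- apply: inj0 => y; have [x <-] := cS y; rewrite aE /= => /(short_exact_lift
  s')[w].
  rewrite kE eE z0E /= => -[hw /(inj0P gI)/(short_exact_lift s)[v vE]].
  by rewrite -hw -vE hE (short_exact0 _ sI).
- by have [x <-] := dS y; exists (q (0, x)); rewrite bE.
- split=> [|[y <-]]; last first.
    by have [w <-] := cS y; rewrite aE bE /= eE z0E linear0.
  have [[u v] <-] := qS x; rewrite bE /= => /(short_exact_lift sJ)[z zE].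
  have [y yE] := pS z; exists (c (u - h y)); rewrite aE /=.
  apply/eqP; rewrite -subr_eq0 -linearB; apply/eqP.
  suff -> : e (u - h y) - (u, v) = - k y by rewrite linearN (short_exact0 _ s')
    oppr0.
  rewrite eE kE z0E /= yE zE; congr (_, _); rewrite /= ?sub0r //.
  by rewrite [u - _]addrC addrK.
Qed.

(** By Schanuel's lemma [X + Q] and [L + Y] are isomorphic; this is the resulting
    split embedding of [X] into [Y + L]. *)
Lemma schanuel_retract X Y Z (i : {linear X -> Y}) (p : {linear Y -> Z})
    L Q (l : {linear L -> Q}) (g : {linear Q -> Z}) :
  short_exact i p -> projective Y -> short_exact l g -> projective Q ->
  exists (u : {linear X -> (Y * L)%type}) (v : {linear (Y * L)%type ->
    X}), cancel u v.
Proof.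
move=> s Yp sQ Qp; have [iI pS _] := s; have [lI gS _] := sQ.
have [f fE] := Yp _ _ g p gS; have [h hE] := Qp _ _ p g pS.
have [|w wE] := factor_inj lI (f := f \o i : {linear X -> Q}).
  by move=> x; apply: (short_exact_lift sQ); rewrite /= fE (short_exact0 _ s).
have [u uE] := pair_map i w.
have [d dE] := diff_map (idfun : {linear Y -> Y}) (h \o f : {linear Y -> Y}).
have [k kE] := copair_map d (h \o l : {linear L -> Y}).
have [|v vE] := factor_inj iI (f := k).
  move=> x; apply: (short_exact_lift s); rewrite kE dE /= linearD linearB !hE
    fE.
  by rewrite subrr add0r (short_exact0 _ sQ).
exists u, v => x; apply: iI; rewrite vE kE uE dE /= wE /=.
by rewrite subrK.
Qed.

Lemma coschanuel_retract X Y Z (i : {linear X -> Y}) (p : {linear Y -> Z})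
    I C (f : {linear X -> I}) (c : {linear I -> C}) :
  short_exact i p -> injective_module Y -> short_exact f c ->
    injective_module I ->
  exists (u : {linear Z -> (Y * C)%type}) (v : {linear (Y * C)%type ->
    Z}), cancel u v.
Proof.
move=> s Yi sI Ii; have [iI pS _] := s; have [fI cS _] := sI.
have [al alE] := Yi _ _ f i fI; have [be beE] := Ii _ _ i f iI.
have [d dE] := diff_map (idfun : {linear Y -> Y}) (al \o be : {linear Y -> Y}).
have [e eE] := pair_map d (c \o be : {linear Y -> C}).
have [|u uE] := factor_surj pS (f := e).
  move=> x /(short_exact_lift s)[w <-]; rewrite eE dE /= beE alE (short_exact0
    _ sI) subrr //.
have [|ga gaE] := factor_surj cS (f := p \o al : {linear I -> Z}).
  by move=> x /(short_exact_lift sI)[w <-]; rewrite /= alE (short_exact0 _ s).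
have [v vE] := copair_map p ga.
exists u, v => z; have [y <-] := pS z.
by rewrite uE vE eE dE /= gaE /= linearB subrK.
Qed.
End Horseshoe.

Section Dimension.
Variable A : nzRingType.
Implicit Types M N K L X Y Z P I C S T U V E : lmodType A.
Hypothesis finA : finite_length (A^o : lmodType A).
Hypothesis decomposes : forall M, finite_length M -> uniserial_sum M.

(** * Homological dimensions over a ring of finite length *)

Lemma finite_length_syz n X : finite_length X -> exists K,
  syz n X K /\ finite_length K.
Proof.
elim: n X => [|n IHn] X fX; first by exists X; split=> //; apply: iso_refl.
have [P [p [fP Pp pS]]] := enough_proj finA fX.
have [K [i s]] := short_exact_ker pS; have [iI _ _] := s.
have [L [c fL]] := IHn K (finite_length_sub fP iI).
by exists L; split=> //; exists K; split=> //; exists P, i, p.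
Qed.

Lemma finite_length_cosyz n X : finite_length X ->
  exists K, cosyz n X K /\ finite_length K.
Proof.
elim: n X => [|n IHn] X fX; first by exists X; split=> //; apply: iso_refl.
have [P [p [fP Pp pS]]] := enough_inj finA decomposes fX.
have [K [i s]] := short_exact_coker pS; have [_ iI _] := s.
have [L [c fL]] := IHn K (finite_length_quo fP iI).
by exists L; split=> //; exists K; split=> //; exists P, p, i.
Qed.

Lemma Ext0_finite_lengthr X M : finite_length M ->
  (forall S, simple_module S -> Ext0 X S) -> Ext0 X M.
Proof.
move=> fM h; apply: (finite_length_ind_subquot _ _ fM) => [N N0|N1 N2 N3 i p s
  _|T sT _].
- exact/Ext0_inj/zero_inj.
- exact: Ext0_midr s.
- exact: h.
Qed.

Lemma Ext0_finite_lengthl X M : finite_length X ->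
  (forall S, simple_module S -> Ext0 S M) -> Ext0 X M.
Proof.
move=> fM h; apply: (finite_length_ind_subquot (Pr := fun X => Ext0 X M) _ _ fM)
  => [N N0|N1 N2 N3 i p s _|T sT _].
- exact/Ext0_proj/zero_proj.
- exact: Ext0_midl s.
- exact: h.
Qed.

(** [Ext^1(X, -)] vanishes on the kernel of a projective cover, which therefore
    splits off. *)
Lemma proj_of_Ext0 X : finite_length X -> (forall S, simple_module S ->
  Ext0 X S) ->
  projective X.
Proof.
move=> fX h; have [P [p [fP Pp pS]]] := enough_proj finA fX.
have [K [i s]] := short_exact_ker pS; have [iI _ _] := s.
have V : Ext0 X K by apply: Ext0_finite_lengthr h; apply: finite_length_sub iI.
have [g gE] := V _ _ _ _ s (idfun : {linear X -> X}).
exact: (proj_retract (u := g) (v := p)).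
Qed.

(** [A / J] has finite length for every left ideal [J], so Baer's criterion
    reduces to simple modules. *)
Lemma inj_of_Ext0 M : (forall S, simple_module S -> Ext0 S M) ->
  injective_module M.
Proof.
move=> h; apply: baer => K j f jI; have [C [c s]] := short_exact_coker jI.
have [_ cS _] := s; have fC := finite_length_quo finA cS.
have /Ext0P V := Ext0_finite_lengthl fC h.
exact: V s f.
Qed.

(** [Ext^1(K, S)] is [Ext^1(X, Sigma^n S)], which vanishes because it can also
    be computed from a projective [n]-th syzygy of [X]. *)
Lemma pd_le_syz n X K : pd_le n X -> syz n X K -> finite_length K ->
  projective K.
Proof.
move=> /pd_leP[K0 [c0 K0p]] c fK; apply: proj_of_Ext0 => // S sS.
have [C [cS _]] := finite_length_cosyz n (finite_length_simple sS).
apply/(Ext0_syz_cosyz c cS)/(Ext0_syz_cosyz c0 cS).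
exact: Ext0_proj.
Qed.

Lemma id_le_cosyz n X C : id_le n X -> cosyz n X C -> injective_module C.
Proof.
move=> /id_leP[K0 [c0 K0p]] c; apply: inj_of_Ext0 => // S sS.
have [K [cS _]] := finite_length_syz n (finite_length_simple sS).
apply/(Ext0_syz_cosyz cS c)/(Ext0_syz_cosyz cS c0).
exact: Ext0_inj.
Qed.

Lemma pd_le_ext n X Y Z (i : {linear X -> Y}) (p : {linear Y -> Z}) :
  short_exact i p -> finite_length Y -> pd_le n X -> pd_le n Z -> pd_le n Y.
Proof.
move=> s fY /pd_leP[KX [cX pX]] /pd_leP[KZ [cZ pZ]].
have [K [c fK]] := finite_length_syz n fY; apply/pd_leP; exists K; split=> //.
apply: proj_of_Ext0 => // S sS.
have [C [cS _]] := finite_length_cosyz n (finite_length_simple sS).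
apply/(Ext0_syz_cosyz c cS); apply: (Ext0_midl s).
  by apply/(Ext0_syz_cosyz cX cS)/Ext0_proj.
by apply/(Ext0_syz_cosyz cZ cS)/Ext0_proj.
Qed.

Lemma id_le_ext n X Y Z (i : {linear X -> Y}) (p : {linear Y -> Z}) :
  short_exact i p -> finite_length Y -> id_le n X -> id_le n Z -> id_le n Y.
Proof.
move=> s fY /id_leP[KX [cX pX]] /id_leP[KZ [cZ pZ]].
have [K [c fK]] := finite_length_cosyz n fY; apply/id_leP; exists K; split=> //.
apply: inj_of_Ext0 => // S sS.
have [C [cS _]] := finite_length_syz n (finite_length_simple sS).
apply/(Ext0_syz_cosyz cS c); apply: (Ext0_midr s).
  by apply/(Ext0_syz_cosyz cS cX)/Ext0_inj.
by apply/(Ext0_syz_cosyz cS cZ)/Ext0_inj.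
Qed.

Lemma pd_le_shift n X K : pd_le n.+1 X -> syz1 X K -> finite_length K ->
  pd_le n K.
Proof.
move=> h s fK; have [L [c fL]] := finite_length_syz n fK.
apply/pd_leP; exists L; split=> //; apply: (pd_le_syz h) fL.
by exists K.
Qed.

Lemma id_le_shift n X K : id_le n.+1 X -> cosyz1 X K -> finite_length K ->
  id_le n K.
Proof.
move=> h s fK; have [L [c fL]] := finite_length_cosyz n fK.
apply/id_leP; exists L; split=> //; apply: (id_le_cosyz h).
by exists K.
Qed.

(** * Finitistic dimensions are bounded by levels *)

(** [C'] and [C] are the last two cosyzygies of [M], of which only [C] is
    injective; a simple [S] with [Ext^1(S, C') <> 0] has [del S > n]. *)
Lemma fin_inj_le_del : enat_le (fin_inj A) (del_alg A).
Proof.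
apply: enat_sup_le => _ [M [fgM fin ->]].
case: (idimP M) => [[[|n] [-> idM nmin]]|[/fin //]]; first by case: (del_alg A).
have /id_leP[C [c Ci]] := idM.
have [C' [c' /(chain1 (@cosyz1_isor A)) c1]] : exists C',
  cosyz n M C' /\ cosyz 1 C' C.
  by apply: chain_split; rewrite addn1.
have nC' : ~ injective_module C'.
  move=> C'i; have /nmin : id_le n M by apply/id_leP; exists C'.
  by rewrite ltnn.
have [S [sS nS]] : exists S, simple_module S /\ ~ Ext0 S C'.
  apply: contrapT => h; apply: nC'; apply: inj_of_Ext0 => S sS.
  by apply: contrapT => hS; apply: h; exists S.
apply: (enat_le_trans (v := del S)); last by apply: enat_sup_ub; exists S.
rewrite /del; set D := (X in least X); case: (leastP D) => [[m [-> Dm _]]|[->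
  _] //].
rewrite /= ltnNge; apply/negP => mn; apply: nS.
have [N [P [M' [N' [oN [_ Pp] _ oN' sN]]]]] := Dm.
have [M1 [_ c2]] : exists M1, cosyz (n - m) M M1 /\ cosyz m M1 C'.
  by apply: chain_split; rewrite subnK.
apply/(Ext0_syz_cosyz (is_Omega_syz oN) c2).
have [u [v uK]] := summand_retract sN.
apply: (Ext0_retractl uK); apply: Ext0_suml; first exact: Ext0_proj.
apply/(Ext0_syz_cosyz (is_Omega_syz oN') (chain_rcons (@cosyz1_isol A) c2 c1)).
exact: Ext0_inj.
Qed.

Lemma fin_pro_le_des : enat_le (fin_pro A) (des_alg A).
Proof.
apply: enat_sup_le => _ [M [/(fg_finite_length finA) fM fin ->]].
case: (pdimP M) => [[[|n] [-> pdM nmin]]|[/fin //]]; first by case: (des_alg A).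
have [C' [c' fC']] := finite_length_syz n fM.
have [C [c1 fC]] := finite_length_syz 1 fC'.
have {}c1 := chain1 (@syz1_isor A) c1.
have Ci : projective C.
  by apply: (pd_le_syz pdM) fC; apply: (chain_rcons (@syz1_isol A) c' c1).
have nC' : ~ projective C'.
  move=> C'i; have /nmin : pd_le n M by apply/pd_leP; exists C'.
  by rewrite ltnn.
have [S [sS nS]] : exists S, simple_module S /\ ~ Ext0 C' S.
  apply: contrapT => h; apply: nC'; apply: proj_of_Ext0 => // S sS.
  by apply: contrapT => hS; apply: h; exists S.
apply: (enat_le_trans (v := des S)); last by apply: enat_sup_ub; exists S.
rewrite /des; set D := (X in least X); case: (leastP D) => [[m [-> Dm _]]|[->
  _] //].
rewrite /= ltnNge; apply/negP => mn; apply: nS.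
have [N [P [M' [N' [oN [_ Pp] _ oN' sN]]]]] := Dm.
have [M1 [_ c2]] : exists M1, syz (n - m) M M1 /\ syz m M1 C'.
  by apply: chain_split; rewrite subnK.
apply/(Ext0_syz_cosyz c2 (is_Sigma_cosyz oN)).
have [u [v uK]] := summand_retract sN.
apply: (Ext0_retractr uK); apply: Ext0_sumr; first exact: Ext0_inj.
apply/(Ext0_syz_cosyz (chain_rcons (@syz1_isol A) c2 c1) (is_Sigma_cosyz oN')).
exact: Ext0_proj.
Qed.

(** * Levels are bounded by the dimensions of [M_S] and [N_S] *)

(** Minimal syzygies and cosyzygies of uniserial modules are uniserial, being
    submodules of uniserial covers and quotients of uniserial envelopes; so
    [is_Omega] and [is_Sigma] can be iterated. *)
Lemma uniserial_syzygy X : uniserial X -> exists K P (i : {linear K ->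
  P}) (p : {linear P -> X}),
  [/\ projective_cover p, short_exact i p, uniserial P & uniserial K].
Proof.
move=> /(uniserial_cover finA decomposes)[P [p [cp uP]]]; have [Pp pS _] := cp.
have [K [i s]] := short_exact_ker pS; exists K, P, i, p; split=> //.
by case: s => iI _ _; apply: uniserial_sub iI.
Qed.

Lemma uniserial_cosyzygy X : uniserial X -> exists I C (i : {linear X ->
  I}) (p : {linear I -> C}),
  [/\ injective_envelope i, short_exact i p, uniserial I & uniserial C].
Proof.
move=> /(uniserial_envelope finA decomposes)[P [p [cp uP]]];
  have [Pp pS _] := cp.
have [K [i s]] := short_exact_coker pS; exists P, K, p, i; split=> //.
by case: s => _ iI _; apply: uniserial_quo iI.
Qed.

Lemma short_exact_is_syzygy X K P (i : {linear K -> P}) (p : {linear P -> X}) :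
  projective_cover p -> short_exact i p -> is_syzygy X K.
Proof. by move=> cp [iI _ e]; exists P, p, i. Qed.

Lemma short_exact_is_cosyzygy X C I (i : {linear X -> I}) (p : {linear I ->
  C}) :
  injective_envelope i -> short_exact i p -> is_cosyzygy X C.
Proof. by move=> cp [_ pS e]; exists I, i, p. Qed.

Lemma Omega_exists n X : uniserial X -> exists N, is_Omega n X N /\ uniserial N.
Proof.
elim: n X => [|n IHn] X uX; first by exists X; split=> //; apply: iso_refl.
have [K [P [i [p [cp s uP uK]]]]] := uniserial_syzygy uX.
have [N [oN uN]] := IHn K uK; exists N; split=> //.
exact: is_Omega_cons (short_exact_is_syzygy cp s) oN.
Qed.

Lemma Sigma_exists n X : uniserial X -> exists N, is_Sigma n X N /\ uniserial N.
Proof.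
elim: n X => [|n IHn] X uX; first by exists X; split=> //; apply: iso_refl.
have [I [C [i [p [cp s uP uK]]]]] := uniserial_cosyzygy uX.
have [N [oN uN]] := IHn C uK; exists N; split=> //.
exact: is_Sigma_cons (short_exact_is_cosyzygy cp s) oN.
Qed.

(** Induction by the horseshoe lemma until the middle term is projective, where
    Schanuel's lemma applies. *)
Lemma Omega_summand n X Y Z (i : {linear X -> Y}) (p : {linear Y -> Z}) :
  short_exact i p -> uniserial X -> uniserial Z -> pd_le n Y ->
  exists N P N', [/\ is_Omega n X N, finite_length P /\ projective P,
    is_Omega n.+1 Z N' & summand N (P * N')%type].
Proof.
elim: n X Y Z i p => [|n IHn] X Y Z i p s uX uZ pdY.
  have [L [Q [l [g [cg sQ uQ uL]]]]] := uniserial_syzygy uZ.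
  have [Qp _ _] := cg; have [u [v uK]] := schanuel_retract s pdY sQ Qp.
  exists X, Y, L; split; first exact: iso_refl.
  - by split=> //; apply: finite_length_ext s uX.1 uZ.1.
  - by exists Z; split; [exact: iso_refl|exact: short_exact_is_syzygy sQ].
  - exact: retract_summand uK.
have [K [P [j [f [cf sP uP uK]]]]] := uniserial_syzygy uX.
have [L [Q [l [g [cg sQ uQ uL]]]]] := uniserial_syzygy uZ.
have [Pp _ _] := cf; have [Qp _ _] := cg.
have [Y' [a [b [s' sy]]]] := horseshoe s Pp sP Qp sQ.
have pdY' := pd_le_shift pdY sy (finite_length_ext s' uK.1 uL.1).
have [N [R [N' [oN hR oN' sN]]]] := IHn _ _ _ _ _ s' uK uL pdY'.
exists N, R, N'; split=> //.
  exact: is_Omega_cons (short_exact_is_syzygy cf sP) oN.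
exact: is_Omega_cons (short_exact_is_syzygy cg sQ) oN'.
Qed.

Lemma Sigma_summand n X Y Z (i : {linear X -> Y}) (p : {linear Y -> Z}) :
  short_exact i p -> uniserial X -> uniserial Z -> id_le n Y ->
  exists N P N', [/\ is_Sigma n Z N, finite_length P /\ injective_module P,
    is_Sigma n.+1 X N' & summand N (P * N')%type].
Proof.
elim: n X Y Z i p => [|n IHn] X Y Z i p s uX uZ pdY.
  have [Q [L [l [g [cg sQ uQ uL]]]]] := uniserial_cosyzygy uX.
  have [Qp _ _] := cg; have [u [v uK]] := coschanuel_retract s pdY sQ Qp.
  exists Z, Y, L; split; first exact: iso_refl.
  - by split=> //; apply: finite_length_ext s uX.1 uZ.1.
  - by exists X; split; [exact: iso_refl|exact: short_exact_is_cosyzygy sQ].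
  - exact: retract_summand uK.
have [P [K [j [f [cf sP uP uK]]]]] := uniserial_cosyzygy uX.
have [Q [L [l [g [cg sQ uQ uL]]]]] := uniserial_cosyzygy uZ.
have [Pp _ _] := cf; have [Qp _ _] := cg.
have [Y' [a [b [s' sy]]]] := cohorseshoe s Pp sP Qp sQ.
have pdY' := id_le_shift pdY sy (finite_length_ext s' uK.1 uL.1).
have [N [R [N' [oN hR oN' sN]]]] := IHn _ _ _ _ _ s' uK uL pdY'.
exists N, R, N'; split=> //.
  exact: is_Sigma_cons (short_exact_is_cosyzygy cg sQ) oN.
exact: is_Sigma_cons (short_exact_is_cosyzygy cf sP) oN'.
Qed.

Lemma least_le (D : set nat) n : D n -> enat_le (least D) (Some n).
Proof. by move=> Dn; case: (leastP D) => [[m [-> _ h]]|[_ /(_ n)]//];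
  apply: h. Qed.

Lemma summand_prodl M N : summand M (M * N)%type.
Proof. by exists N; apply: iso_refl. Qed.

Lemma del_le_max_pd_MS : enat_le (del_alg A) (max_pd_MS A).
Proof.
apply: enat_sup_le => _ [S [sS ->]]; have uS := uniserial_simple sS.
suff [X [hX le]] : exists X, is_MS S X /\ enat_le (del S) (pdim X).
  by apply: (enat_le_trans le); apply: enat_sup_ub; exists S, X.
case: (pdimP S) => [[n [e pdS _]]|[e _]].
  exists S; split; first by left; rewrite e; split=> //; apply: iso_refl.
  rewrite e; apply: least_le.
  have [N [oN uN]] := Omega_exists n uS.
  have [N' [oN' _]] := Omega_exists n.+1 uS.
  exists N, N, S, N'; split=> //; [|exact/finite_length_fg/uS.1|exact:
    summand_prodl].
  split; first exact: finite_length_fg uN.1.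
  exact: pd_le_syz pdS (is_Omega_syz oN) uN.1.
have [I [C [i [p [ci s uI uC]]]]] := uniserial_cosyzygy uS.
exists I; split; first by right; split=> //; exists i.
case: (pdimP I) => [[n [-> pdI _]]|[-> _]]; last by case: (del S).
apply: least_le.
have [N [P [N' [oN [fP Pp] oN' sN]]]] := Omega_summand s uS uC pdI.
exists N, P, C, N'; split=> //; last exact/finite_length_fg/uC.1.
by split=> //; apply: finite_length_fg.
Qed.

Lemma des_le_max_id_NS : enat_le (des_alg A) (max_id_NS A).
Proof.
apply: enat_sup_le => _ [S [sS ->]]; have uS := uniserial_simple sS.
suff [X [hX le]] : exists X, is_NS S X /\ enat_le (des S) (idim X).
  by apply: (enat_le_trans le); apply: enat_sup_ub; exists S, X.
case: (idimP S) => [[n [e pdS _]]|[e _]].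
  exists S; split; first by left; rewrite e; split=> //; apply: iso_refl.
  rewrite e; apply: least_le.
  have [N [oN uN]] := Sigma_exists n uS.
  have [N' [oN' _]] := Sigma_exists n.+1 uS.
  exists N, N, S, N'; split=> //; [|exact/finite_length_fg/uS.1|exact:
    summand_prodl].
  split; first exact: finite_length_fg uN.1.
  exact: id_le_cosyz pdS (is_Sigma_cosyz oN).
have [C [I [i [p [ci s uI uC]]]]] := uniserial_syzygy uS.
exists I; split; first by right; split=> //; exists p.
case: (idimP I) => [[n [-> pdI _]]|[-> _]]; last by case: (des S).
apply: least_le.
have [N [P [N' [oN [fP Pp] oN' sN]]]] := Sigma_summand s uC uS pdI.
exists N, P, C, N'; split=> //; last exact/finite_length_fg/uC.1.
by split=> //; apply: finite_length_fg.
Qed.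
End Dimension.

Section Simples.
Variable A : nzRingType.
Implicit Types M N K L X Y Z P I C S T U V E R B W : lmodType A.

(** * Finiteness of the number of simple modules *)

Lemma simple_quotients_finite M : finite_length M -> exists n (r : nat ->
  lmodType A),
  forall S (f : {linear M -> S}) x, simple_module S -> f x <> 0 ->
    exists2 i, (i < n)%N & iso S (r i).
Proof.
case=> m; elim: m M => [|m IHm] M.
  move/has_length0=> M0; exists 0%N, (fun=> M) => S f x _.
  by rewrite (M0 x) linear0.
case/has_lengthS=> K [S0 [i [p [s sS0 /IHm[n [r h]]]]]]; have [_ pS _] := s.
exists n.+1, (fun j => if (j < n)%N then r j else S0) => S f x sS fx.
case: (pselect (exists y, f (i y) <> 0)) => [[y fy]|fi].
  have [j jn e] := h S (f \o i : {linear K -> S}) y sS fy.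
  by exists j; [exact: leqW|rewrite jn].
have [|g gE] := factor_surj pS (f := f).
  by move=> y /(short_exact_lift s)[z <-]; apply: contrapT => fz; apply: fi;
    exists z.
exists n; rewrite ?ltnn //; apply/iso_sym.
by apply: (schur (f := g) (x := p x)) => //; rewrite gE.
Qed.

Lemma simples_finite : finite_length (A^o : lmodType A) ->
  exists n (r : nat -> lmodType A),
  forall S, simple_module S -> exists2 i, (i < n)%N & iso S (r i).
Proof.
move=> /simple_quotients_finite[n [r h]]; exists n, r => S sS.
have [y y0] := (nonzeroP S).1 sS.1; have [f fE] := cyclic_map y.
by apply: (h S f 1 sS); rewrite fE scale1r.
Qed.

(** The relation [E] has no two distinct predecessors of a vertex, and every
    vertex in [Inf] has a successor in [Inf].  Choosing successors is then an
    injective self-map [t] of the finite set [D] of isomorphism classes in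
    [Inf], hence bijective: each class in [Inf] has a predecessor in [Inf], of
    which it is the only successor in [Inf]. *)
Lemma simple_graph (Inf : lmodType A -> Prop) (E : lmodType A -> lmodType A ->
  Prop) :
  finite_length (A^o : lmodType A) ->
  (forall R, simple_module R -> Inf R ->
     exists T, [/\ simple_module T, Inf T & E R T]) ->
  (forall R T T', iso T T' -> E R T -> E R T') ->
  (forall R R' T, simple_module R -> simple_module R' -> simple_module T ->
     E R T -> E R' T -> iso R R') ->
  forall S, simple_module S -> Inf S ->
  exists R, [/\ simple_module R, E R S &
    forall T, simple_module T -> Inf T -> E R T -> iso T S].
Proof.
move=> /simples_finite[n [r hr]] out Eiso Euniq.
(* The representatives may repeat; [can] selects the least index. *)
pose can S i := iso S (r i) /\ forall j, (j < i)%N -> ~ iso S (r j).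
have canE S : simple_module S -> exists i : 'I_n, can S i.
  move=> /hr[i ilt ei]; have ex : exists i, `[< iso S (r i) >].
    by exists i; apply/asboolP.
  case: (ex_minnP ex) => j /asboolP ej jmin.
  have ji : (j <= i)%N by apply/jmin/asboolP.
  exists (Ordinal (leq_ltn_trans ji ilt)); split=> //= k kj ek.
  by move: kj; rewrite ltnNge jmin //; apply/asboolP.
have can_uniq S S' (i j : 'I_n) : iso S S' -> can S i -> can S' j -> i = j.
  move=> e [ei mi] [ej mj]; apply/val_inj/eqP; rewrite eqn_leq /=.
  apply/andP; split; rewrite leqNgt; apply/negP => h.
    by apply: (mi j h); apply: iso_trans e ej.
  by apply: (mj i h); apply: iso_trans (iso_sym e) ei.
have can_iso S S' (i : 'I_n) : can S i -> can S' i -> iso S S'.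
  by move=> [e _] [e' _]; apply: iso_trans e (iso_sym e').
pose D := [set i : 'I_n | `[< exists S, [/\ simple_module S,
  Inf S & can S i] >]]%SET.
pose step (i j : 'I_n) := exists R T,
  [/\ [/\ simple_module R, Inf R & can R i],
      [/\ simple_module T, Inf T & can T j] & E R T].
have stepE i : exists j, i \in D -> step i j.
  case: (pselect (i \in D)) => [|]; last by exists i.
  rewrite inE => /asboolP[R [sR iR cR]]; have [T [sT iT eT]] := out R sR iR.
  by have [j cT] := canE T sT; exists j => _; exists R, T.
have [t tE] := choice stepE.
have tD : {in D &, injective t}.
  move=> i j /tE[R [T [[sR iR cR] [sT iT cT] eR]]].
  move=> /tE[R' [T' [[sR' iR' cR'] [sT' iT' cT'] eR']]] e.
  rewrite -e in cT'; apply: can_uniq cR cR'.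
  apply: (Euniq R R' T) => //; apply: Eiso eR'.
  exact: can_iso cT' cT.
have tDD : (t @: D)%SET = D.
  apply/eqP; rewrite eqEcard card_in_imset // leqnn andbT.
  apply/fintype.subsetP => _ /imsetP[i /tE[R [T [_ hT _]]] ->].
  by rewrite inE; apply/asboolP; exists T.
move=> S sS iS; have [j cS] := canE S sS.
have : j \in D by rewrite inE; apply/asboolP; exists S.
rewrite -tDD => /imsetP[i /[dup] iD /tE[R [T [[sR iR cR] [sT iT cT] eR]]] jE].
rewrite -jE in cT.
exists R; split=> // [|T1 sT1 iT1 eT1].
  by apply: Eiso eR; apply: can_iso cT cS.
have [j1 cT1] := canE T1 sT1.
have : j1 \in D by rewrite inE; apply/asboolP; exists T1.
rewrite -tDD => /imsetP[i1 /tE[R2 [T2 [[sR2 iR2 cR2] [sT2 iT2 cT2] eR2]]] j1E].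
rewrite -j1E in cT2.
have i1E : i1 = i.
  apply: can_uniq cR2 cR; apply: (Euniq R2 R T1) => //.
  by apply: Eiso eR2; apply: can_iso cT2 cT1.
by apply: can_iso cT1 _; rewrite j1E i1E -jE.
Qed.

Lemma top_unique B U U' (v : {linear B -> U}) (v' : {linear B -> U'}) :
  chained B -> surjective v -> surjective v' -> simple_module U ->
  simple_module U' -> iso U U'.
Proof.
have aux W W' (w : {linear B -> W}) (w' : {linear B -> W'}) :
    surjective w -> surjective w' -> simple_module W -> simple_module W' ->
    (forall x, w x = 0 -> w' x = 0) -> iso W W'.
  move=> wS wS' sW sW' h; have [g gE] := factor_surj wS h.
  have [y y0] := (nonzeroP W').1 sW'.1; have [x xE] := wS' y.
  by apply: (schur (f := g) (x := w x)) => //; rewrite gE xE.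
move=> cB vS vS' sU sU'; case: (chained_ker v v' cB) => h; first exact: aux h.
exact/iso_sym/(aux _ _ _ _ _ _ _ _ h).
Qed.

Lemma socle_unique B U U' (v : {linear U -> B}) (v' : {linear U' -> B}) :
  chained B -> injective v -> injective v' -> simple_module U ->
  simple_module U' -> iso U U'.
Proof.
have aux W W' (w : {linear W -> B}) (w' : {linear W' -> B}) :
    injective w -> injective w' -> simple_module W -> simple_module W' ->
    (forall x, exists y, w' y = w x) -> iso W W'.
  move=> wS wS' sW sW' h; have [g gE] := factor_inj wS' h.
  have [y y0] := (nonzeroP W).1 sW.1.
  apply: (schur (f := g) (x := y)) => // gy; apply: y0.
  by apply: (inj0P wS); rewrite -gE gy linear0.
move=> cB vS vS' sU sU'; case: (chained_im v v' cB) => h; first exact: aux h.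
exact/iso_sym/(aux _ _ _ _ _ _ _ _ h).
Qed.

Lemma subquot_quo T L Y (e : {linear L -> Y}) : surjective e -> subquot T Y ->
  subquot T L.
Proof.
move=> eS [Z [a [b [aI bS]]]]; have [N [k s]] := short_exact_ker eS.
have [E [a' [b' [k' [[_ b'S _] h _ _ inj]]]]] := pullback a s.
exists E, a', (b \o b' : {linear E -> T}); split=> [|t].
  apply: inj0 => x ax; apply: inj => //; apply: (inj0P aI).
  by rewrite -h ax linear0.
by have [z <-] := bS t; have [x <-] := b'S z; exists x.
Qed.

(** With [T = Z / N], the quotient of [L] by [N] contains [T]. *)
Lemma subquot_cosubquot T L : subquot T L -> exists Y (a : {linear L ->
  Y}) (b : {linear T -> Y}),
  surjective a /\ injective b.
Proof.
move=> [Z [a [b [aI bS]]]]; have [N [k s]] := short_exact_ker bS.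
have [kI _ _] := s.
have [Y [c s']] := short_exact_coker (f := a \o k : {linear N ->
  L}) (inj_comp aI kI).
have [_ cS _] := s'.
have [|d dE] := factor_surj bS (f := c \o a : {linear Z -> Y}).
  by move=> x /(short_exact_lift s)[y <-]; apply: (short_exact0 _ s').
exists Y, c, d; split=> //; apply: inj0 => t; have [z <-] := bS t.
rewrite dE /= => /(short_exact_lift s')[y /= /aI <-]; exact: short_exact0 s.
Qed.
End Simples.

Section Finiteness.
Variable A : nzRingType.
Implicit Types M N K L X Y Z P Q I J C S T U V E R B : lmodType A.
Hypothesis finA : finite_length (A^o : lmodType A).
Hypothesis decomposes : forall M, finite_length M -> uniserial_sum M.

(** * Composition factors of second syzygies and cosyzygies *)

(** A simple [U] determines the simple module that can sit directly above it in
    a uniserial module: modulo the kernels of [u] and [u'], [P] and [P'] embed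
    in the uniserial injective envelope of [U], where the layer above the socle
    [U] is unique. *)
Lemma predecessor_unique U P P' K K' R R' (i : {linear K ->
  P}) (f : {linear P -> R})
    (i' : {linear K' -> P'}) (f' : {linear P' -> R'})
    (u : {linear K -> U}) (u' : {linear K' -> U}) :
  simple_module U -> simple_module R -> simple_module R' ->
  chained P -> chained P' -> short_exact i f -> short_exact i' f' ->
  surjective u -> surjective u' -> iso R R'.
Proof.
move=> sU; have [I [e [[Ii eI _] [_ cI]]]] := simple_envelope finA decomposes
  sU.
(* [P0 -> I] extending [K0 -> U -> I] has kernel inside [K0]. *)
have ext P0 K0 R0 (i0 : {linear K0 -> P0}) (f0 : {linear P0 -> R0})
    (u0 : {linear K0 -> U}) : chained P0 -> short_exact i0 f0 ->
      surjective u0 ->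
    exists ph : {linear P0 -> I}, (forall x, ph (i0 x) = e (u0 x)) /\
      forall x, ph x = 0 -> f0 x = 0.
  move=> cP s uS; have [i0I _ _] := s.
  have [ph phE] := Ii _ _ i0 (e \o u0 : {linear K0 -> I}) i0I.
  exists ph; split=> // x phx; case: (chained_imker i0 ph cP) => h; last first.
    by have [y <-] := h x phx; apply: short_exact0 s.
  have [y y0] := (nonzeroP U).1 sU.1; have [z zE] := uS y.
  by case: y0; rewrite -zE; apply: (inj0P eI); rewrite -[RHS](h z) phE.
have aux P0 P1 K0 K1 R0 R1 (i0 : {linear K0 -> P0}) (f0 : {linear P0 -> R0})
    (i1 : {linear K1 -> P1}) (f1 : {linear P1 -> R1})
    (u0 : {linear K0 -> U}) (u1 : {linear K1 -> U})
    (ph0 : {linear P0 -> I}) (ph1 : {linear P1 -> I}) :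
    simple_module R0 -> simple_module R1 -> short_exact i0 f0 ->
      short_exact i1 f1 ->
    surjective u0 -> surjective u1 ->
    (forall x, ph0 (i0 x) = e (u0 x)) -> (forall x, ph0 x = 0 -> f0 x = 0) ->
    (forall x, ph1 (i1 x) = e (u1 x)) -> (forall x, ph1 x = 0 -> f1 x = 0) ->
    (forall x, exists y, ph1 y = ph0 x) -> iso R0 R1.
  move=> sR0 sR1 s0 s1 u0S u1S h0 k0 h1 k1 im.
  have [f0S f1S] : surjective f0 /\ surjective f1 by case: s0; case: s1.
  have [J [q [j [qS jI jE]]]] := img_exists ph1.
  have [|sg sgE] := factor_surj qS (f := f1).
    by move=> x qx; apply: k1; rewrite -jE qx linear0.
  have [|ta taE] := factor_inj jI (f := ph0).
    by move=> x; have [y <-] := im x; exists (q y).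
  have key x y : ph1 y = ph0 x -> sg (ta x) = f1 y.
    move=> xy; have -> : ta x = q y by apply: jI; rewrite taE jE.
    by rewrite sgE.
  have [|g gE] := factor_surj f0S (f := sg \o ta : {linear P0 -> R1}).
    move=> x /(short_exact_lift s0)[k <-] /=; have [k' k'E] := u1S (u0 k).
    by rewrite (key _ (i1 k')) ?(short_exact0 _ s1) // h1 h0 k'E.
  have [y y0] := (nonzeroP R0).1 sR0.1; have [x xE] := f0S y.
  apply: (schur (f := g) (x := y)) => // gy; apply: y0.
  have [z zE] := im x; move: gy; rewrite -xE gE /= (key _ _ zE).
  move=> /(short_exact_lift s1)[k' k'E]; have [k kE] := u0S (u1 k').
  have /k0 : ph0 (x - i0 k) = 0 by rewrite linearB -zE -k'E h1 h0 kE subrr.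
  by rewrite linearB (short_exact0 _ s0) subr0.
move=> sR sR' cP cP' s s' uS uS'.
have [ph [h k]] := ext _ _ _ _ _ _ cP s uS.
have [ph' [h' k']] := ext _ _ _ _ _ _ cP' s' uS'.
case: (chained_im ph ph' cI) => im.
  exact: (aux _ _ _ _ _ _ _ _ _ _ _ _ _ _ sR sR' s s' uS uS' h k h' k' im).
apply: iso_sym.
exact: (aux _ _ _ _ _ _ _ _ _ _ _ _ _ _ sR' sR s' s uS' uS h' k' h k im).
Qed.

(** Dually, a simple [U] determines the simple module directly below it: it is
    the second layer of the projective cover of [U]. *)
Lemma successor_unique U I I' K K' R R' (i : {linear R -> I}) (p : {linear I ->
  K})
    (i' : {linear R' -> I'}) (p' : {linear I' -> K'})
    (u : {linear U -> K}) (u' : {linear U -> K'}) :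
  simple_module U -> simple_module R -> simple_module R' ->
  chained I -> chained I' -> short_exact i p -> short_exact i' p' ->
  injective u -> injective u' -> iso R R'.
Proof.
move=> sU; have [F [e [[Fp eS _] [_ cF]]]] := uniserial_cover finA decomposes
  (uniserial_simple sU).
have ext I0 K0 R0 (i0 : {linear R0 -> I0}) (p0 : {linear I0 -> K0})
    (u0 : {linear U -> K0}) : chained I0 -> short_exact i0 p0 -> injective u0 ->
    exists ph : {linear F -> I0}, (forall x, p0 (ph x) = u0 (e x)) /\
      forall y, exists x, ph x = i0 y.
  move=> cI s uI; have [_ p0S _] := s.
  have [ph phE] := Fp _ _ p0 (u0 \o e : {linear F -> K0}) p0S.
  exists ph; split=> // y; case: (chained_imker ph p0 cI) => h; last first.
    by apply: h; apply: short_exact0 s.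
  have [z z0] := (nonzeroP U).1 sU.1; have [x xE] := eS z.
  by case: z0; rewrite -xE; apply: (inj0P uI); rewrite -[RHS](h x) phE.
have aux I0 I1 K0 K1 R0 R1 (i0 : {linear R0 -> I0}) (p0 : {linear I0 -> K0})
    (i1 : {linear R1 -> I1}) (p1 : {linear I1 -> K1})
    (u0 : {linear U -> K0}) (u1 : {linear U -> K1})
    (ph0 : {linear F -> I0}) (ph1 : {linear F -> I1}) :
    simple_module R0 -> simple_module R1 -> short_exact i0 p0 ->
      short_exact i1 p1 ->
    injective u0 -> injective u1 ->
    (forall x, p0 (ph0 x) = u0 (e x)) -> (forall y, exists x, ph0 x = i0 y) ->
    (forall x, p1 (ph1 x) = u1 (e x)) -> (forall y, exists x, ph1 x = i1 y) ->
    (forall x, ph0 x = 0 -> ph1 x = 0) -> iso R0 R1.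
  move=> sR0 sR1 s0 s1 u0I u1I h0 k0 h1 k1 ker.
  have [i0I i1I] : injective i0 /\ injective i1 by case: s0; case: s1.
  have [J [q [j [qS jI jE]]]] := img_exists ph0.
  have [|sg sgE] := factor_surj qS (f := ph1).
    by move=> x qx; apply: ker; rewrite -jE qx linear0.
  have [|ta taE] := factor_inj jI (f := i0).
    by move=> y; have [x <-] := k0 y; exists (q x).
  have key x y : ph0 x = i0 y -> sg (ta y) = ph1 x.
    move=> xy; have -> : ta y = q x by apply: jI; rewrite taE jE.
    by rewrite sgE.
  have [|g gE] := factor_inj i1I (f := sg \o ta : {linear R0 -> I1}).
    move=> y; have [x xE] := k0 y; rewrite /= (key _ _ xE).
    apply: (short_exact_lift s1); rewrite h1; suff ->
      : e x = 0 by rewrite linear0.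
    by apply: (inj0P u0I); rewrite -h0 xE (short_exact0 _ s0).
  have [y' y'0] := (nonzeroP R1).1 sR1.1; have [x xE] := k1 y'.
  have ex : e x = 0 by apply: (inj0P u1I); rewrite -h1 xE (short_exact0 _ s1).
  have [y yE] : exists y, i0 y = ph0 x.
    by apply: (short_exact_lift s0); rewrite h0 ex linear0.
  apply: (schur (f := g) (x := y)) => // gy; apply: y'0; apply: (inj0P i1I).
  by rewrite -xE -(key x y) // -[LHS]gE gy linear0.
move=> sR sR' cP cP' s s' uS uS'.
have [ph [h k]] := ext _ _ _ _ _ _ cP s uS.
have [ph' [h' k']] := ext _ _ _ _ _ _ cP' s' uS'.
case: (chained_ker ph ph' cF) => im.
  exact: (aux _ _ _ _ _ _ _ _ _ _ _ _ _ _ sR sR' s s' uS uS' h k h' k' im).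
apply: iso_sym.
exact: (aux _ _ _ _ _ _ _ _ _ _ _ _ _ _ sR' sR s' s uS' uS h' k' h k im).
Qed.

(** Here [K = Omega R] and [L = Omega^2 R], and [B] is [Q / Y'] where [Y'] is
    the kernel of [b].  If [B] were not injective, its envelope would contain a
    uniserial extension [E] of a simple [R'] by [B].  As [B] and [K] share their
    top, [R'] is isomorphic to [R], so [P] maps onto [E] and hence [K] onto [B].
    Together with the non-injective epimorphism [r] from [B] to [K], this
    contradicts finite length. *)
Lemma injective_quotient R P K Q L T Y (i : {linear K -> P}) (f : {linear P ->
  R})
    (l : {linear L -> Q}) (g : {linear Q -> K})
    (a : {linear Y -> L}) (b : {linear Y -> T}) :
  simple_module R -> projective P -> uniserial P -> short_exact i f ->
  projective_cover g -> uniserial Q -> short_exact l g ->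
  simple_module T -> injective a -> surjective b ->
  exists B (q : {linear Q -> B}) (t : {linear T -> B}) (r : {linear B -> K}),
  [/\ [/\ surjective q, (forall x, q x = 0 <-> exists y, b y = 0 /\ l (a y) = x)
        & forall x, r (q x) = g x],
      [/\ injective t, forall y, t (b y) = q (l (a y)) & forall x, r (t x) = 0],
      injective_module B, uniserial B & ~ zero_module K].
Proof.
move=> sR Pp uP s cg uQ sl sT aI bS.
have [lI gS _] := sl; have [iI fS _] := s.
have Ws : psub (fun x => exists y, b y = 0 /\ l (a y) = x).
  split=> [|c _ _ [y [yb <-]] [z [zb <-]]]; first by exists 0; rewrite !linear0.
  by exists (c *: y + z); rewrite !linearP yb zb scaler0 addr0.
have [B [q [qS qE]]] := quotient_exists Ws.
have [|t tE] := factor_surj bS (f := q \o l \o a : {linear Y -> B}).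
  by move=> y yb; apply/qE; exists y.
have tI : injective t.
  apply: inj0 => x; have [y <-] := bS x; rewrite tE /= => /qE[z [zb]].
  by move=> /lI/aI <-.
have [|r rE] := factor_surj qS (f := g).
  by move=> x /qE[y [_ <-]]; apply: short_exact0 sl.
have rS : surjective r by move=> x; have [y <-] := gS x; exists (q y).
have rt x : r (t x) = 0.
  by have [y <-] := bS x; rewrite tE /= rE (short_exact0 _ sl).
have [x0 x0n] := (nonzeroP T).1 sT.1.
have K0 : ~ zero_module K.
  move=> K0; apply: x0n; have [y <-] := bS x0.
  suff -> : y = 0 by rewrite linear0.
  apply: (inj0P aI); apply: (inj0P lI); have [_ _ sup] := cg.
  apply/(in_pred_of (fun x : Q => x = 0)); apply: sup;
    first exact/pred_of_closed/psub_zero.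
  by move=> x; exists 0; [apply/in_pred_of|rewrite (K0 (g _))].
have uB := uniserial_quo uQ qS.
exists B, q, t, r; split=> //.
have [J [e [[Ji eI _] uJ]]] := uniserial_envelope finA decomposes uB.
suff eS : surjective e by apply: inj_iso Ji; apply: iso_intro eI eS.
(* [R'] is the layer of the envelope [J] directly above [B], and [E] is the
   preimage of [R'] in [J]. *)
have [D [d sd]] := short_exact_coker eI; have [_ dS _] := sd.
apply: contrapT => neS.
have D0 : ~ zero_module D by move=> D0; apply: neS => x;
  apply: (short_exact_lift sd).
have [R' [h [sR' hI]]] := finite_length_socle (finite_length_quo uJ.1 dS) D0.
have [E [a' [b' [k [se ab ak _ inj]]]]] := pullback h sd.
have a'I : injective a'.
  by apply: inj0 => x ax; apply: inj => //; apply: (inj0P hI);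
    rewrite -ab ax linear0.
have uE := uniserial_sub uJ a'I; have [kI b'S _] := se.
have fK : finite_length K := finite_length_quo uQ.1 gS.
have [U [u [sU uS]]] := finite_length_top fK K0.
have [ph [ps [phK psK]]] : exists (ph : {linear R -> R'}) (ps : {linear R' ->
  R}),
    (forall x, ps (ph x) = x) /\ (forall x, ph (ps x) = x).
  apply: isoE; apply: (predecessor_unique (u := u) (u' := u \o r : {linear B ->
    U})
    sU sR sR' uP.2 uE.2 s se uS).
  by move=> x; have [y <-] := uS x; have [z <-] := rS y; exists z.
have [m mE] := Pp _ _ b' (ph \o f : {linear P -> R'}) b'S.
have [z0 z0n] := (nonzeroP R).1 sR.1.
have mS : surjective m.
  case: (chained_imker m b' uE.2) => hm.
    have [x xE] := fS z0; case: z0n; rewrite -xE -[f x]phK.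
    by rewrite -[ph _]mE hm linear0.
  move=> y; have [x xE] := fS (ps (b' y)).
  have [w wE] := hm (y - m x) ltac:(by rewrite linearB mE /= xE psK subrr).
  by exists (w + x); rewrite linearD wE subrK.
have [|w wE] := factor_inj kI (f := m \o i : {linear K -> E}).
  by move=> x; apply: (short_exact_lift se); rewrite mE /= (short_exact0 _ s)
    linear0.
have wS : surjective w.
  move=> z; have [x xE] := mS (k z).
  have [y yE] : exists y, i y = x.
    apply: (short_exact_lift s); rewrite -[f x]phK -[ph _]mE xE (short_exact0 _
      se).
    exact: linear0.
  by exists y; apply: kI; rewrite wE /= yE.
(* [K -> B -> K] is onto and [K] has finite length, so [w] and [r] are bijective,
   whereas [r] vanishes on the image of [T]. *)
have rwI : injective (r \o w : {linear K -> K}).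
  apply: surj_endo_inj => // x; have [y <-] := rS x; have [z <-] := wS y.
  by exists z.
apply: x0n; apply: (inj0P tI); have [y yE] := wS (t x0).
have : (r \o w) y = 0 by rewrite /= yE rt.
by rewrite -yE => /(inj0P rwI) ->; rewrite linear0.
Qed.

(** The dual statement: [K = Sigma R] and [L = Sigma^2 R], and [B] is the
    submodule of [J] formed by the elements that are mapped into [T]. *)
Lemma projective_submodule R I K J L T Y (i : {linear R ->
  I}) (p : {linear I -> K})
    (g : {linear K -> J}) (l : {linear J -> L})
    (a : {linear L -> Y}) (b : {linear T -> Y}) :
  simple_module R -> injective_module I -> uniserial I -> short_exact i p ->
  injective_envelope g -> uniserial J -> short_exact g l ->
  simple_module T -> surjective a -> injective b ->
  exists B (c : {linear B -> J}) (t : {linear B -> T}) (r : {linear K -> B}),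
  [/\ [/\ injective c, (forall x, (exists y, b y = a (l x)) <-> exists z,
    c z = x)
        & forall x, c (r x) = g x],
      [/\ surjective t, forall z, b (t z) = a (l (c z)) & forall x,
        t (r x) = 0],
      projective B, uniserial B & ~ zero_module K].
Proof.
move=> sR Ii uI s cg uJ sl sT aS bI.
have [gI lS _] := sl; have [iI pS _] := s.
have Ws : psub (fun x => exists y, b y = a (l x)).
  exact: (psub_preim (a \o l : {linear J -> Y}) (psub_im b)).
have [B [c [cI cE]]] := submodule_exists Ws.
have [|t tE] := factor_inj bI (f := a \o l \o c : {linear B -> Y}).
  by move=> z; apply/cE; exists z.
have tS : surjective t.
  move=> y; have [w wE] := aS (b y); have [x xE] := lS w.
  have /cE[z zE] : exists y, b y = a (l x) by exists y; rewrite xE wE.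
  by exists z; apply: bI; rewrite tE /= zE xE wE.
have [|r rE] := factor_inj cI (f := g).
  by move=> x; apply/cE; exists 0; rewrite (short_exact0 _ sl) !linear0.
have rI : injective r.
  by apply: inj0 => x rx; apply: (inj0P gI); rewrite -rE rx linear0.
have tr x : t (r x) = 0.
  by apply: (inj0P bI); rewrite tE /= rE (short_exact0 _ sl) linear0.
have [x0 x0n] := (nonzeroP T).1 sT.1.
have K0 : ~ zero_module K.
  move=> K0; apply: x0n; apply: (inj0P bI).
  have [w wE] := aS (b x0); have [x xE] := lS w.
  rewrite -wE -xE; suff -> : x = 0 by rewrite !linear0.
  apply: contrapT => xn; have [_ _ ess] := cg.
  have [|y _] := ess (pred_of (fun _ : J => True)) (pred_of_closed (psub_all
    J)).
    by exists x => //; apply/in_pred_of.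
  by case; rewrite (K0 y) linear0.
have uB := uniserial_sub uJ cI.
exists B, c, t, r; split=> //.
have [F [e [[Fp eS _] uF]]] := uniserial_cover finA decomposes uB.
suff eI : injective e by apply: proj_iso Fp; apply/iso_sym/(iso_intro eI eS).
(* [R'] is the top of the kernel [D] of the cover [F -> B], and [E] is the
   quotient of [F] that extends [B] by [R']. *)
have [D [d sd]] := short_exact_ker eS; have [dI _ _] := sd.
apply: contrapT => neI.
have D0 : ~ zero_module D.
  by move=> D0; apply: neI; apply: inj0 => x /(short_exact_lift sd)[y <-];
    rewrite (D0 y) linear0.
have [R' [h [sR' hS]]] := finite_length_top (finite_length_sub uF.1 dI) D0.
have [E [a' [b' [k [se ab ak gen _]]]]] := pushout h sd.
have a'S : surjective a'.
  move=> x; have [y [w ->]] := gen x; have [v <-] := hS w.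
  by exists (y + d v); rewrite linearD ab.
have uE := uniserial_quo uF a'S; have [b'I kS _] := se.
have fK : finite_length K := finite_length_quo uI.1 pS.
have [U [u [sU uUI]]] := finite_length_socle fK K0.
have [ph [ps [phK psK]]] : exists (ph : {linear R -> R'}) (ps : {linear R' ->
  R}),
    (forall x, ps (ph x) = x) /\ (forall x, ph (ps x) = x).
  apply: isoE; apply: (successor_unique (u := u) (u' := r \o u : {linear U ->
    B})
    sU sR sR' uI.2 uE.2 s se uUI).
  exact: inj_comp.
have [m mE] := Ii _ _ b' (i \o ps : {linear R' -> I}) b'I.
have [z0 z0n] := (nonzeroP R').1 sR'.1.
have mI : injective m.
  case: (chained_imker b' m uE.2) => hm.
    case: z0n; rewrite -[z0]psK; suff -> : ps z0 = 0 by rewrite linear0.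
    by apply: (inj0P iI); rewrite -[RHS](hm z0) mE.
  apply: inj0 => x mx; have [y yE] := hm x mx.
  move: mx; rewrite -yE mE /= => /(inj0P iI) y0.
  by rewrite -[y]psK y0 !linear0.
have [|w wE] := factor_surj kS (f := p \o m : {linear E -> K}).
  by move=> x /(short_exact_lift se)[y <-]; rewrite /= mE /= (short_exact0 _ s).
have wI : injective w.
  apply: inj0 => z; have [x <-] := kS z; rewrite wE /= => /(short_exact_lift
    s)[y yE].
  have : m (b' (ph y)) = m x by rewrite mE /= phK.
  by move=> /mI <-; rewrite (short_exact0 _ se).
have wrS : surjective (w \o r : {linear K -> K}).
  by apply: inj_endo_surj => //; apply: inj_comp.
apply: x0n; have [y <-] := tS x0; have [x /= /wI <-] := wrS (w y).
exact: tr.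
Qed.

(** [T] is a composition factor of [Omega^2 R], for [R] and [T] simple. *)
Definition second_syzygy_factor R T : Prop := exists P K Q L (i : {linear K ->
  P})
    (f : {linear P -> R}) (l : {linear L -> Q}) (g : {linear Q -> K}),
  [/\ projective P /\ uniserial P, short_exact i f,
    projective_cover g /\ uniserial Q, short_exact l g
    & subquot T L].

(** [T] is a composition factor of [Sigma^2 R], for [R] and [T] simple. *)
Definition second_cosyzygy_factor R T : Prop := exists I K J L (i : {linear R
  -> I})
    (p : {linear I -> K}) (g : {linear K -> J}) (l : {linear J -> L}),
  [/\ injective_module I /\ uniserial I, short_exact i p,
    injective_envelope g /\ uniserial J, short_exact g l
    & subquot T L].

Lemma second_syzygy_factor_iso R T T' : iso T T' -> second_syzygy_factor R T ->
  second_syzygy_factor R T'.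
Proof.
move=> e [P [K [Q [L [i [f [l [g [h1 h2 h3 h4 /(subquot_isol e) h5]]]]]]]]].
by exists P, K, Q, L, i, f, l, g.
Qed.

Lemma second_cosyzygy_factor_iso R T T' : iso T T' ->
  second_cosyzygy_factor R T -> second_cosyzygy_factor R T'.
Proof.
move=> e [P [K [Q [L [i [f [l [g [h1 h2 h3 h4 /(subquot_isol e) h5]]]]]]]]].
by exists P, K, Q, L, i, f, l, g.
Qed.

(** [Q] and [Q'] have the injective envelope of [T] as a common quotient, so
    [K] and [K'] have isomorphic tops, which determine [R] and [R']. *)
Lemma second_syzygy_factor_unique R R' T : simple_module R ->
  simple_module R' ->
  simple_module T -> second_syzygy_factor R T -> second_syzygy_factor R' T ->
    iso R R'.
Proof.
move=> sR sR' sT.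
move=> [P [K [Q [L [i [f [l [g [[Pp uP] s [cg uQ] sl [Y [a [b [aI
  bS]]]]]]]]]]]]].
move=> [P' [K' [Q' [L' [i' [f' [l' [g' [[Pp' uP'] s' [cg' uQ'] sl'
  [Y' [a' [b' [aI' bS']]]]]]]]]]]]].
have [B [q [t [r [[qS qE rE] [tI tE rt] Bi uB K0]]]]] :=
  injective_quotient sR Pp uP s cg uQ sl sT aI bS.
have [B' [q' [t' [r' [[qS' qE' rE'] [tI' tE' rt'] Bi' uB' K0']]]]] :=
  injective_quotient sR' Pp' uP' s' cg' uQ' sl' sT aI' bS'.
have env := chained_envelope Bi tI uB.2 sT.1.
have env' := chained_envelope Bi' tI' uB'.2 sT.1.
have [be [be' [beK beK']]] := isoE (envelope_unique env env').
have [_ gS _] := sl; have [_ gS' _] := sl'.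
have [U [u [sU uS]]] := finite_length_top (finite_length_quo uQ.1 gS) K0.
have [U' [u' [sU' uS']]] := finite_length_top (finite_length_quo uQ'.1 gS') K0'.
have [w [w' [wK wK']]] : exists (w : {linear U' -> U}) (w' : {linear U -> U'}),
    (forall x, w' (w x) = x) /\ (forall x, w (w' x) = x).
  apply: isoE; apply: (top_unique (v := u' \o r' \o be : {linear B -> U'})
    (v' := u \o r : {linear B -> U}) uB.2) => // x.
    have [y <-] := uS' x; have [z <-] := gS' y.
    by exists (be' (q' z)); rewrite /= beK' rE'.
  by have [y <-] := uS x; have [z <-] := gS y; exists (q z); rewrite /= rE.
apply: (predecessor_unique (u := u) (u' := w \o u' : {linear K' -> U})
  sU sR sR' uP.2 uP'.2 s s' uS) => x.
by have [y yE] := uS' (w' x); exists y; rewrite /= yE.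
Qed.

Lemma second_cosyzygy_factor_unique R R' T : simple_module R ->
  simple_module R' ->
  simple_module T -> second_cosyzygy_factor R T ->
    second_cosyzygy_factor R' T -> iso R R'.
Proof.
move=> sR sR' sT.
move=> [P [K [Q [L [i [f [g [l [[Pp uP] s [cg uQ] sl
  /subquot_cosubquot[Y [a [b [aI bS]]]]]]]]]]]]].
move=> [P' [K' [Q' [L' [i' [f' [g' [l' [[Pp' uP'] s' [cg' uQ'] sl'
  /subquot_cosubquot[Y' [a' [b' [aI' bS']]]]]]]]]]]]].
have [B [c [t [r [[cI cE rE] [tS tE tr] Bp uB K0]]]]] :=
  projective_submodule sR Pp uP s cg uQ sl sT aI bS.
have [B' [c' [t' [r' [[cI' cE' rE'] [tS' tE' tr'] Bp' uB' K0']]]]] :=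
  projective_submodule sR' Pp' uP' s' cg' uQ' sl' sT aI' bS'.
have env := chained_cover Bp tS uB.2 sT.1.
have env' := chained_cover Bp' tS' uB'.2 sT.1.
have [be [be' [beK beK']]] := isoE (cover_unique env env').
have [gI _ _] := sl; have [gI' _ _] := sl'.
have rI : injective r.
  by apply: inj0 => x rx; apply: (inj0P gI); rewrite -rE rx linear0.
have rI' : injective r'.
  by apply: inj0 => x rx; apply: (inj0P gI'); rewrite -rE' rx linear0.
have [U [u [sU uI]]] := finite_length_socle (finite_length_sub uQ.1 gI) K0.
have [U' [u' [sU' uI']]] := finite_length_socle (finite_length_sub uQ'.1 gI')
  K0'.
have [w [w' [wK wK']]] : exists (w : {linear U' -> U}) (w' : {linear U -> U'}),
    (forall x, w' (w x) = x) /\ (forall x, w (w' x) = x).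
  apply: isoE; apply: (socle_unique (v := be' \o r' \o u' : {linear U' -> B})
    (v' := r \o u : {linear U -> B}) uB.2) => //.
    by apply: inj_comp uI'; apply: inj_comp rI'; apply: can_inj beK'.
  exact: inj_comp.
apply: (successor_unique (u := u) (u' := u' \o w' : {linear U -> K'})
  sU sR sR' uP.2 uP'.2 s s' uI).
by apply: inj_comp uI' _; apply: can_inj wK'.
Qed.

Lemma pd_le_subquot L : finite_length L ->
  (forall T, simple_module T -> subquot T L -> exists n, pd_le n T) ->
  exists n, pd_le n L.
Proof.
apply: finite_length_ind_subquot => [M M0|X Y Z i p s fY [m hX] [n hZ]].
  by exists 0%N; apply: zero_proj.
exists (maxn m n); apply: (pd_le_ext finA decomposes s fY).
  exact: pd_le_mono (leq_maxl _ _) hX.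
exact: pd_le_mono (leq_maxr _ _) hZ.
Qed.

Lemma id_le_subquot L : finite_length L ->
  (forall T, simple_module T -> subquot T L -> exists n, id_le n T) ->
  exists n, id_le n L.
Proof.
apply: finite_length_ind_subquot => [M M0|X Y Z i p s fY [m hX] [n hZ]].
  by exists 0%N; apply: zero_inj.
exists (maxn m n); apply: (id_le_ext finA decomposes s fY).
  exact: id_le_mono (leq_maxl _ _) hX.
exact: id_le_mono (leq_maxr _ _) hZ.
Qed.

(** If all composition factors of [Omega^2 R] had finite projective dimension,
    so would [R]. *)
Lemma infinite_pd_factor R : simple_module R -> (forall n, ~ pd_le n R) ->
  exists T, [/\ simple_module T, forall n, ~ pd_le n T & second_syzygy_factor R
    T].
Proof.
move=> sR iR; apply: contrapT => nT.
have [K [P [i [f [cf s uP uK]]]]] := uniserial_syzygy finA decomposes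
  (uniserial_simple sR).
have [L [Q [l [g [cg sl uQ uL]]]]] := uniserial_syzygy finA decomposes uK.
have [Pp _ _] := cf; have [Qp _ _] := cg.
have [|n hn] := pd_le_subquot uL.1; last first.
  apply: (iR n.+2); exists K; split; first by exists P, i, f.
  by exists L; split=> //; exists Q, l, g.
move=> T sT TL; apply: contrapT => iT; apply: nT; exists T; split=> // [n hn|].
  by apply: iT; exists n.
by exists P, K, Q, L, i, f, l, g.
Qed.

Lemma infinite_id_factor R : simple_module R -> (forall n, ~ id_le n R) ->
  exists T, [/\ simple_module T, forall n, ~ id_le n T & second_cosyzygy_factor
    R T].
Proof.
move=> sR iR; apply: contrapT => nT.
have [P [K [i [f [cf s uP uK]]]]] := uniserial_cosyzygy finA decomposes
  (uniserial_simple sR).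
have [Q [L [l [g [cg sl uQ uL]]]]] := uniserial_cosyzygy finA decomposes uK.
have [Pp _ _] := cf; have [Qp _ _] := cg.
have [|n hn] := id_le_subquot uL.1; last first.
  apply: (iR n.+2); exists K; split; first by exists P, i, f.
  by exists L; split=> //; exists Q, l, g.
move=> T sT TL; apply: contrapT => iT; apply: nT; exists T; split=> // [n hn|].
  by apply: iT; exists n.
by exists P, K, Q, L, i, f, l, g.
Qed.

(** * Finiteness of the dimensions of [M_S] and [N_S] *)

(** [I] is the quotient [Q / Y'] for the predecessor [R] of [S].  A composition
    factor [T] of [Y'] of infinite projective dimension is a successor of [R],
    hence isomorphic to [S].  Its envelope [B2] is then a quotient of [Q] that
    is isomorphic to [Q / Y'] and maps onto it with nonzero kernel. *)
Lemma envelope_pd_finite S I (e : {linear S -> I}) : simple_module S ->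
  (forall n, ~ pd_le n S) -> injective_envelope e -> exists n, pd_le n I.
Proof.
move=> sS iS env.
have [R [sR eRS Runiq]] := simple_graph finA infinite_pd_factor
  second_syzygy_factor_iso second_syzygy_factor_unique sS iS.
have [P [K [Q [L [i [f [l [g [[Pp uP] s [cg uQ] sl [Y [a [b [aI bS]]]]]]]]]]]]]
  := eRS.
have [B [q [t [r [[qS qE rE] [tI tE rt] Bi uB K0]]]]] :=
  injective_quotient sR Pp uP s cg uQ sl sS aI bS.
have envB := chained_envelope Bi tI uB.2 sS.1.
have [Qp _ _] := cg; have [lI _ _] := sl.
have [Y' [c sc]] := short_exact_ker qS; have [cI _ _] := sc.
have [|d dE] := factor_inj lI (f := c).
  by move=> x; have /qE[y [_ <-]] := short_exact0 x sc; exists (a y).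
have dI : injective d.
  by apply: inj0 => x dx; apply: (inj0P cI); rewrite -dE dx linear0.
have [||n hn] := @pd_le_subquot Y'; [exact: finite_length_sub uQ.1 cI| |];
  last first.
  exists n.+1; apply: (pd_le_iso (envelope_unique env envB)).
  by exists Y'; split=> //; exists Q, c, q.
move=> T sT TY'; apply: contrapT => iT.
have e0 : iso T S.
  apply: Runiq => // [n hn|]; first by apply: iT; exists n.
  by exists P, K, Q, L, i, f, l, g; split=> //; apply: subquot_sub dI TY'.
have [Z [a2 [b2 [a2I b2S]]]] := TY'.
have [B2 [q2 [t2 [r2 [[q2S q2E _] [t2I t2E _] B2i uB2 _]]]]] :=
  injective_quotient sR Pp uP s cg uQ sl sT (inj_comp dI a2I) b2S.
have [ph [ps [phK psK]]] := isoE e0.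
have envB2 := chained_envelope B2i (inj_comp t2I (can_inj psK)) uB2.2 sS.1.
have [be [be' [beK beK']]] := isoE (envelope_unique envB envB2).
have [|w wE] := factor_surj q2S (f := q).
  by move=> x /q2E[y [_ <-]] /=; rewrite dE (short_exact0 _ sc).
have wI : injective (be \o w : {linear B2 -> B2}).
  apply: surj_endo_inj uB2.1 _ => x; have [y yE] := qS (be' x).
  by exists (q2 y); rewrite /= wE yE beK'.
have [x x0] := (nonzeroP T).1 sT.1; apply: x0; apply: (inj0P t2I).
apply: (inj0P wI); have [y <-] := b2S x.
by rewrite /= t2E /= wE dE (short_exact0 _ sc) linear0.
Qed.

(** Dually, the projective cover of [S] is a submodule [B] of [J], and a
    composition factor [T] of [J / B] of infinite injective dimension would have
    a projective cover [B2] that contains [B] properly. *)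
Lemma cover_id_finite S P0 (e : {linear P0 -> S}) : simple_module S ->
  (forall n, ~ id_le n S) -> projective_cover e -> exists n, id_le n P0.
Proof.
move=> sS iS env.
have [R [sR eRS Runiq]] := simple_graph finA infinite_id_factor
  second_cosyzygy_factor_iso second_cosyzygy_factor_unique sS iS.
have [I [K [J [L [i [p [g [l [[Ii uI] s [cg uJ] sl SL]]]]]]]]] := eRS.
have [Y [a [b [aS bI]]]] := subquot_cosubquot SL.
have [B [c [t [r [[cI cE rE] [tS tE tr] Bp uB K0]]]]] :=
  projective_submodule sR Ii uI s cg uJ sl sS aS bI.
have envB := chained_cover Bp tS uB.2 sS.1.
have [Ji _ _] := cg; have [_ lS _] := sl.
have [Y' [q sc]] := short_exact_coker cI; have [_ qS _] := sc.
have [|d dE] := factor_surj lS (f := q).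
  by move=> x /(short_exact_lift sl)[y <-]; rewrite -rE (short_exact0 _ sc).
have dS : surjective d by move=> x; have [y <-] := qS x; exists (l y).
have [||n hn] := @id_le_subquot Y'; [exact: finite_length_quo uJ.1 qS| |];
  last first.
  exists n.+1; apply: (id_le_iso (cover_unique env envB)).
  by exists Y'; split=> //; exists J, c, q.
move=> T sT TY'; apply: contrapT => iT.
have e0 : iso T S.
  apply: Runiq => // [n hn|]; first by apply: iT; exists n.
  by exists I, K, J, L, i, p, g, l; split=> //; apply: subquot_quo dS TY'.
have [Z [a2 [b2 [a2S b2I]]]] := subquot_cosubquot TY'.
have a2dS : surjective (a2 \o d : {linear L -> Z}).
  by move=> x; have [y <-] := a2S x; have [z <-] := dS y; exists z.
have [B2 [c2 [t2 [r2 [[c2I c2E _] [t2S t2E _] B2p uB2 _]]]]] :=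
  projective_submodule sR Ii uI s cg uJ sl sT a2dS b2I.
have [ph [ps [phK psK]]] := isoE e0.
have pht2 : surjective (ph \o t2 : {linear B2 -> S}).
  by move=> x; have [y yE] := t2S (ps x); exists y; rewrite /= yE psK.
have envB2 := chained_cover B2p pht2 uB2.2 sS.1.
have [be [be' [beK beK']]] := isoE (cover_unique envB2 envB).
have [|w wE] := factor_inj c2I (f := c).
  by move=> x; apply/c2E; exists 0; rewrite /= dE (short_exact0 _ sc) !linear0.
have wS : surjective (w \o be : {linear B2 -> B2}).
  apply: inj_endo_surj uB2.1 _; apply: inj_comp; last exact: can_inj beK.
  by apply: inj0 => x wx; apply: (inj0P cI); rewrite -wE wx linear0.
have [x x0] := (nonzeroP T).1 sT.1; apply: x0.
have [y <-] := t2S x; have [z <-] := wS y.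
by apply: (inj0P b2I); rewrite t2E /= wE dE (short_exact0 _ sc) linear0.
Qed.

Lemma max_pd_MS_le_fin_pro : enat_le (max_pd_MS A) (fin_pro A).
Proof.
apply: enat_sup_le => _ [S [X [sS hX ->]]]; apply: enat_sup_ub; exists X.
case: hX => [[fin e]|[inf [e env]]].
  rewrite -(pdim_iso e); split=> //; apply: finite_length_fg;
    apply: finite_length_iso e _.
  exact: finite_length_simple.
have [I [e' [env' uI]]] := simple_envelope finA decomposes sS.
split=> //.
  by apply: finite_length_fg; apply: finite_length_iso uI.1;
    apply: envelope_unique env' env.
case: (pdimP X) => [[n [-> //]]|[_ nX]].
have [|n /nX//] := envelope_pd_finite sS _ env.
by move=> n; case: (pdimP S) inf => [[m [-> //]]|[_ +] _]; apply.
Qed.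

Lemma max_id_NS_le_fin_inj : enat_le (max_id_NS A) (fin_inj A).
Proof.
apply: enat_sup_le => _ [S [X [sS hX ->]]]; apply: enat_sup_ub; exists X.
case: hX => [[fin e]|[inf [e env]]].
  rewrite -(idim_iso e); split=> //; apply: finite_length_fg;
    apply: finite_length_iso e _.
  exact: finite_length_simple.
have [I [e' [env' uI]]] := uniserial_cover finA decomposes (uniserial_simple
  sS).
split=> //.
  by apply: finite_length_fg; apply: finite_length_iso uI.1;
    apply: cover_unique env' env.
case: (idimP X) => [[n [-> //]]|[_ nX]].
have [|n /nX//] := cover_id_finite sS _ env.
by move=> n; case: (idimP S) inf => [[m [-> //]]|[_ +] _]; apply.
Qed.
End Finiteness.

(** * Nakayama algebras *)

Lemma uniserial_sum_finite_length (A : nzRingType) (M : lmodType A) :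
  uniserial_sum M -> finite_length M.
Proof.
elim=> {M} [M|U X M [fU _] _ fX /iso_sym e]; first exact: finite_length_zero.
by apply: finite_length_iso e _; apply: finite_length_prod.
Qed.

(** Left ideals of [A] are [k]-submodules. *)
Lemma artin_algebra_artinian (k : comNzRingType) (A : algType k) :
  artin_algebra A -> artinian (A^o : lmodType A).
Proof.
move=> [ak fgA] N Ncl Nd; apply: (fg_artinian ak fgA) Nd => i.
have [n0 nD] := Ncl i; split=> // a x y nx ny.
by rewrite -[x]mul1r scalerAl; apply: (nD (a *: 1) x y).
Qed.

Theorem mainTheorem5 (k : comNzRingType) (A : algType k)
    (hA : nakayama_algebra A) :
  [/\ fin_pro A = fin_inj A,
      fin_inj A = del_alg A,
      del_alg A = des_alg A,
      des_alg A = max_pd_MS A &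
      max_pd_MS A = max_id_NS A].
Proof.
have [/artin_algebra_artinian aA ser] := hA.
have fgA : finitely_generated (A^o : lmodType A).
  apply/fgP; exists 1%N, (fun=> 1) => x; exists (fun=> x).
  by rewrite big_ord1 /GRing.scale /= mulr1.
have finA := uniserial_sum_finite_length (artinian_uniserial_sum ser aA fgA).
have fds (M : lmodType A) : finite_length M -> uniserial_sum M.
  by move=> /finite_length_fg fgM; apply: artinian_uniserial_sum => //;
    apply: fg_artinian.
have h1 := fin_inj_le_del finA.
have h2 := del_le_max_pd_MS finA fds.
have h3 := max_pd_MS_le_fin_pro finA fds.
have h4 := fin_pro_le_des finA fds.
have h5 := des_le_max_id_NS finA fds.
have h6 := max_id_NS_le_fin_inj finA fds.
have h12 := enat_le_trans h1 h2.
have h56 := enat_le_trans h5 h6.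
have e1 : fin_pro A = fin_inj A.
  by apply: enat_le_anti; [exact: enat_le_trans h4 h56|exact: enat_le_trans h12
    h3].
have e2 : fin_inj A = del_alg A.
  apply: enat_le_anti h1 _; apply: enat_le_trans h2 _.
  by rewrite -e1.
have e3 : fin_pro A = des_alg A.
  by apply: enat_le_anti h4 _; apply: enat_le_trans h56 _; rewrite e1;
    apply: enat_le_refl.
have e4 : fin_pro A = max_pd_MS A.
  by apply: enat_le_anti h3; rewrite e1.
have e5 : fin_inj A = max_id_NS A.
  by apply: enat_le_anti h6; rewrite -e1 e3.
by rewrite -e2 -e3 -e4 -e5 e1.
Qed.
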